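(* Let $r\in\{0,\dots,d-1\}$, $\beta_b\in(0,1]$, $L_b\ge0$, $C>0$. There is a constant $C_{d,r+1}>1$ depending only on $d$ and $r+1$ such that the following holds. Let $(h_n)$ be block sizes with $h_n\to0$ as $n\to\infty$ and $nh_n\ge2(r+1)C_{d,r+1}$, let $(c_n)_{n\in\mathbb N}$ be a sequence with $c_n\to\infty$, and consider the test $\varphi_{\alpha,n}=\mathbf 1(T_{n,h_n}>\kappa_{\alpha,n})$ with critical values $$\kappa_{\alpha,n}=c_n\bigl(n^{-1}h_n^{-2}+L_bn^{-1/2}h_n^{\beta_b-1/2}\bigr).$$ Let $(\hbar_n)\subset(0,1)$ with $\hbar_n/h_n\to\infty$. Then $\varphi_{\alpha,n}$ is asymptotically consistent over the local alternatives $\mathcal H_1(r,\beta_b,L_b,\hbar_n,v_n,C)$ when $v_n$ is larger than a constant multiple of $\kappa_{\alpha,n}$: there exists $c'>0$ such that $$\lim_{n\to\infty}\ \inf\Bigl\{\mathbb P_{(\Sigma,b)}(\varphi_{\alpha,n}=1)\ \Big|\ (\Sigma,b)\in\mathcal H_1(r,\beta_b,L_b,\hbar_n,c'\kappa_{\alpha,n},C)\Bigr\}=1 .$$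
   Context: Model. On a filtered probability space $(\Omega,\mathcal F,(\mathcal F_t)_{t\ge0},\mathbb P)$ let $dX(t)=b(t)\,dt+\sigma(t)\,dW(t)$, $t\in[0,1]$, be $\mathbb R^d$-valued, where $W$ is an $m$-dimensional standard Brownian motion (with respect to the filtration), $b$ is an adapted $\mathbb R^d$-valued process (measurable, so that the integrals make sense) with $\mathbb E[\int_0^1\|b(t)\|dt]<\infty$, and $\sigma(t)\in\mathbb R^{d\times m}$ is deterministic with $\int_0^1\mathrm{tr}(\sigma(t)\sigma(t)^\top)dt<\infty$. The spot covariance is $\Sigma(t)=\sigma(t)\sigma(t)^\top$. $\mathbb P_{(\Sigma,b)}$ denotes probability under the model with spot covariance $\Sigma$ and drift $b$. Observations $X(i/n)$, $i=0,\dots,n$. Block length $h\in(0,1]$ (here $h=h_n$) with $nh,h^{-1}\in\mathbb N$; blocks $I_k=[kh,(k+1)h]$, $k=0,\dots,h^{-1}-1$. $\Delta X_{ik}=X(kh+i/n)-X(kh+(i-1)/n)$, $i=1,\dots,nh$. With $v^{\otimes2}=vv^\top$, the re-centred estimator is $$\hat\Sigma^{kh}=h^{-1}\sum_{i=1}^{nh}\Bigl(\Delta X_{ik}-(nh)^{-1}\sum_{j=1}^{nh}\Delta X_{jk}\Bigr)^{\otimes2}.$$ $\lambda_1(A)\ge\dots\ge\lambda_d(A)$ are the ordered eigenvalues of a symmetric matrix $A$. The test statistic is $T_{n,h}=\sum_{k=0}^{h^{-1}-1}h\,\lambda_{r+1}(\hat\Sigma^{kh})$. Classes. $\mathbb R^{d\times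 d}_{\mathrm{spd}}$ is the set of symmetric positive semi-definite matrices. $\mathcal H^{\beta_b}(L_b)$ is the class of adapted $\mathbb R^d$-valued processes $b$ on $[0,1]$ with $\mathbb E[\int_0^1\|b(t)\|dt]<\infty$ and $\mathbb E[\|b(s)-b(t)\|^4]^{1/4}\le L_b|s-t|^{\beta_b}$ for all $0\le t\le s\le1$. For $\hbar\in(0,1)$, $v,C>0$, $\mathcal H_1(r,\beta_b,L_b,\hbar,v,C)$ is the set of $(\Sigma,b)\in C([0,1];\mathbb R^{d\times d}_{\mathrm{spd}})\times\mathcal H^{\beta_b}(L_b)$ such that $$\sup_{I\subseteq[0,1],\,|I|\ge\hbar}|I|\min_{t\in I}\lambda_{r+1}(\Sigma(t))\ge v\quad\text{and}\quad\mathrm{tr}\Bigl(\int_0^1\Sigma(t)\,dt\Bigr)\le C,$$ the supremum being over intervals $I$ of length $|I|$. An infimum of probabilities over an empty class is read as $1$. *)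

(* Defs.v *)
From HB Require Import structures.
From mathcomp Require Import all_boot all_order all_algebra.
From mathcomp Require Import all_classical all_reals all_analysis.

Set Implicit Arguments.
Unset Strict Implicit.
Unset Printing Implicit Defensive.

Import Order.TTheory GRing.Theory Num.Theory.
Import numFieldNormedType.Exports.

Local Open Scope classical_set_scope.
Local Open Scope ring_scope.

(** * Linear algebra *)
Section LinearAlgebra.
Variable R : realType.

(* The library norm on matrices is the sup norm, hence these Euclidean and
   Frobenius versions. *)
Definition enorm (d : nat) (v : 'cV[R]_d) : R :=
  Num.sqrt (\sum_i v i 0 ^+ 2).

Definition frob2 (d m : nat) (A : 'M[R]_(d, m)) : R :=
  \sum_i \sum_j A i j ^+ 2.

Definition outer (d : nat) (v : 'cV[R]_d) : 'M[R]_d := v *m v^T.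

Definition psd (d : nat) (A : 'M[R]_d) : Prop :=
  A^T = A /\ forall x : 'cV[R]_d, 0 <= (x^T *m A *m x) 0 0.

(* The eigenvalues with multiplicity, in nonincreasing order: such a list is
   unique, and for symmetric A it exists by the spectral theorem (the default
   [::] is only used for matrices whose spectrum is not real). *)
Definition eigenvalues (d : nat) (A : 'M[R]_d) : seq R :=
  xget [::] [set s : seq R |
    sorted >=%R s /\ char_poly A = \prod_(x <- s) ('X - x%:P)].

(* k-th largest eigenvalue, numbered from k = 1. *)
Definition lambda (d k : nat) (A : 'M[R]_d) : R := (eigenvalues A)`_k.-1.

End LinearAlgebra.

(** * Filtrations, Brownian motion and the Ito process *)
Section Model.
Context (disp : measure_display) (T : measurableType disp) (R : realType).

Definition filtration (F : R -> set (set T)) : Prop :=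
  (forall t : R, 0 <= t -> sigma_algebra [set: T] (F t) /\ F t `<=` measurable) /\
  (forall s t : R, 0 <= s -> s <= t -> F s `<=` F t).

(* Measurability of the random vector Y with respect to G. *)
Definition vec_measurable (G : set (set T)) (d : nat) (Y : T -> 'cV[R]_d) :
    Prop :=
  forall (i : 'I_d) (B : set (measurableTypeR R)), measurable B ->
    G [set w | B (Y w i 0)].

Definition path_continuous (d : nat) (D : set R) (f : R -> 'cV[R]_d) : Prop :=
  forall i : 'I_d, {within D, continuous (fun t => f t i 0)}.

Definition in_box (m : nat) (B : 'I_m -> set (measurableTypeR R))
    (v : 'cV[R]_m) : Prop :=
  forall j : 'I_m, B j (v j 0).

(* Borel boxes form a pi-system generating the Borel sets of R^m, so the last
   two clauses say that W(t) - W(s) is N(0, (t - s) I_m)-distributed and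
   independent of F_s.  The second parameter of [normal_prob] is the standard
   deviation. *)
Definition brownian (P : probability T R) (F : R -> set (set T)) (m : nat)
    (W : R -> T -> 'cV[R]_m) : Prop :=
  [/\ {ae P, forall w, W 0 w = 0},
      forall t : R, 0 <= t -> vec_measurable (F t) (W t),
      {ae P, forall w, path_continuous `[0, +oo[ (W ^~ w)},
      forall (s t : R) (B : 'I_m -> set (measurableTypeR R)),
        0 <= s -> s < t -> (forall j, measurable (B j)) ->
        P [set w | in_box B (W t w - W s w)] =
        (\prod_(j < m) normal_prob 0 (Num.sqrt (t - s)) (B j))%E &
      forall (s t : R) (A : set T) (B : 'I_m -> set (measurableTypeR R)),
        0 <= s -> s < t -> F s A -> (forall j, measurable (B j)) ->
        P (A `&` [set w | in_box B (W t w - W s w)]) =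
        (P A * P [set w | in_box B (W t w - W s w)])%E].

(* A list of triples ((u, v), A) encodes the deterministic step function
   sum of the 1_(]u, v]) A. *)
Definition step_seq (d m : nat) : Type := seq ((R * R) * 'M[R]_(d, m)).

Definition step_within (d m : nat) (a b : R) (l : step_seq d m) : bool :=
  all (fun e : (R * R) * 'M[R]_(d, m) =>
         [&& a <= e.1.1, e.1.1 <= e.1.2 & e.1.2 <= b]) l.

Definition step_fun (d m : nat) (l : step_seq d m) (s : R) : 'M[R]_(d, m) :=
  \sum_(e <- l) (e.1.1 < s <= e.1.2)%R%:R *: e.2.

Definition step_integral (d m : nat) (W : R -> T -> 'cV[R]_m)
    (l : step_seq d m) (w : T) : 'cV[R]_d :=
  \sum_(e <- l) e.2 *m (W e.1.2 w - W e.1.1 w).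

(* Y is (a version of) the Ito integral of the deterministic sigma against W
   over [a, b], as an L^2-limit of integrals of step functions; by the Ito
   isometry Y is determined up to a null set. *)
Definition is_wiener_integral (P : probability T R) (d m : nat)
    (W : R -> T -> 'cV[R]_m) (sigma : R -> 'M[R]_(d, m)) (a b : R)
    (Y : T -> 'cV[R]_d) : Prop :=
  vec_measurable measurable Y /\
  exists l : nat -> step_seq d m,
    [/\ forall k, step_within a b (l k),
        (\int[lebesgue_measure]_(s in `[a, b])
            (frob2 (step_fun (l k) s - sigma s))%:E)%E @[k --> \oo] --> 0%E &
        (\int[P]_w (enorm (step_integral W (l k) w - Y w) ^+ 2)%:E)%E
          @[k --> \oo] --> 0%E].

(* Standing assumptions on the deterministic volatility. *)
Definition volatility (d m : nat) (sigma : R -> 'M[R]_(d, m)) : Prop :=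
  (forall i j, measurable_fun (`[0, 1] : set (measurableTypeR R))
     (fun t => sigma t i j)) /\
  (\int[lebesgue_measure]_(t in `[0%R, 1%R])
     (\tr (sigma t *m (sigma t)^T))%:E < +oo)%E.

(* Standing assumptions on the drift. *)
Definition drift (P : probability T R) (F : R -> set (set T)) (d : nat)
    (b : R -> T -> 'cV[R]_d) : Prop :=
  [/\ forall t : R, 0 <= t <= 1 -> vec_measurable (F t) (b t),
      forall i : 'I_d, measurable_fun
        ((`[0, 1] : set (measurableTypeR R)) `*` [set: T])
        (fun x : measurableTypeR R * T => b x.1 x.2 i 0) &
      (\int[P]_w \int[lebesgue_measure]_(t in `[0%R, 1%R])
         (enorm (b t w))%:E < +oo)%E].

(* dX(t) = b(t) dt + sigma(t) dW(t) on [0, 1]. *)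
Definition is_ito_process (P : probability T R) (d m : nat)
    (W : R -> T -> 'cV[R]_m) (b : R -> T -> 'cV[R]_d)
    (sigma : R -> 'M[R]_(d, m)) (X : R -> T -> 'cV[R]_d) : Prop :=
  [/\ forall t : R, 0 <= t <= 1 -> vec_measurable measurable (X t),
      {ae P, forall w, path_continuous `[0, 1] (X ^~ w)} &
      forall t : R, 0 <= t <= 1 -> exists J : T -> 'cV[R]_d,
        is_wiener_integral P W sigma 0 t J /\
        {ae P, forall w, X t w =
          X 0 w
          + (\col_i (\int[lebesgue_measure]_(s in `[0, t]) b s w i 0)%R)
          + J w}].

(** * The classes *)

Definition holder_drift (P : probability T R) (F : R -> set (set T)) (d : nat)
    (beta L : R) (b : R -> T -> 'cV[R]_d) : Prop :=
  drift P F b /\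
  forall s t : R, 0 <= t -> t <= s -> s <= 1 ->
    ((\int[P]_w (enorm (b s w - b t w) ^+ 4)%:E) `^ (4^-1)
      <= (L * `|s - t| `^ beta)%:E)%E.

(* Intervals are closed, so that the minimum over I is attained for the
   continuous Sigma; it is then the infimum. *)
Definition signal_strength (d r : nat) (hbar : R) (Sigma : R -> 'M[R]_d) :
    \bar R :=
  ereal_sup [set ((z.2 - z.1)%:E *
      ereal_inf [set (lambda r.+1 (Sigma t))%:E | t in `[z.1, z.2]])%E
    | z in [set z : R * R |
              [/\ 0 <= z.1, z.1 <= z.2, z.2 <= 1 & hbar <= z.2 - z.1]]].

Definition H1_class (P : probability T R) (F : R -> set (set T)) (d r : nat)
    (beta L hbar v C : R) (Sigma : R -> 'M[R]_d) (b : R -> T -> 'cV[R]_d) :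
    Prop :=
  [/\ {within `[0, 1], continuous Sigma} /\
      (forall t : R, 0 <= t <= 1 -> psd (Sigma t)),
      holder_drift P F beta L b,
      (v%:E <= signal_strength r hbar Sigma)%E &
      \tr (\matrix_(i, j)
        (\int[lebesgue_measure]_(t in `[0, 1]) Sigma t i j)%R) <= C].

End Model.

(** * The statistic and the test *)
Section Test.
Variables (R : realType) (d : nat).

(* The numbers h^-1 of blocks and nh of increments per block are assumed to be
   natural numbers whenever these definitions are used. *)
Definition nblocks (h : R) : nat := Num.truncn h^-1.
Definition blocksize (n : nat) (h : R) : nat := Num.truncn (n%:R * h).

Definition increment (n : nat) (h : R) (x : R -> 'cV[R]_d) (i k : nat) :
    'cV[R]_d :=
  x (k%:R * h + i%:R / n%:R) - x (k%:R * h + (i%:R - 1) / n%:R).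

Definition Sigma_hat (n : nat) (h : R) (x : R -> 'cV[R]_d) (k : nat) :
    'M[R]_d :=
  h^-1 *: \sum_(1 <= i < (blocksize n h).+1)
    outer (increment n h x i k
           - (n%:R * h)^-1 *: \sum_(1 <= j < (blocksize n h).+1)
                                 increment n h x j k).

Definition test_stat (r n : nat) (h : R) (x : R -> 'cV[R]_d) : R :=
  \sum_(0 <= k < nblocks h) h * lambda r.+1 (Sigma_hat n h x k).

Definition test (r n : nat) (h kappa : R) (x : R -> 'cV[R]_d) : nat :=
  (kappa < test_stat r n h x)%R.

End Test.

Definition critical_value (R : realType) (beta L : R) (h c : nat -> R)
    (n : nat) : R :=
  c n * (n%:R^-1 * h n ^- 2
         + L * n%:R `^ (- 2^-1) * h n `^ (beta - 2^-1)).

(* The rejection probabilities over all realisations of the model with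
   (Sigma, b) in H1.  As Sigma does not determine its square root sigma, every
   sigma with Sigma = sigma sigma^T is included. *)
Definition H1_powers (disp : measure_display) (T : measurableType disp)
    (R : realType) (P : probability T R) (F : R -> set (set T))
    (d m r : nat) (W : R -> T -> 'cV[R]_m) (beta L hbar v C : R)
    (phi : (R -> 'cV[R]_d) -> nat) : set (\bar R) :=
  [set p | exists (Sigma : R -> 'M[R]_d) (b : R -> T -> 'cV[R]_d)
             (sigma : R -> 'M[R]_(d, m)) (X : R -> T -> 'cV[R]_d),
    [/\ H1_class P F r beta L hbar v C Sigma b,
        volatility sigma,
        forall t : R, 0 <= t <= 1 -> Sigma t = sigma t *m (sigma t)^T,
        is_ito_process P W b sigma X &
        p = P [set w | phi (X ^~ w) = 1%N]]].

(* Infimum of a set of probabilities, equal to 1 for the empty set; adding the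
   element 1 does not change the infimum of a nonempty one. *)
Definition inf_prob (R : realType) (A : set (\bar R)) : \bar R :=
  ereal_inf (1%E |` A).

(* Main.v *)
Require Import Defs.
From HB Require Import structures.
From mathcomp Require Import all_boot all_order all_algebra.
From mathcomp Require Import fingroup perm complex.
From mathcomp Require Import ring lra zify.
From mathcomp Require Import all_classical all_reals all_analysis.
From mathcomp Require Import measurable_realfun.

Set Implicit Arguments.
Unset Strict Implicit.
Unset Printing Implicit Defensive.

Import Order.TTheory GRing.Theory Num.Theory.
Import numFieldNormedType.Exports.

Local Open Scope classical_set_scope.
Local Open Scope ring_scope.

(* For a drift-free process the second differences
     Z_i = X((i+2)/n) - 2 X((i+1)/n) + X(i/n)
   over disjoint windows are independent Gaussian vectors, and the re-centring of
   the estimator does not affect them.  Group r+1 such differences inside a block.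
   As d * lambda_{r+1} dominates the sum of the d-r lowest eigenvalues, which is the
   energy outside an r-dimensional space, and r+1 vectors in general position are
   not close to any such space, each group contributes at least a constant
   times e to h * lambda_{r+1} of the estimator on its block as soon as every Z_j of
   the group has squared distance at least e to the span of the other r.  By anti-concentration of Gaussian vectors
   this has probability at least 1/2 for e of order mu / n, where mu is a lower bound
   of lambda_{r+1}(Sigma) on the interval considered; by independence of the groups and
   Chebyshev's inequality a quarter of them succeed with high probability.  The signal
   is then a constant times |I| mu, hence larger than kappa.  The drift enters the
   second differences only through its increments and is absorbed by Markov's
   inequality, since n kappa tends to infinity. *)

(** * Spectral theory of real symmetric matrices *)

(** The obstacle is that [is_wiener_integral] gives each grid time its own L2 limit of step
    integrals, so neither joint Gaussianity nor independence of the second differences is directly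
    at hand. Both are recovered by cutting one step function, close to [sigma] on all of [0, 1], at
    every grid time: the resulting second differences are exact combinations of finitely many
    Brownian increments, disjoint for disjoint windows, and replace the true ones up to an error as
    small as desired. Their distribution enters only through expectations of the heat kernel, so no
    general theory of Gaussian vectors is required. Spans of random vectors are handled by
    [proj_compl], a projection whose trace, at least d - r for r vectors, stands for the
    codimension; this is what turns a lower bound of lambda_{r+1}(Sigma) into a lower bound of the
    variance left after projection. The final bound 1 - ((16 (1 + L^4) + 1) / c_n + 32 h_n / hbar_n)
    depends neither on the probability space nor on (Sigma, b), hence the uniformity over the
    class. *)

Lemma mulmx_tr_row_ge0 (R : realType) n (v : 'rV[R]_n) : 0 <= (v *m v^T) 0 0.
Proof. by rewrite mxE sumr_ge0// => i _; rewrite mxE -expr2 sqr_ge0. Qed.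

Lemma mulmx_tr_row_eq0 (R : realType) n (v : 'rV[R]_n) :
  ((v *m v^T) 0 0 == 0) = (v == 0).
Proof.
apply/idP/eqP => [|->]; last by rewrite mul0mx mxE.
rewrite mxE psumr_eq0 => [/allP v0|i _]; last by rewrite mxE -expr2 sqr_ge0.
apply/rowP => i; have := v0 i (mem_index_enum _).
by rewrite !mxE -expr2 sqrf_eq0 => /eqP.
Qed.

Lemma mulmx_trC (R : realType) n (u v : 'rV[R]_n) :
  u *m v^T = v *m u^T.
Proof.
apply/matrixP => i j; rewrite !ord1 !mxE; apply: eq_bigr => k _.
by rewrite !mxE mulrC.
Qed.

(** Over the algebraically closed field R[i] there is an eigenvector x + iy, with eigenvalue a + ib.
    Comparing x M y^T with y M x^T gives b (|x|^2 + |y|^2) = 0, so b = 0 and whichever of x, y is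
    nonzero is a real eigenvector. *)
Lemma sym_eigenvector (R : realType) n (M : 'M[R]_n) : (0 < n)%N -> M^T = M ->
  exists a (v : 'rV[R]_n), v != 0 /\ v *m M = a *: v.
Proof.
move=> n0 Msym.
have [a /eigenvalueP[v vM v0]] := eigenvalue_closed (map_mx (real_complex R) M) n0.
pose x := map_mx (@complex.Re R) v; pose y := map_mx (@complex.Im R) v.
have sumRe (I : finType) (F : I -> R[i]) : complex.Re (\sum_i F i) = \sum_i complex.Re (F i).
  by elim/big_rec2 : _ => // i b c _ <-; case: (F i); case: c.
have sumIm (I : finType) (F : I -> R[i]) : complex.Im (\sum_i F i) = \sum_i complex.Im (F i).
  by elim/big_rec2 : _ => // i b c _ <-; case: (F i); case: c.
have xM : x *m M = complex.Re a *: x - complex.Im a *: y.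
  apply/rowP => j; have /rowP/(_ j) /(congr1 (@complex.Re R)) := vM.
  rewrite !mxE sumRe => /= e.
  transitivity (complex.Re (a * v ord0 j)); last by case: (a); case: (v ord0 j).
  rewrite -e; apply: eq_bigr => k _; rewrite !mxE; case: (v ord0 k) => p q /=.
  by rewrite mulr0 subr0.
have yM : y *m M = complex.Im a *: x + complex.Re a *: y.
  apply/rowP => j; have /rowP/(_ j) /(congr1 (@complex.Im R)) := vM.
  rewrite !mxE sumIm => /= e.
  transitivity (complex.Im (a * v ord0 j)).
    rewrite -e; apply: eq_bigr => k _; rewrite !mxE; case: (v ord0 k) => p q /=.
    by rewrite mulr0 add0r.
  by case: (a); case: (v ord0 j) => p q p' q' /=; ring.
have xy0 : (x != 0) || (y != 0).
  rewrite -negb_and; apply: contra v0 => /andP[/eqP x0 /eqP y0].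
  apply/eqP/rowP => j; move/rowP/(_ j): x0; move/rowP/(_ j): y0.
  by rewrite !mxE; case: (v ord0 j) => p q /= -> ->.
have b0 : complex.Im a = 0.
  have e : x *m M *m y^T = y *m M *m x^T.
    by rewrite mulmx_trC trmx_mul Msym mulmxA.
  have : complex.Im a * ((x *m x^T) 0 0 + (y *m y^T) 0 0) = 0.
    have : (x *m M *m y^T) 0 0 = (y *m M *m x^T) 0 0 by rewrite e.
    rewrite xM yM mulmxBl mulmxDl -!scalemxAl (mulmx_trC y x).
    have mxD (A B : 'M[R]_1) : (A + B) 0 0 = A 0 0 + B 0 0 by rewrite mxE.
    have mxN (A : 'M[R]_1) : (- A) 0 0 = - A 0 0 by rewrite mxE.
    have mxZ c (A : 'M[R]_1) : (c *: A) 0 0 = c * A 0 0 by rewrite mxE.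
    by rewrite !(mxD, mxN, mxZ); lra.
  move/eqP; rewrite mulf_eq0 => /orP[/eqP //|].
  rewrite paddr_eq0 ?mulmx_tr_row_ge0// !mulmx_tr_row_eq0 => /andP[x0 y0].
  by move: xy0; rewrite x0 y0.
move: xM yM; rewrite b0 !scale0r subr0 add0r => xM yM.
by case/orP: xy0 => ?; [exists (complex.Re a), x|exists (complex.Re a), y].
Qed.

(** For v other than the first basis vector e, this is the reflection along w = v - e, which
    exchanges v and e. It serves to split off an eigenvector in an induction on the dimension. *)
Lemma householder (R : realType) n (v : 'rV[R]_(1 + n)) : v *m v^T = 1%:M ->
  exists H : 'M[R]_(1 + n), [/\ H^T = H, H *m H = 1%:M & row 0 H = v].
Proof.
move=> v1; pose e : 'rV[R]_(1 + n) := delta_mx 0 0.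
have e1 : e *m e^T = 1%:M.
  apply/matrixP => i j; by rewrite !ord1 trmx_delta mul_delta_mx !mxE.
have [->|ve] := eqVneq v e.
  by exists 1%:M; rewrite trmx1 mul1mx; split => //; rewrite row1.
pose w := v - e; pose s : R := (w *m w^T) 0 0.
have s0 : s != 0 by rewrite mulmx_tr_row_eq0 subr_eq0.
pose k := 2 / s.
have wwT : w *m w^T = s%:M by apply/matrixP => i j; rewrite !ord1 [RHS]mxE eqxx mulr1n.
have ewT : k *: (e *m w^T) = - 1%:M.
  have : s%:M = 2%:M - 2 *: (e *m v^T).
    rewrite -wwT /w [(v - e)^T]linearB/= mulmxBl !mulmxBr v1 e1 (mulmx_trC v e).
    by move: (e *m v^T) => p; apply/matrixP => i j; rewrite !ord1 !mxE eqxx !mulr1n; lra.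
  move=> se; rewrite [(v - e)^T]linearB/= mulmxBr e1; move: (e *m v^T) se => p se.
  apply/matrixP => i j; rewrite !ord1 !mxE eqxx/=.
  move/matrixP/(_ 0 0) : se; rewrite !mxE eqxx !mulr1n => se.
  have -> : p 0 0 - 1 = - (s / 2) by lra.
  by rewrite /k; field.
have we : w + e = v by rewrite /w subrK.
clearbody w; exists (1%:M - k *: (w^T *m w)); split.
- by rewrite linearB/= trmx1 linearZ/= trmx_mul trmxK.
- have QQ : (w^T *m w) *m (w^T *m w) = s *: (w^T *m w).
    by rewrite mulmxA -(mulmxA w^T w) wwT mul_mx_scalar -scalemxAl.
  rewrite mulmxBl mul1mx mulmxBr mulmx1 -!scalemxAl -!scalemxAr QQ !scalerA.
  by apply/matrixP => i j; rewrite !mxE /k; field.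
- have -> : row 0 (1%:M - k *: (w^T *m w)) = e *m (1%:M - k *: (w^T *m w)).
    by rewrite -rowE.
  rewrite mulmxBr mulmx1 -scalemxAr mulmxA scalemxAl ewT mulNmx mul1mx.
  by rewrite opprK addrC.
Qed.

(** Deflation: conjugation by a reflection whose first row is a unit eigenvector leaves the
    eigenvalue in the corner and zeros in the rest of the first row and column; the remaining block
    is symmetric and of size one less. *)
Lemma sym_diagonalization (R : realType) n (M : 'M[R]_n) : M^T = M ->
  exists (U : 'M[R]_n) (D : 'rV[R]_n),
    U *m U^T = 1%:M /\ M = U^T *m diag_mx D *m U.
Proof.
elim: n M => [|n IH] M Msym.
  by exists 1%:M, 0; rewrite trmx1 mulmx1; split => //; apply/matrixP => -[].
have [a [x [x0 xM]]] := sym_eigenvector (ltn0Sn n) Msym.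
pose c := (Num.sqrt ((x *m x^T) 0 0))^-1.
pose v := c *: x.
have v1 : v *m v^T = 1%:M.
  apply/matrixP => i j; rewrite !ord1 /v [(c *: x)^T]linearZ/= -scalemxAl -scalemxAr scalerA.
  rewrite [LHS]mxE [RHS]mxE eqxx mulr1n -expr2 exprVn sqr_sqrtr ?mulmx_tr_row_ge0//.
  by rewrite mulVf// mulmx_tr_row_eq0.
have vM : v *m M = a *: v by rewrite /v -scalemxAl xM scalerA mulrC -scalerA.
have [H [Hsym HH Hv]] := @householder R n v v1.
have [N NH] : exists N : 'M[R]_(1 + n), N = H *m M *m H by exists (H *m M *m H).
have Nsym : N^T = N by rewrite NH !trmx_mul Hsym Msym mulmxA.
have rowN : row 0 N = a *: delta_mx 0 0.
  rewrite NH !row_mul Hv vM -scalemxAl -Hv -row_mul HH; by rewrite row1.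
have N0 : ursubmx N = 0.
  apply/matrixP => i j; move/rowP/(_ (rshift 1 j)) : rowN.
  rewrite !ord1 !mxE/= mulr0 => <-; congr (N _ _); exact: val_inj.
have N1 : dlsubmx N = 0.
  by rewrite -Nsym -trmx_ursub N0 trmx0.
have N2 : ulsubmx N = a%:M.
  apply/matrixP => i j; move/rowP/(_ (lshift n 0)) : rowN.
  rewrite !ord1 !mxE/= mulr1 => <-; congr (N _ _); exact: val_inj.
have [U' [D' [U1 N'E]]] : exists (U : 'M[R]_n) (D : 'rV[R]_n),
    U *m U^T = 1%:M /\ drsubmx N = U^T *m diag_mx D *m U.
  by apply: IH; rewrite -[in RHS]Nsym trmx_drsub.
pose U0 : 'M[R]_(1 + n) := block_mx 1%:M 0 0 U'.
have NE : N = U0^T *m diag_mx (row_mx a%:M D') *m U0.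
  rewrite -(submxK N) N0 N1 N2 N'E /U0 tr_block_mx diag_mx_row !mulmx_block.
  rewrite !trmx1 !trmx0 !(mul0mx, mulmx0, addr0, add0r, mul1mx, mulmx1).
  by congr block_mx; apply/matrixP => i j; rewrite !ord1 !mxE eqxx.
have U01 : U0 *m U0^T = 1%:M.
  rewrite /U0 tr_block_mx mulmx_block !trmx1 !trmx0.
  by rewrite !(mul0mx, mulmx0, addr0, add0r, mul1mx, mulmx1) U1 -scalar_mx_block.
exists (U0 *m H), (row_mx a%:M D'); split.
  by rewrite trmx_mul Hsym -mulmxA (mulmxA H) HH mul1mx.
have -> : M = H *m N *m H by rewrite NH !mulmxA HH mul1mx -mulmxA HH mulmx1.
by rewrite NE trmx_mul Hsym !mulmxA.
Qed.

(** [eigenvalues] is an [xget]; the sorted diagonal of [D] is a list with the required property,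
    which excludes the default, and unique factorisation into linear polynomials fixes the list up
    to a permutation. *)
Lemma eigenvalues_spec (R : realType) d (M U : 'M[R]_d) (D : 'rV[R]_d) :
  U *m U^T = 1%:M -> M = U^T *m diag_mx D *m U ->
  perm_eq (eigenvalues M) [seq D 0 i | i <- enum 'I_d] /\
  sorted >=%R (eigenvalues M).
Proof.
move=> U1 ME.
have cpM : char_poly M = \prod_(x <- [seq D 0 i | i <- enum 'I_d]) ('X - x%:P).
  have U2 : U^T *m U = 1%:M by apply: mulmx1C.
  have -> : \prod_(x <- [seq D 0 i | i <- enum 'I_d]) ('X - x%:P) = char_poly (diag_mx D).
    rewrite big_map char_poly_trig ?diag_mx_is_trig// big_enum/=.
    by apply: eq_bigr => i _; rewrite mxE eqxx mulr1n.
  rewrite /char_poly /char_poly_mx.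
  have -> : 'X%:M - map_mx polyC M =
      map_mx polyC U^T *m ('X%:M - map_mx polyC (diag_mx D)) *m map_mx polyC U.
    rewrite mulmxBr mulmxBl -!map_mxM/= -ME; congr (_ - _).
    by rewrite mul_mx_scalar -scalemxAl -map_mxM/= U2 map_mx1 scalemx1.
  rewrite !det_mulmx mulrAC -det_mulmx -map_mxM/= U2 map_mx1 det1 mul1r //.
have sE : eigenvalues M \in
    [set s : seq R | sorted >=%R s /\ char_poly M = \prod_(x <- s) ('X - x%:P)].
  rewrite /eigenvalues; case: xgetP => [s -> sP|/(_ (sort >=%R [seq D 0 i | i <- enum 'I_d]))].
    by rewrite inE.
  case; split; first by apply: sort_sorted => x y; rewrite /= orbC; exact: le_total.
  by rewrite cpM; apply: perm_big; rewrite perm_sym perm_sort.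
move: sE; rewrite inE => -[sE cp]; split => //.
by apply: prod_XsubC_eq; rewrite -cp cpM.
Qed.

Lemma sym_spectral (R : realType) d (M : 'M[R]_d) : M^T = M ->
  exists U : 'M[R]_d, [/\ U *m U^T = 1%:M,
    M = U^T *m diag_mx (\row_i lambda i.+1 M) *m U &
    forall i j : 'I_d, (i <= j)%N -> lambda j.+1 M <= lambda i.+1 M].
Proof.
move=> Msym; have [U [D [U1 ME]]] := sym_diagonalization Msym.
have [ps ss] := eigenvalues_spec U1 ME.
have psD : perm_eq (eigenvalues M) [tuple D 0 i | i < d] by [].
have [p pE] := tuple_permP psD.
have sz : size (eigenvalues M) = d by rewrite pE size_tuple.
have lE (i : 'I_d) : lambda i.+1 M = D 0 (p i).
  rewrite /lambda pE -tnth_nth tnth_mktuple tnth_mktuple //.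
have U2 i j : \sum_k U i k * U j k = (i == j)%:R.
  move/matrixP/(_ i j) : U1; rewrite !mxE => <-.
  by apply: eq_bigr => k _; rewrite mxE.
exists (row_perm p U); split.
- apply/matrixP => i j; rewrite !mxE.
  under eq_bigr do rewrite !mxE.
  by rewrite U2 (inj_eq perm_inj).
- rewrite [LHS]ME; apply/matrixP => i j; rewrite !mxE (reindex_inj (@perm_inj _ p))/=.
  apply: eq_bigr => k _; rewrite !mul_mx_diag !mxE; congr (_ * _ * _).
  by rewrite lE.
- move=> i j ij; rewrite /lambda/=.
  have := @sorted_leq_nth _ >=%R _ _ 0 _ ss.
  apply => //.
  + by move=> x y z /= xy yz; exact: le_trans yz xy.
  + by move=> x /=.
  + by rewrite inE sz.
  + by rewrite inE sz.
Qed.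

(** * Squared Euclidean norms and orthogonal projections *)

Definition nsq (R : realType) d (v : 'cV[R]_d) : R := \sum_i v i 0 ^+ 2.

Section SquaredNorm.
Variables (R : realType) (d : nat).
Implicit Types (u v : 'cV[R]_d).

Lemma nsq_ge0 v : 0 <= nsq v.
Proof. by apply: sumr_ge0 => i _; exact: sqr_ge0. Qed.

Lemma nsq_eq0 v : (nsq v == 0) = (v == 0).
Proof.
apply/idP/eqP => [|->]; last by rewrite /nsq big1// => i _; rewrite mxE expr0n.
rewrite psumr_eq0 => [/allP v0|i _]; last by rewrite sqr_ge0.
apply/colP => i; have := v0 i (mem_index_enum _).
by rewrite !mxE sqrf_eq0 => /eqP.
Qed.

Lemma mulmx_trl_nsq v : v^T *m v = (nsq v)%:M.
Proof.
apply/matrixP => i j; rewrite !ord1 mxE [RHS]mxE eqxx mulr1n.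
by apply: eq_bigr => k _; rewrite mxE expr2.
Qed.

Lemma mxtrace_outer v : \tr (v *m v^T) = nsq v.
Proof. by rewrite mxtrace_mulC mulmx_trl_nsq mxtrace_scalar. Qed.

Lemma nsqZ a v : nsq (a *: v) = a ^+ 2 * nsq v.
Proof. by rewrite /nsq mulr_sumr; apply: eq_bigr => i _; rewrite mxE exprMn. Qed.

Lemma nsqN v : nsq (- v) = nsq v.
Proof. by rewrite /nsq; apply: eq_bigr => i _; rewrite mxE sqrrN. Qed.

Lemma nsqD_le u v : nsq (u + v) <= 2 * nsq u + 2 * nsq v.
Proof.
rewrite /nsq !mulr_sumr -big_split/=; apply: ler_sum => i _; rewrite mxE.
by have := sqr_ge0 (u i 0 - v i 0); nra.
Qed.

Lemma nsqD_ge u v : nsq u / 2 - nsq v <= nsq (u + v).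
Proof.
have := nsqD_le (u + v) (- v); rewrite addrK nsqN; lra.
Qed.

Lemma nsq_sum_le (I : finType) (x : I -> 'cV[R]_d) :
  nsq (\sum_i x i) <= #|I|%:R * \sum_i nsq (x i).
Proof.
have sqr_sum (f : I -> R) : (\sum_i f i) ^+ 2 <= #|I|%:R * \sum_i f i ^+ 2.
  have [I0|I0] := posnP #|I|.
    rewrite big1 => [|i]; first by rewrite I0 mul0r expr0n.
    by have := fintype0 i I0.
  set m := \sum_i f i.
  have : 0 <= \sum_i (#|I|%:R * f i - m) ^+ 2 by apply: sumr_ge0 => i _; exact: sqr_ge0.
  have -> : \sum_i (#|I|%:R * f i - m) ^+ 2 =
      #|I|%:R ^+ 2 * (\sum_i f i ^+ 2) - 2 * #|I|%:R * m * m + #|I|%:R * m ^+ 2.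
    have -> : 2 * #|I|%:R * m * m = \sum_i 2 * #|I|%:R * m * f i by rewrite -mulr_sumr.
    rewrite mulr_sumr -sumrB.
    have -> : #|I|%:R * m ^+ 2 = \sum_(i : I) m ^+ 2 by rewrite sumr_const mulr_natl.
    by rewrite -big_split/=; apply: eq_bigr => i _; ring.
  have : (0 : R) < #|I|%:R by rewrite ltr0n.
  move: (#|I|%:R : R) (\sum_i f i ^+ 2) => N S N0 h.
  have {}h : 0 <= N * (N * S - m ^+ 2) by nra.
  by move: h; rewrite pmulr_rge0// subr_ge0.
rewrite /nsq exchange_big/= mulr_sumr; apply: ler_sum => i _.
by rewrite summxE.
Qed.

End SquaredNorm.

Lemma nsq_orthogonal (R : realType) d n (U : 'M[R]_(n, d)) (v : 'cV[R]_d) :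
  U^T *m U = 1%:M -> nsq (U *m v) = nsq v.
Proof.
move=> U1; have := mulmx_trl_nsq (U *m v); rewrite trmx_mul -mulmxA (mulmxA U^T) U1 mul1mx.
by rewrite mulmx_trl_nsq => /matrixP/(_ 0 0); rewrite !mxE eqxx !mulr1n => ->.
Qed.

Section Projection.
Variables (R : realType) (d : nat).

Definition is_proj (P : 'M[R]_d) := P^T = P /\ P *m P = P.

Lemma nsq_proj_le (P : 'M[R]_d) (v : 'cV[R]_d) : is_proj P -> nsq (P *m v) <= nsq v.
Proof.
move=> [PT PP]; have := nsq_ge0 (v - P *m v).
have e : (v - P *m v)^T *m (v - P *m v) = v^T *m v - (P *m v)^T *m (P *m v).
  rewrite [(_ - _)^T]linearB/= !trmx_mul PT mulmxBl !mulmxBr !mulmxA.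
  by rewrite -(mulmxA v^T P P) PP subrr subr0.
move/matrixP/(_ 0 0) : e; rewrite !mulmx_trl_nsq !mxE eqxx !mulr1n => ->.
by rewrite subr_ge0.
Qed.

(* Gram-Schmidt; when [P *m o] vanishes, [0^-1 = 0] leaves P unchanged. *)
Fixpoint proj_compl (os : seq 'cV[R]_d) : 'M[R]_d :=
  if os is o :: os' then
    let P := proj_compl os' in
    P - (nsq (P *m o))^-1 *: ((P *m o) *m (P *m o)^T)
  else 1%:M.

(** Each vector removes a rank-one projection, of trace one, or nothing at all. The trace bound
    replaces a statement on ranks and is the form in which [lambda_le_trace_proj] uses it. *)
Lemma proj_complP os : [/\ is_proj (proj_compl os),
  forall o, List.In o os -> proj_compl os *m o = 0 &
  d%:R - (size os)%:R <= \tr (proj_compl os)].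
Proof.
elim: os => [|o os [[PT PP] Pos trP]] /=.
  by split => //; [split; rewrite ?trmx1 ?mul1mx|rewrite mxtrace1 subr0].
set P := proj_compl os in PT PP Pos trP *; pose v := P *m o.
have Pv : P *m v = v by rewrite /v mulmxA PP.
have vP : v^T *m P = v^T by rewrite -{1}PT -trmx_mul Pv.
rewrite -/v; pose Q := P - (nsq v)^-1 *: (v *m v^T).
have QT : Q^T = Q by rewrite /Q [(_ - _)^T]linearB/= PT [(_ *: _)^T]linearZ/= trmx_mul trmxK.
have [v0|v0] := eqVneq v 0.
  rewrite v0 mul0mx scaler0 subr0; split => //; first by move=> o' [<- //|/Pos].
  by rewrite (le_trans _ trP)// lerB// ler_nat leqW.
have n0 : nsq v != 0 by rewrite nsq_eq0.
have vo : v^T *m o = (nsq v)%:M by rewrite -vP -mulmxA -/v mulmx_trl_nsq.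
split.
- split; first exact: QT.
  have PX : P *m (v *m v^T) = v *m v^T by rewrite mulmxA Pv.
  have XP : (v *m v^T) *m P = v *m v^T by rewrite -mulmxA vP.
  have XX : (v *m v^T) *m (v *m v^T) = nsq v *: (v *m v^T).
    by rewrite mulmxA -(mulmxA v) mulmx_trl_nsq mul_mx_scalar -scalemxAl.
  rewrite mulmxBr !mulmxBl -!scalemxAr -!scalemxAl PP PX XP XX.
  by rewrite !scalerA -mulrA mulVf// mulr1 subrr subr0.
- move=> o' [<-|oo'].
    rewrite mulmxBl -scalemxAl -mulmxA vo mul_mx_scalar scalerA mulVf// scale1r.
    by rewrite subrr.
  by rewrite mulmxBl Pos// -scalemxAl -mulmxA -vP -(mulmxA v^T) Pos// !mulmx0 scaler0 subr0.
- rewrite raddfB/= mxtraceZ mxtrace_outer mulVf// -natr1 opprD addrA.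
  by rewrite lerB.
Qed.

End Projection.

(** * Eigenvalue inequalities *)

Lemma unit_row_sqr (R : realType) d (U : 'M[R]_d) : U *m U^T = 1%:M ->
  forall i, \sum_j U i j ^+ 2 = 1.
Proof.
move=> U1 i; transitivity ((1%:M : 'M[R]_d) i i); last by rewrite mxE eqxx.
rewrite -U1 mxE.
by apply: eq_bigr => j _; rewrite mxE expr2.
Qed.

Lemma quad_spectral (R : realType) d (U : 'M[R]_d) (D : 'rV[R]_d) (x : 'cV[R]_d) :
  (x^T *m (U^T *m diag_mx D *m U) *m x) 0 0 = \sum_i D 0 i * (U *m x) i 0 ^+ 2.
Proof.
rewrite !mulmxA -trmx_mul -mulmxA mxE; apply: eq_bigr => i _.
by rewrite mul_mx_diag !mxE mulrAC expr2 mulrC mulrA.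
Qed.

(** Courant-Fischer by a dimension count: some nonzero y is orthogonal to the first k eigenvectors
    of A and to those of B after number k+1. On it the form of A is at most lambda_{k+1}(A) |y|^2,
    and the form of B at least lambda_{k+1}(B) |y|^2. *)
Lemma lambda_perturb (R : realType) d k (A B : 'M[R]_d) (e : R) :
  (k < d)%N -> A^T = A -> B^T = B ->
  (forall x : 'cV[R]_d, (x^T *m B *m x) 0 0 - e * nsq x <= (x^T *m A *m x) 0 0) ->
  lambda k.+1 B - e <= lambda k.+1 A.
Proof.
move=> kd AT BT AB.
have [U [U1 AE lA]] := sym_spectral AT.
have [V [V1 BE lB]] := sym_spectral BT.
pose k0 := Ordinal kd.
(* Only d - 1 orthogonality conditions are imposed: row k is zero, so [K] is singular. *)
pose K : 'M[R]_d := \matrix_(i, j)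
  (if (i < k)%N then U i j else if (i == k :> nat) then 0 else V i j).
have [x x0 xK] : exists2 x : 'rV[R]_d, x != 0 & x *m K^T = 0.
  apply/det0P; rewrite det_tr (expand_det_row _ k0) big1// => j _.
  by rewrite mxE ltnn eqxx mul0r.
pose y := x^T.
have y0 : 0 < nsq y.
  rewrite lt_neqAle nsq_ge0 andbT eq_sym nsq_eq0; apply: contra x0 => /eqP y0.
  by rewrite -[x]trmxK -/y y0 trmx0.
have yK : K *m y = 0 by rewrite -[LHS]trmxK trmx_mul trmxK xK trmx0.
have yU (i : 'I_d) : (i < k)%N -> (U *m y) i 0 = 0.
  move=> ik; transitivity ((K *m y) i 0); last by rewrite yK mxE.
  rewrite mxE [RHS]mxE.
  by apply: eq_bigr => j _; rewrite !mxE ik.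
have yV (i : 'I_d) : (k < i)%N -> (V *m y) i 0 = 0.
  move=> ik; transitivity ((K *m y) i 0); last by rewrite yK mxE.
  rewrite mxE [RHS]mxE.
  by apply: eq_bigr => j _; rewrite !mxE ltnNge ltnW//= gtn_eqF.
have nU : \sum_i (U *m y) i 0 ^+ 2 = nsq y.
  by apply: (nsq_orthogonal y); exact: mulmx1C.
have nV : \sum_i (V *m y) i 0 ^+ 2 = nsq y.
  by apply: (nsq_orthogonal y); exact: mulmx1C.
have hA : (y^T *m A *m y) 0 0 <= lambda k.+1 A * nsq y.
  rewrite [in leLHS]AE quad_spectral -nU mulr_sumr; apply: ler_sum => i _; rewrite mxE.
  have [ik|ki] := ltnP i k; first by rewrite yU// expr0n !mulr0.
  by rewrite ler_wpM2r ?sqr_ge0//; exact: (lA k0 i).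
have hB : lambda k.+1 B * nsq y <= (y^T *m B *m y) 0 0.
  rewrite [in leRHS]BE quad_spectral -nV mulr_sumr; apply: ler_sum => i _; rewrite mxE.
  have [ik|ki] := ltnP k i; first by rewrite yV// expr0n !mulr0.
  by rewrite ler_wpM2r ?sqr_ge0//; exact: (lB i k0).
rewrite -(ler_pM2r y0); have := AB y; lra.
Qed.

Lemma lambda_ge0 (R : realType) d k (A : 'M[R]_d) : (k < d)%N -> psd A ->
  0 <= lambda k.+1 A.
Proof.
move=> kd [AT A0]; have [U [U1 AE lA]] := sym_spectral AT.
pose x : 'cV[R]_d := (row (Ordinal kd) U)^T.
suff -> : lambda k.+1 A = (x^T *m A *m x) 0 0 by exact: A0.
rewrite [in RHS]AE quad_spectral (bigD1 (Ordinal kd))//= big1 => [|i ik].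
  have -> : (U *m x) (Ordinal kd) 0 = 1.
    rewrite mxE -(unit_row_sqr U1 (Ordinal kd)); apply: eq_bigr => j _.
    by rewrite !mxE expr2.
  by rewrite mxE expr1n mulr1 addr0.
have -> : (U *m x) i 0 = (U *m U^T) i (Ordinal kd).
  by rewrite !mxE; apply: eq_bigr => j _; rewrite !mxE.
by rewrite U1 [X in _ * X ^+ 2]mxE (negbTE ik) expr0n mulr0.
Qed.

(** In the eigenbasis the trace is the sum of lambda_i w_i with weights w_i in [0, 1] of total tr P
    >= d - r. The d - r - 1 indices beyond r+1 carry at most d - r - 1 of it, so the first r+1
    eigenvalues get total weight at least 1. *)
Lemma lambda_le_trace_proj (R : realType) d r (S P : 'M[R]_d) : (r < d)%N ->
  psd S -> is_proj P -> d%:R - r%:R <= \tr P -> lambda r.+1 S <= \tr (P *m S *m P).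
Proof.
move=> rd Spsd [PT PP] trP; have [ST _] := Spsd.
have [U [U1 SE lS]] := sym_spectral ST.
have U2 : U^T *m U = 1%:M by exact: mulmx1C.
pose w (i : 'I_d) := nsq (P *m (row i U)^T).
have w0 i : 0 <= w i by exact: nsq_ge0.
have w1 i : w i <= 1.
  rewrite (le_trans (nsq_proj_le _ (conj PT PP)))// le_eqVlt; apply/orP; left; apply/eqP.
  by rewrite -(unit_row_sqr U1 i); apply: eq_bigr => j _; rewrite !mxE.
have wE i : w i = (U *m P *m U^T) i i.
  rewrite /w; have := mulmx_trl_nsq (P *m (row i U)^T) => /matrixP/(_ 0 0).
  rewrite [RHS]mxE eqxx mulr1n trmx_mul trmxK PT mulmxA -(mulmxA _ P P) PP => <-.
  rewrite -row_mul mxE [RHS]mxE; apply: eq_bigr => j _; by rewrite !mxE.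
have sw : \sum_i w i = \tr P.
  under eq_bigr do rewrite wE.
  by rewrite -/(\tr (U *m P *m U^T)) mxtrace_mulC mulmxA U2 mul1mx.
have -> : \tr (P *m S *m P) = \sum_(i < d) lambda i.+1 S * w i.
  rewrite mxtrace_mulC mulmxA PP mxtrace_mulC [in LHS]SE -!mulmxA mxtrace_mulC -mulmxA.
  rewrite /mxtrace; apply: eq_bigr => i _.
  by rewrite wE mul_diag_mx [LHS]mxE [X in X * _]mxE.
have l0 (i : 'I_d) : 0 <= lambda i.+1 S by exact: lambda_ge0.
set l := lambda r.+1 S; have l00 : 0 <= l by exact: (l0 (Ordinal rd)).
rewrite (bigID (fun i : 'I_d => (i <= r)%N))/= ler_wpDr//.
  by apply: sumr_ge0 => i _; rewrite mulr_ge0.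
apply: (@le_trans _ _ (\sum_(i < d | (i <= r)%N) l * w i)); last first.
  by apply: ler_sum => i ir; rewrite ler_wpM2r//; exact: (lS i (Ordinal rd)).
rewrite -mulr_sumr ler_peMr//.
have : \sum_(i < d | ~~ (i <= r)%N) w i <= d%:R - r.+1%:R.
  have -> : d%:R - r.+1%:R = \sum_(i < d | ~~ (i <= r)%N) (1 : R).
    rewrite -natrB// -(subnK rd) addnC.
    rewrite addKn big_split_ord/= [X in X + _]big1 ?add0r => [|i].
      under eq_bigl do rewrite -ltnNge ltnS leq_addr.
      by rewrite sumr_const card_ord.
    by rewrite -ltnNge ltnNge -ltnS ltn_ord.
  by apply: ler_sum => i _.
by move: trP; rewrite -sw (bigID (fun i : 'I_d => (i <= r)%N))/= -natr1; lra.
Qed.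

(* V projects onto the span of the eigenvectors numbered r+1, ..., d, which has
   codimension r; hence it contains a combination of any r+1 vectors. *)
Lemma tail_seminorm (R : realType) d r (M : 'M[R]_d) : (r < d)%N -> psd M ->
  exists V : 'M[R]_d, [/\ \tr (V *m M *m V^T) <= d%:R * lambda r.+1 M,
    forall y : 'cV[R]_d, nsq (V *m y) <= nsq y &
    forall z : 'I_r.+1 -> 'cV[R]_d, exists2 a : 'I_r.+1 -> R, exists j, a j != 0 &
      nsq (V *m \sum_j a j *: z j) = nsq (\sum_j a j *: z j)].
Proof.
move=> rd Mpsd; have [MT _] := Mpsd; have [U [U1 ME lM]] := sym_spectral MT.
have U2 : U^T *m U = 1%:M by exact: mulmx1C.
pose V : 'M[R]_d := \matrix_(i, j) if (r <= i)%N then U i j else 0.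
have Vy (y : 'cV[R]_d) i : (V *m y) i 0 = if (r <= i)%N then (U *m y) i 0 else 0.
  case: ifPn => ri; rewrite !mxE; first by apply: eq_bigr => j _; rewrite mxE ri.
  by rewrite big1// => j _; rewrite mxE (negbTE ri) mul0r.
exists V; split.
- have VUT i j : (V *m U^T) i j = (r <= i)%N%:R * (i == j)%:R.
    have /matrixP/(_ i j) := U1; rewrite !mxE => U1ij.
    case: (boolP (r <= i)%N) => ri.
      by rewrite mul1r -U1ij; apply: eq_bigr => k _; rewrite !mxE ri.
    by rewrite mul0r big1// => k _; rewrite !mxE (negbTE ri) mul0r.
  have -> : \tr (V *m M *m V^T) = \sum_(i < d) (r <= i)%N%:R * lambda i.+1 M.
    have -> : V *m M *m V^T = (V *m U^T) *m diag_mx (\row_i lambda i.+1 M) *m (V *m U^T)^T.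
      by rewrite [in LHS]ME trmx_mul trmxK !mulmxA.
    rewrite /mxtrace; apply: eq_bigr => i _; rewrite mxE (bigD1 i)//= big1 => [|j ji].
      rewrite addr0 mul_mx_diag [X in X * _]mxE [X in _ * X]mxE VUT [X in _ * X * _]mxE eqxx mulr1.
      by case: (r <= i)%N; rewrite ?mul1r ?mulr1 ?mul0r.
    by rewrite [X in _ * X]mxE VUT eq_sym (negbTE ji) mulr0 mulr0.
  have -> : d%:R * lambda r.+1 M = \sum_(i < d) lambda r.+1 M.
    by rewrite sumr_const card_ord mulr_natl.
  apply: ler_sum => i _; case: (leqP r i) => ri; last by rewrite mul0r lambda_ge0.
  by rewrite mul1r; exact: (lM (Ordinal rd) i).
- move=> y; rewrite -(nsq_orthogonal y U2); apply: ler_sum => i _.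
  by rewrite Vy; case: ifP => // _; rewrite expr0n sqr_ge0.
- move=> z.
  (* The last row of [K] is zero, so there is a nonzero kernel vector [a]. The combination with
     coefficients [a] has vanishing first r eigencoordinates, the only ones that [V] kills. *)
  pose K : 'M[R]_(r.+1) := \matrix_(i, j)
    if (i < r)%N then (U *m z j) (widen_ord rd i) 0 else 0.
  have [a a0 aK] : exists2 a : 'rV[R]_r.+1, a != 0 & a *m K^T = 0.
    apply/det0P; rewrite det_tr (expand_det_row _ ord_max) big1// => j _.
    by rewrite mxE ltnn mul0r.
  exists (fun j => a 0 j).
    apply/existsP; apply: contraNT a0 => /existsPn a0; apply/eqP/rowP => j.
    by have := a0 j; rewrite negbK mxE => /eqP.
  rewrite -[RHS](nsq_orthogonal _ U2); apply: eq_bigr => i _; rewrite Vy.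
  case: leqP => // ir; congr (_ ^+ 2).
  have ir1 : (i < r.+1)%N by rewrite ltnW.
  transitivity ((a *m K^T) 0 (Ordinal ir1)); first by rewrite aK mxE.
  rewrite mulmx_sumr summxE mxE; apply: eq_bigr => j _.
  rewrite -scalemxAr [RHS]mxE [X in a 0 j * X]mxE [X in a 0 j * X]mxE /= ir; congr (_ * _).
  by congr ((U *m z j) _ 0); exact: val_inj.
Qed.

Definition others (R : realType) d q (z : 'I_q -> 'cV[R]_d) (j : 'I_q) :
    seq 'cV[R]_d := [seq z l | l <- enum 'I_q & l != j].

Lemma size_others (R : realType) d q (z : 'I_q.+1 -> 'cV[R]_d) j :
  size (others z j) = q.
Proof.
rewrite size_map size_filter; have := count_predC (pred1 j) (enum 'I_q.+1).
rewrite size_enum_ord (count_uniq_mem j (enum_uniq _)) mem_enum inE => -[e].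
by rewrite -[RHS]e; exact: eq_count.
Qed.

(** Scale the combination so that its largest coefficient, number j, becomes 1. Its norm is then at
    least the distance of z_j to the span of the others; as all coefficients are at most 1 in
    modulus, Cauchy-Schwarz bounds the squared norm of its image by (r+1) times the sum of the |V
    z_i|^2. *)
Lemma leave_one_out (R : realType) d r (V : 'M[R]_d) (z : 'I_r.+1 -> 'cV[R]_d)
    (a : 'I_r.+1 -> R) e :
  (exists j, a j != 0) ->
  nsq (V *m \sum_j a j *: z j) = nsq (\sum_j a j *: z j) ->
  (forall j, e <= nsq (proj_compl (others z j) *m z j)) ->
  e <= r.+1%:R * \sum_j nsq (V *m z j).
Proof.
move=> [i0 ai0] Va ez.
pose j := [arg max_(i > i0) `|a i|]%O.
have aj i : `|a i| <= `|a j| by rewrite /j; case: arg_maxP => // k _; apply.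
have aj0 : a j != 0 by rewrite -normr_gt0 (lt_le_trans _ (aj i0))// normr_gt0.
pose c i := (a j)^-1 * a i.
have c1 i : c i ^+ 2 <= 1.
  rewrite -real_normK ?num_real// expr_le1// /c normrM normfV.
  by rewrite ler_pdivrMl ?mulr1// normr_gt0.
have [prP Pos _] := proj_complP (others z j).
have cz : \sum_i c i *: z i = (a j)^-1 *: \sum_i a i *: z i.
  by rewrite scaler_sumr; apply: eq_bigr => i _; rewrite scalerA.
have e1 : e <= nsq (\sum_i c i *: z i).
  rewrite (le_trans (ez j))//.
  suff -> : proj_compl (others z j) *m z j = proj_compl (others z j) *m \sum_i c i *: z i.
    exact: nsq_proj_le.
  rewrite mulmx_sumr (bigD1 j)//= big1 => [|i ij].
    by rewrite addr0 /c mulVf// scale1r.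
  rewrite -scalemxAr Pos ?scaler0//; rewrite /others.
  have : i \in [seq l <- enum 'I_r.+1 | l != j] by rewrite mem_filter ij mem_enum.
  elim: [seq _ <- _ | _] => //= l s IH; rewrite inE => /orP[/eqP ->|/IH]; first by left.
  by right.
apply: (le_trans e1); rewrite cz nsqZ -Va -nsqZ scalemxAr -cz mulmx_sumr.
rewrite (le_trans (nsq_sum_le _))// card_ord ler_wpM2l//.
apply: ler_sum => i _; rewrite -scalemxAr nsqZ ler_piMl// ?nsq_ge0//.
Qed.

Lemma ge0_sum_pairs (R : realType) (f : nat -> R) b L : (forall i, 0 <= f i) ->
  (L.*2 <= b)%N ->
  \sum_(l < L) (f l.*2.+1 + f l.*2.+2) <= \sum_(1 <= i < b.+1) f i.
Proof.
move=> f0 Lb.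
have -> : \sum_(l < L) (f l.*2.+1 + f l.*2.+2) = \sum_(1 <= i < L.*2.+1) f i.
  elim: L {Lb} => [|L IH]; first by rewrite big_ord0 big_geq.
  by rewrite big_ord_recr /= IH doubleS [RHS]big_nat_recr//= [in RHS]big_nat_recr//= addrA.
rewrite (@big_cat_nat _ _ _ L.*2.+1 1 b.+1)//= lerDl.
by apply: sumr_ge0.
Qed.

Lemma sum_regroup (R : realType) (f : nat -> R) B q :
  \sum_(l < (B * q)) f l = \sum_(g < B) \sum_(j < q) f (g * q + j)%N.
Proof.
elim: B => [|B IH]; first by rewrite mul0n !big_ord0.
by rewrite mulSnr big_split_ord big_ord_recr/= -IH.
Qed.

(* Pairing consecutive observations removes the centring m, as
   |u - m|^2 + |v - m|^2 >= |u - v|^2 / 2. *)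
Lemma lambda_block_ge (R : realType) d r b B (h e : R) (m : 'cV[R]_d)
    (y z err : nat -> 'cV[R]_d) (good : pred 'I_B) :
  (r < d)%N -> 0 < h -> 0 <= e -> ((B * r.+1).*2 <= b)%N ->
  (forall l, (l < B * r.+1)%N -> y l.*2.+2 - y l.*2.+1 = z l + err l) ->
  (forall g j, good g ->
     e <= nsq (proj_compl (others (fun j : 'I_r.+1 => z (g * r.+1 + j)%N) j)
               *m z (g * r.+1 + j)%N)) ->
  e / r.+1%:R / 4 * (\sum_(g < B) (good g)%:R)
    - 2^-1 * \sum_(l < (B * r.+1)) nsq (err l)
  <= d%:R * (h * lambda r.+1 (h^-1 *: \sum_(1 <= i < b.+1) outer (y i - m))).
Proof.
move=> rd h0 e0 Bb yz goodP.
set M := h^-1 *: _.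
have outerT (u : 'cV[R]_d) : (outer u)^T = outer u by rewrite /outer trmx_mul trmxK.
have quad_outer (x u : 'cV[R]_d) : (x^T *m outer u *m x) 0 0 = ((u^T *m x) 0 0) ^+ 2.
  rewrite /outer mulmxA -mulmxA mxE big_ord1.
  by rewrite expr2; congr (_ * _); rewrite !mxE; apply: eq_bigr => i _; rewrite !mxE mulrC.
have Mpsd : psd M.
  split; first by rewrite /M [LHS]linearZ/= linear_sum/=; congr (_ *: _); apply: eq_bigr.
  move=> x; rewrite /M -scalemxAr -scalemxAl mxE mulr_ge0 ?invr_ge0 ?(ltW h0)//.
  rewrite mulmx_sumr mulmx_suml summxE; apply: sumr_ge0 => i _; rewrite quad_outer; exact: sqr_ge0.
have [V [trV Vle Va]] := tail_seminorm rd Mpsd.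
rewrite mulrCA; apply: le_trans (_ : h * \tr (V *m M *m V^T) <= _); last by rewrite ler_pM2l.
have -> : h * \tr (V *m M *m V^T) = \sum_(1 <= i < b.+1) nsq (V *m (y i - m)).
  rewrite /M -scalemxAr -scalemxAl mxtraceZ mulrA divff ?gt_eqF// mul1r.
  rewrite mulmx_sumr mulmx_suml raddf_sum/=; apply: eq_bigr => i _.
  have -> : V *m outer (y i - m) *m V^T = (V *m (y i - m)) *m (V *m (y i - m))^T.
    by rewrite trmx_mul !mulmxA.
  by rewrite mxtrace_outer.
apply: le_trans (ge0_sum_pairs (fun i => nsq_ge0 (V *m (y i - m))) Bb).
(* Pairing gives at least |V(z + err)|^2 / 2 per pair, and |V(z + err)|^2 >= |V z|^2 / 2 - |V
   err|^2; hence the factors 1/4 and 1/2. *)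
apply: (@le_trans _ _ (\sum_(l < (B * r.+1)) (4^-1 * nsq (V *m z l) - 2^-1 * nsq (err l)))).
  suff : e / r.+1%:R * (\sum_(g < B) (good g)%:R) <= \sum_(l < (B * r.+1)) nsq (V *m z l).
    rewrite sumrB -!mulr_sumr => hs; rewrite lerB//.
    have -> : e / r.+1%:R / 4 * \sum_(g < B) (good g)%:R
        = 4^-1 * (e / r.+1%:R * \sum_(g < B) (good g)%:R) by ring.
    by rewrite ler_pM2l ?invr_gt0.
  rewrite (sum_regroup (fun l => nsq (V *m z l))) mulr_sumr; apply: ler_sum => g _.
  have [gg|gg] := boolP (good g); last first.
    by rewrite mulr0 sumr_ge0// => j _; exact: nsq_ge0.
  rewrite mulr1 ler_pdivrMr// mulrC.
  have [a a0 aV] := Va (fun j => z (g * r.+1 + j)%N).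
  by apply: (leave_one_out a0 aV) => j; exact: goodP.
apply: ler_sum => l _.
have h1 : nsq (V *m (z l + err l)) <=
    2 * nsq (V *m (y l.*2.+2 - m)) + 2 * nsq (V *m (y l.*2.+1 - m)).
  have -> : V *m (z l + err l) = V *m (y l.*2.+2 - m) + - (V *m (y l.*2.+1 - m)).
    by rewrite -yz// -mulmxBr opprB addrA subrK.
  by rewrite (le_trans (nsqD_le _ _))// nsqN.
have := nsqD_ge (V *m z l) (V *m err l); rewrite -mulmxDr.
have := Vle (err l); lra.
Qed.

(** * Independent Gaussian variables *)

Section NormalIntegral.
Variables (R : realType) (s : R).
Local Notation mu := lebesgue_measure.
Local Notation N := (normal_prob 0 s).
Local Notation pdf := (normal_pdf 0 s).

Import HBNNSimple.

Let mpdf : measurable_fun setT (fun x => (pdf x)%:E).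
Proof. apply/measurable_EFinP. apply: measurable_normal_pdf. Qed.

Let integral_normal_nnsfun (f : {nnsfun (measurableTypeR R) >-> R}) :
  (\int[N]_x (f x)%:E = \int[mu]_x ((f x)%:E * (pdf x)%:E))%E.
Proof.
under [LHS]eq_integral do rewrite fimfunE -fsumEFin//.
rewrite [LHS]ge0_integral_fsum//; last 2 first.
  - by move=> r; exact/measurable_EFinP/measurableT_comp.
  - by move=> n x _; rewrite EFinM nnfun_muleindic_ge0.
under [RHS]eq_integral.
  move=> x xD; rewrite fimfunE -fsumEFin// muleC ge0_mule_fsumr; last first.
    by move=> r; rewrite EFinM nnfun_muleindic_ge0.
  over.
rewrite [RHS]ge0_integral_fsum//; last 2 first.
  - move=> r; apply: emeasurable_funM => //.
    by apply/measurable_EFinP; do 2 apply/measurableT_comp => //.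
  - move=> n x _; rewrite EFinM mule_ge0//; last by rewrite nnfun_muleindic_ge0.
    by rewrite lee_fin normal_pdf_ge0.
apply: eq_fsbigr => r _.
rewrite integralZl_indic_nnsfun//= integral_indic//= setIT.
have [r0|r0] := leP 0 r; last first.
  rewrite preimage_nnfun0// measure0 mule0 integral0_eq// => x _.
  by rewrite indicE in_set0 mulr0 mule0.
under eq_integral do rewrite EFinM muleCA.
rewrite ge0_integralZl//; last 2 first.
  - apply: emeasurable_funM => //.
    exact/measurable_EFinP/measurable_indic.
  - by move=> x _; rewrite mule_ge0// lee_fin normal_pdf_ge0.
congr (_ * _)%E; rewrite /normal_prob [LHS]integral_mkcond/=.
apply: eq_integral => x _; rewrite patchE indicE; case: ifPn => xr.
  by rewrite mule1.
by rewrite mule0.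
Qed.

(** Both sides are monotone limits along the same simple functions, for which the claim is the
    definition of [normal_prob] as an integral of its density. *)
Lemma integral_normal_prob (f : measurableTypeR R -> \bar R) :
  measurable_fun setT f -> (forall x, 0 <= f x)%E ->
  (\int[N]_x f x = \int[mu]_x (f x * (pdf x)%:E))%E.
Proof.
move=> mf f0.
pose f_ := nnsfun_approx measurableT mf.
have pdf0 x : (0 <= (pdf x)%:E)%E by rewrite lee_fin normal_pdf_ge0.
transitivity (lim (\int[N]_x (f_ n x)%:E @[n --> \oo])%E).
  rewrite -monotone_convergence//=.
  - apply: eq_integral => ? /[!inE] xD; apply/esym/cvg_lim => //=.
    exact: cvg_nnsfun_approx.
  - by move=> n; exact/measurable_EFinP/measurable_funTS.
  - by move=> n ? _; rewrite lee_fin.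
  - by move=> ? _ ? ? mn; rewrite lee_fin; exact/lefP/nd_nnsfun_approx.
have -> : (\int[mu]_x (f x * (pdf x)%:E) =
    lim (\int[mu]_x ((f_ n x)%:E * (pdf x)%:E) @[n --> \oo]))%E.
  rewrite -monotone_convergence//=.
  - apply: eq_integral => x /[!inE] xD; apply/esym/cvg_lim => //.
    apply: cvgeZr => //; exact: cvg_nnsfun_approx.
  - move=> n; apply: emeasurable_funM => //; exact/measurable_EFinP/measurable_funTS.
  - by move=> n x _; apply: mule_ge0; rewrite ?pdf0 ?lee_fin.
  - move=> x _ ? ? ?; apply: lee_wpmul2r => //; rewrite lee_fin.
    exact/lefP/nd_nnsfun_approx.
by apply: congr_lim; apply/funext => n /=; exact: integral_normal_nnsfun.
Qed.

End NormalIntegral.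

(* The heat kernel up to the constant 1 / sqrt (2 pi); t is the variance. *)
Definition heat (R : realType) (t x : R) : R :=
  (Num.sqrt t)^-1 * expR (- (x ^+ 2 / (2 * t))).

Lemma measurable_heat (R : realType) (t : R) : measurable_fun setT (@heat R t).
Proof.
apply: measurable_funM => //; apply: measurableT_comp => //.
apply: measurableT_comp => //; apply: measurable_funM => //.
Qed.

Lemma heat_ge0 (R : realType) (t x : R) : 0 <= heat t x.
Proof. by rewrite mulr_ge0 ?invr_ge0 ?expR_ge0. Qed.

(** Completing the square in x: what remains besides the exponent of the kernel with variance T at c
    is that of a normal density with mean - a c s^2 / T and variance s^2 t / T, which integrates to
    1. *)
Lemma heat_exponent (R : realFieldType) (t s a c x : R) :
  t != 0 -> s != 0 -> t + a ^+ 2 * s ^+ 2 != 0 ->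
  let T := t + a ^+ 2 * s ^+ 2 in
  - ((c + a * x) ^+ 2 / (2 * t)) + - (x - 0) ^+ 2 / (s ^+ 2 *+ 2) =
  - (c ^+ 2 / (2 * T)) + - (x - - (a * c * s ^+ 2 / T)) ^+ 2 / (s ^+ 2 * (t / T) *+ 2).
Proof.
move=> t0 s0 T0 /=; field; rewrite t0 s0 !andbT.
by have -> : t + (a * s) ^+ 2 = t + a ^+ 2 * s ^+ 2 by ring.
Qed.

(** The semigroup property of the heat kernel: averaging over an independent centred normal shift
    adds its variance. *)
Lemma integral_heat (R : realType) (t s a c : R) : 0 < t -> 0 < s ->
  (\int[normal_prob 0 s]_x (heat t (c + a * x))%:E = (heat (t + a ^+ 2 * s ^+ 2) c)%:E)%E.
Proof.
move=> t0 s0; rewrite integral_normal_prob; last 2 first.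
- apply/measurable_EFinP; apply: (measurableT_comp (measurable_heat t)).
  by apply: measurable_funD => //; exact: measurable_funM.
- by move=> x; rewrite lee_fin heat_ge0.
set T := t + a ^+ 2 * s ^+ 2.
have T0 : 0 < T by rewrite ltr_wpDr// mulr_ge0 ?sqr_ge0.
pose sg := s * Num.sqrt (t / T).
pose m := - (a * c * s ^+ 2 / T).
have tT0 : 0 < t / T by rewrite divr_gt0.
have sg0 : 0 < sg by rewrite mulr_gt0// sqrtr_gt0.
have hE := heat_exponent c _ (lt0r_neq0 t0) (lt0r_neq0 s0) (lt0r_neq0 T0).
transitivity (\int[lebesgue_measure]_x ((heat T c)%:E * (normal_pdf m sg x)%:E))%E.
  apply: eq_integral => x _; rewrite -!EFinM; congr EFin.
  rewrite !normal_pdfE ?gt_eqF// /heat /normal_peak /normal_fun.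
  have E2 : sg ^+ 2 = s ^+ 2 * (t / T) by rewrite exprMn sqr_sqrtr// ltW.
  rewrite [RHS]mulrACA [LHS]mulrACA E2; congr (_ * _).
    rewrite -!invfM -!sqrtrM ?ltW//; congr (Num.sqrt _)^-1.
    by clearbody T; field; rewrite lt0r_neq0.
  by rewrite -!expRD; congr expR; exact: hE.
rewrite ge0_integralZl//; first by rewrite integral_normal_pdf mule1.
- apply/measurable_EFinP; exact: measurable_normal_pdf.
- by move=> x _; rewrite lee_fin normal_pdf_ge0.
- by rewrite lee_fin heat_ge0.
Qed.

(** * Independence, from events to integrals and from pi-systems to sigma-algebras *)

Section Independence.
Context disp (T : measurableType disp) (R : realType) (P : probability T R).

Definition indep d1 d2 (T1 : measurableType d1) (T2 : measurableType d2)
    (X : T -> T1) (Y : T -> T2) : Prop :=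
  forall A B, measurable A -> measurable B ->
    P (X @^-1` A `&` Y @^-1` B) = (P (X @^-1` A) * P (Y @^-1` B))%E.

(** The joint law is the product of the marginals, so by Tonelli [Y] may be frozen at an independent
    outcome w' while [X] is averaged. *)
Lemma integral_indep d1 d2 (T1 : measurableType d1) (T2 : measurableType d2)
    (X : T -> T1) (Y : T -> T2) (f : T1 * T2 -> \bar R) :
  measurable_fun setT X -> measurable_fun setT Y -> indep X Y ->
  measurable_fun setT f -> (forall z, 0 <= f z)%E ->
  (\int[P]_w f (X w, Y w) = \int[P]_w' \int[P]_w f (X w, Y w'))%E.
Proof.
move=> mX mY XY mf f0.
pose X' : {mfun T >-> T1} := mfun_Sub (mem_set mX).
pose Y' : {mfun T >-> T2} := mfun_Sub (mem_set mY).
pose Z' : {mfun T >-> (T1 * T2)%type} :=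
  mfun_Sub (mem_set (measurable_fun_pair mX mY)).
have eqm A : measurable A ->
    (distribution P X' \x distribution P Y')%E A = distribution P Z' A.
  by apply: product_measure_unique => B C mB mC; rewrite -XY.
have -> : (\int[P]_w f (X w, Y w) = \int[distribution P Z']_z f z)%E.
  rewrite [in RHS]/distribution ge0_integral_pushforward//; exact: measurable_fun_pair.
have -> : (\int[distribution P Z']_z f z =
    \int[(distribution P X' \x distribution P Y')%E]_z f z)%E.
  by apply: eq_measure_integral => A mA _; apply: esym; exact: eqm.
rewrite fubini_tonelli2// /distribution ge0_integral_pushforward//; last 2 first.
- exact: measurable_fun_fubini_tonelli_G.
- by move=> y _; rewrite integral_ge0.
apply: eq_integral => w' _ /=; rewrite /fubini_G ge0_integral_pushforward//.
by apply: measurableT_comp => //; exact: measurable_pair2.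
Qed.

(** As functions of A, both sides are finite measures, so agreement on a generating pi-system
    containing the whole space suffices. *)
Lemma pi_indep d1 (T1 : measurableType d1) (X : T -> T1) (G : set (set T1)) (E : set T) :
  measurable_fun setT X -> measurable E ->
  measurable = <<s G >> -> setI_closed G -> G setT ->
  (forall A, G A -> P (X @^-1` A `&` E) = (P (X @^-1` A) * P E)%E) ->
  forall A, measurable A -> P (X @^-1` A `&` E) = (P (X @^-1` A) * P E)%E.
Proof.
move=> mX mE mG IG GT GE A mA.
have PE0 : (0 <= fine (P E))%R by rewrite fine_ge0.
pose m1 : measure T1 R := pushforward (mrestr P mE) X.
pose m2 : measure T1 R := mscale (NngNum PE0) (pushforward P X).
have PEE : ((fine (P E))%:E = P E)%E by rewrite fineK// fin_num_measure.
rewrite -PEE muleC; apply: (@measure_unique _ R T1 G (fun=> setT) mG IG (fun=> GT) _ (m1 mX) (m2 mX)) => //.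
- by apply/seteqP; split => // x _; exists 0%N.
- by move=> B GB; rewrite /m1 /m2 /mscale/= /pushforward /mrestr/= GE// muleC -[X in (X * _)%E]PEE.
- by move=> _; rewrite /m1/= /pushforward /mrestr/= preimage_setT setTI -PEE ltry.
Qed.

Lemma indep_pi d1 d2 (T1 : measurableType d1) (T2 : measurableType d2)
    (X : T -> T1) (Y : T -> T2) (G : set (set T1)) (H : set (set T2)) :
  measurable_fun setT X -> measurable_fun setT Y ->
  measurable = <<s G >> -> setI_closed G -> G setT ->
  measurable = <<s H >> -> setI_closed H -> H setT ->
  (forall A B, G A -> H B ->
     P (X @^-1` A `&` Y @^-1` B) = (P (X @^-1` A) * P (Y @^-1` B))%E) ->
  indep X Y.
Proof.
move=> mX mY mG IG GT mH IH HT GH A B mA mB.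
have pre d (T' : measurableType d) (Z : T -> T') C :
    measurable_fun setT Z -> measurable C -> measurable (Z @^-1` C).
  by move=> mZ mC; rewrite -[X in measurable X]setTI; exact: mZ.
apply: (pi_indep mX _ mG) => //; first exact: pre.
move=> A' GA'; rewrite setIC muleC.
have mA' : measurable A' by rewrite mG; exact: sub_sigma_algebra.
apply: (pi_indep mY _ mH) => //; first exact: pre.
by move=> B' HB'; rewrite setIC muleC; exact: GH.
Qed.

End Independence.

Section Boxes.
Context (R : realType) (n : nat).
Local Notation TR := (n.-tuple (measurableTypeR R)).

Definition boxes : set (set TR) :=
  [set [set t | forall k, B k (tnth t k)] |
     B in [set B : 'I_n -> set (measurableTypeR R) | forall k, measurable (B k)]].

Lemma boxesI : setI_closed boxes.
Proof.
move=> _ _ [B mB <-] [C mC <-]; exists (fun k => B k `&` C k).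
  by move=> k; exact: measurableI.
apply/seteqP; split => t /=; first by move=> BC; split => k; have [] := BC k.
by move=> [tB tC] k; split.
Qed.

Lemma boxesT : boxes setT.
Proof. by exists (fun=> setT) => //; apply/seteqP; split. Qed.

Lemma measurable_boxes : (measurable : set (set TR)) = <<s boxes >>.
Proof.
apply/seteqP; split.
  apply: smallest_sub; first exact: smallest_sigma_algebra.
  move=> A; rewrite -bigcup_seq => -[i _ [B mB <-]]; apply: sub_sigma_algebra.
  exists (fun k => if k == i then B else setT).
    by move=> k; rewrite /=; case: ifP.
  rewrite setTI; apply/seteqP; split => t /=; first by move=> /(_ i); rewrite eqxx.
  by move=> tB k; case: eqP => [->|].
apply: smallest_sub; first exact: sigma_algebra_measurable.
move=> _ [B mB <-].
have -> : [set t : TR | forall k, B k (tnth t k)] =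
    \bigcap_(k in [set: 'I_n]) ((fun t : TR => tnth t k) @^-1` B k).
  by apply/seteqP; split => t Bt k; [move=> _|]; apply: Bt.
apply: fin_bigcap_measurable => // k _.
rewrite -[X in measurable X]setTI.
exact: (@measurable_tnth _ (measurableTypeR R) n k measurableT).
Qed.

End Boxes.

Section MutualIndependence.
Context disp (T : measurableType disp) (R : realType) (P : probability T R).
Context (I : finType) (g : I -> T -> measurableTypeR R).

Definition mut_indep : Prop :=
  forall B : I -> set (measurableTypeR R), (forall i, measurable (B i)) ->
    P [set w | forall i, B i (g i w)] = (\prod_i P (g i @^-1` B i))%E.

(* The subfamily indexed by S, encoded by zeros outside of S. *)
Definition subfamily (S : {set I}) (w : T) : #|I|.-tuple (measurableTypeR R) :=
  [tuple if enum_val k \in S then g (enum_val k) w else 0 | k < #|I|].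

Lemma tnth_subfamily S w i :
  tnth (subfamily S w) (enum_rank i) = if i \in S then g i w else 0.
Proof. by rewrite tnth_mktuple enum_rankK. Qed.

Hypothesis mg : forall i, measurable_fun setT (g i).

Lemma measurable_subfamily S : measurable_fun setT (subfamily S).
Proof.
apply/measurable_fun_tnthP => k.
have [kS|kS] := boolP (enum_val k \in S).
  rewrite (_ : _ \o _ = g (enum_val k)); first exact: mg.
  by apply/funext => w /=; rewrite tnth_mktuple kS.
rewrite (_ : _ \o _ = cst 0); first exact: measurable_cst.
by apply/funext => w /=; rewrite tnth_mktuple (negbTE kS).
Qed.

Hypothesis ig : mut_indep.

Lemma indep_subfamily (S S' : {set I}) : (forall i, i \in S -> i \notin S') ->
  indep P (subfamily S) (subfamily S').
Proof.
move=> SS'.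
apply: (@indep_pi _ _ _ _ _ _ _ _ _ _ (@boxes R #|I|) (@boxes R #|I|)).
- exact: measurable_subfamily.
- exact: measurable_subfamily.
- exact: measurable_boxes.
- exact: boxesI.
- exact: boxesT.
- exact: measurable_boxes.
- exact: boxesI.
- exact: boxesT.
move=> _ _ [B mB <-] [B' mB' <-].
(* Outside S the encoded family is constantly 0. Either every such factor of the box contains 0
   ([ok]) and only indices in S are constrained, or the event is empty. *)
pose ok (S : {set I}) (B : 'I_#|I| -> set (measurableTypeR R)) :=
  forall i, i \notin S -> B (enum_rank i) 0.
have nok (S0 : {set I}) B0 : ~ ok S0 B0 ->
    subfamily S0 @^-1` [set t | forall k, B0 k (tnth t k)] = set0.
  move=> no; apply/seteqP; split => w //= wB; apply: no => i iS.
  by have := wB (enum_rank i); rewrite tnth_subfamily (negbTE iS).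
pose C (S : {set I}) (B : 'I_#|I| -> set (measurableTypeR R)) i :=
  if i \in S then B (enum_rank i) else setT.
have mC S0 B0 : (forall k, measurable (B0 k)) -> forall i, measurable (C S0 B0 i).
  by move=> mB0 i; rewrite /C; case: ifP.
have okE (S0 : {set I}) B0 : ok S0 B0 ->
    subfamily S0 @^-1` [set t | forall k, B0 k (tnth t k)] =
    [set w | forall i, C S0 B0 i (g i w)].
  move=> yes; apply/seteqP; split => w /= wB i.
    by rewrite /C; case: ifP => // iS; have := wB (enum_rank i); rewrite tnth_subfamily iS.
  have [j ->] : exists j, i = enum_rank j.
    by exists (enum_val i); rewrite enum_valK.
  by have := wB j; rewrite tnth_subfamily /C; case: ifP => // /negbT/yes.
have [yes1|no1] := pselect (ok S B); last first.
  by rewrite (nok _ _ no1) set0I measure0 mul0e.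
have [yes2|no2] := pselect (ok S' B'); last first.
  by rewrite (nok _ _ no2) setI0 measure0 mule0.
rewrite !okE//.
have -> : [set w | forall i, C S B i (g i w)] `&` [set w | forall i, C S' B' i (g i w)] =
    [set w | forall i, (C S B i `&` C S' B' i) (g i w)].
  apply/seteqP; split => w /=; first by move=> [h h'] i; split; [exact: h|exact: h'].
  by move=> h; split => i; have [] := h i.
rewrite (ig (mC S B mB)) (ig (mC S' B' mB')).
rewrite (ig (fun i => measurableI _ _ (mC S B mB i) (mC S' B' mB' i))).
rewrite -big_split/=; apply: eq_bigr => i _.
rewrite /C; have [iS|iS] := boolP (i \in S).
  by rewrite (negbTE (SS' i iS)) setIT preimage_setT probability_setT mule1.
by rewrite setTI preimage_setT probability_setT mul1e.
Qed.

End MutualIndependence.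

Section GaussianSum.
Context disp (T : measurableType disp) (R : realType) (P : probability T R).
Context (I : finType) (g : I -> T -> measurableTypeR R) (s : I -> R).
Hypothesis mg : forall i, measurable_fun setT (g i).
Hypothesis ig : mut_indep P g.
Hypothesis s0 : forall i, 0 < s i.
Hypothesis lg : forall i B, measurable B -> P (g i @^-1` B) = normal_prob 0 (s i) B.

Lemma integral_gaussian i (f : measurableTypeR R -> \bar R) :
  measurable_fun setT f -> (forall x, 0 <= f x)%E ->
  (\int[P]_w f (g i w) = \int[normal_prob 0 (s i)]_x f x)%E.
Proof.
move=> mf f0.
pose X : {mfun T >-> measurableTypeR R} := mfun_Sub (mem_set (mg i)).
transitivity (\int[distribution P X]_x f x)%E.
  by rewrite /distribution ge0_integral_pushforward.
by apply: eq_measure_integral => A mA _; exact: (lg i mA).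
Qed.

Lemma measurable_comb (r : seq I) (a : I -> R) :
  measurable_fun setT (fun w => \sum_(i <- r) a i * g i w).
Proof.
exact: (measurable_sum r (fun i => measurable_funM (measurable_cst _) (mg i))).
Qed.

(** This replaces the fact that a combination of independent centred Gaussians is Gaussian, the heat
    kernel being the only test function used below. One variable is peeled off at a time, with the
    others frozen. *)
Lemma integral_heat_comb (r : seq I) (a : I -> R) (t c : R) : uniq r -> 0 < t ->
  (\int[P]_w (heat t (c + \sum_(i <- r) a i * g i w))%:E =
   (heat (t + \sum_(i <- r) a i ^+ 2 * s i ^+ 2) c)%:E)%E.
Proof.
elim: r t c => [|i r IH] t c /=.
  move=> _ t0; rewrite big_nil addr0.
  under eq_integral do rewrite big_nil addr0.
  by rewrite integral_cst//= [X in (_ * X)%E]probability_setT mule1.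
move=> /andP[ir ur] t0.
pose S := [set j in r]%SET.
have dis j : j \in [set i]%SET -> j \notin S by rewrite !inE => /eqP ->.
have iX := indep_subfamily mg ig dis.
pose f (z : #|I|.-tuple (measurableTypeR R) * #|I|.-tuple (measurableTypeR R)) : \bar R :=
  (heat t (c + (a i * tnth z.1 (enum_rank i) + \sum_(j <- r) a j * tnth z.2 (enum_rank j))))%:E.
have fE w w' : f (subfamily g [set i]%SET w, subfamily g S w') =
    (heat t (c + (a i * g i w + \sum_(j <- r) a j * g j w')))%:E.
  rewrite /f /= tnth_subfamily inE eqxx; congr (heat _ (_ + (_ + _)))%:E.
  by apply: eq_big_seq => j jr; rewrite tnth_subfamily inE jr.
have mf : measurable_fun setT f.
  apply/measurable_EFinP; apply: (measurableT_comp (measurable_heat t)).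
  apply: measurable_funD => //; apply: measurable_funD.
    apply: measurable_funM => //.
    exact: (measurableT_comp (measurable_tnth _)).
  apply: measurable_sum => j; apply: measurable_funM => //.
  exact: (measurableT_comp (measurable_tnth _)).
under eq_integral do rewrite big_cons -fE.
rewrite (integral_indep (measurable_subfamily mg _) (measurable_subfamily mg _) iX mf); last first.
  by move=> z; rewrite lee_fin heat_ge0.
transitivity (\int[P]_w (heat (t + a i ^+ 2 * s i ^+ 2) (c + \sum_(j <- r) a j * g j w))%:E)%E.
  apply: eq_integral => w' _; under eq_integral do rewrite fE addrCA addrC.
  rewrite (integral_gaussian i (f := fun x => (heat t (c + \sum_(j <- r) a j * g j w' + a i * x))%:E)).
  - by rewrite integral_heat.
  - apply/measurable_EFinP; apply: (measurableT_comp (measurable_heat t)).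
    by apply: measurable_funD => //; exact: measurable_funM.
  - by move=> x; rewrite lee_fin heat_ge0.
rewrite IH// ?big_cons ?addrA//.
by apply: ltr_wpDr => //; rewrite mulr_ge0 ?sqr_ge0.
Qed.

End GaussianSum.

(** * Probability inequalities and Gaussian anti-concentration *)

Section ProbTools.
Context disp (T : measurableType disp) (R : realType) (P : probability T R).

Lemma prob_le_integral (A : set T) (f : T -> \bar R) :
  measurable A -> measurable_fun setT f -> (forall w, 0 <= f w)%E ->
  (forall w, A w -> 1 <= f w)%E -> (P A <= \int[P]_w f w)%E.
Proof.
move=> mA mf f0 Af; rewrite -[A in leLHS]setIT -integral_indic//.
apply: ge0_le_integral => //.
- exact/measurable_EFinP/measurable_indic.
- move=> w _; rewrite indicE; case: (boolP (w \in A)) => wA //=.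
  by apply: Af; rewrite inE in wA.
Qed.

Lemma measurable_lt_set (f : T -> R) (c : R) : measurable_fun setT f ->
  measurable [set w | f w < c].
Proof.
move=> mf; rewrite -[X in measurable X]setTI.
have -> : [set w | f w < c] = f @^-1` `]-oo, c[ by apply/seteqP; split => w /=; rewrite in_itv.
exact: mf.
Qed.

Lemma measurable_le_set (f : T -> R) (c : R) : measurable_fun setT f ->
  measurable [set w | c <= f w].
Proof.
move=> mf; rewrite -[X in measurable X]setTI.
have -> : [set w | c <= f w] = f @^-1` `[c, +oo[.
  by apply/seteqP; split => w /=; rewrite in_itv/= andbT.
exact: mf.
Qed.

Lemma measurable_forall_le_set (I : finType) (f : I -> T -> R) (c : R) :
  (forall i, measurable_fun setT (f i)) -> measurable [set w | forall i, c <= f i w].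
Proof.
move=> mf; rewrite (_ : [set w | _] = \bigcap_(i in [set: I]) [set w | c <= f i w]).
  by apply: fin_bigcap_measurable => // i _; exact: measurable_le_set.
by apply/seteqP; split => w fw i; [move=> _|]; apply: fw.
Qed.

Lemma prob_markov (f : T -> R) (c : R) : measurable_fun setT f -> (forall w, 0 <= f w) ->
  0 < c -> (P [set w | (c <= f w)%R] <= (c^-1)%:E * \int[P]_w (f w)%:E)%E.
Proof.
move=> mf f0 c0; rewrite -ge0_integralZl//.
- apply: prob_le_integral.
  + exact: measurable_le_set.
  + apply/measurable_EFinP; exact: measurable_funM.
  + by move=> w; rewrite -EFinM lee_fin mulr_ge0// invr_ge0 ltW.
  + by move=> w /= cf; rewrite -EFinM lee_fin ler_pdivlMl// mulr1.
- exact/measurable_EFinP.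
- by move=> w _; rewrite lee_fin.
- by rewrite lee_fin invr_ge0 ltW.
Qed.

(* Chebyshev's inequality: by pairwise independence the variance of the count is
   at most its mean. *)
Lemma prob_count_lt (I : finType) (E : I -> set T) :
  (forall i, measurable (E i)) ->
  (forall i j, i != j -> P (E i `&` E j) = (P (E i) * P (E j))%E) ->
  (forall i, (2^-1)%:E <= P (E i))%E ->
  (P [set w | (\sum_i \1_(E i) w < #|I|%:R / 4 :> R)%R] <= (16 / #|I|%:R)%:E)%E.
Proof.
move=> mE iE pE.
have [I0|I0] := posnP #|I|.
  rewrite (_ : [set w | _] = set0) ?measure0; first by rewrite lee_fin divr_ge0.
  apply/seteqP; split => w //=; rewrite I0 mul0r big1 ?ltxx// => i.
  by have := fintype0 i I0.
pose K : R := #|I|%:R; have K0 : 0 < K by rewrite ltr0n.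
pose p i := fine (P (E i)).
have pP i : (p i)%:E = P (E i) by rewrite /p fineK// fin_num_measure.
have p0 i : 0 <= p i by rewrite fine_ge0.
have p2 i : 2^-1 <= p i by rewrite -lee_fin pP.
have p1 i : p i <= 1 by rewrite -lee_fin pP probability_le1.
pose N w : R := \sum_i \1_(E i) w.
pose m := \sum_i p i.
have m0 : 0 <= m by rewrite sumr_ge0.
have mK : K / 2 <= m.
  rewrite -[K]mul1r mulrAC mulr_natr -sumr_const; apply: ler_sum => i _.
  by rewrite mul1r.
have mK1 : m <= K.
  by rewrite /m /K -[_%:R]/(1 *+ _) -sumr_const; apply: ler_sum.
have N0 w : 0 <= N w by apply: sumr_ge0.
have mN : measurable_fun setT N by apply: measurable_sum => i; exact: measurable_indic.
have mNm : measurable_fun setT (fun w => (N w - m) ^+ 2).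
  by apply: measurable_funX; exact: measurable_funB.
have EN : (\int[P]_w (N w)%:E = m%:E)%E.
  under eq_integral do rewrite -sumEFin.
  rewrite ge0_integral_sum//; last by move=> i; exact/measurable_EFinP/measurable_indic.
  rewrite -sumEFin; apply: eq_bigr => i _.
  by rewrite integral_indic// setIT pP.
have EN2 : (\int[P]_w (N w ^+ 2)%:E <= (m + m ^+ 2)%:E)%E.
  have NE w : (N w ^+ 2)%:E = (\sum_i \sum_j (\1_(E i `&` E j) w)%:E)%E.
    rewrite /N expr2 mulr_suml -sumEFin; apply: eq_bigr => i _.
    rewrite mulr_sumr -sumEFin; apply: eq_bigr => j _.
    by rewrite indicI.
  under eq_integral do rewrite NE.
  rewrite ge0_integral_sum//; last 2 first.
  - move=> i; apply: emeasurable_sum => j.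
    apply/measurable_EFinP/measurable_indic; exact: measurableI.
  - by move=> i w _; apply: sume_ge0.
  rewrite (_ : m + m ^+ 2 = \sum_i (p i + \sum_j p i * p j)); last first.
    by rewrite big_split/= expr2 /m mulr_suml; congr (_ + _); apply: eq_bigr => i _; rewrite mulr_sumr.
  rewrite -sumEFin; apply: lee_sum => i _.
  rewrite ge0_integral_sum//; last first.
    by move=> j; apply/measurable_EFinP/measurable_indic; exact: measurableI.
  rewrite (bigD1 i)//= EFinD; apply: leeD.
    by rewrite setIid integral_indic// setIT pP.
  apply: (@le_trans _ _ (\sum_(j | j != i) (p i * p j)%:E)%E); last first.
    rewrite [X in (_ <= X%:E)%E](bigD1 i)//= EFinD -sumEFin -[leLHS]add0e leeD//.
    by rewrite lee_fin mulr_ge0.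
  apply: lee_sum => j ji; rewrite integral_indic//; last exact: measurableI.
  rewrite setIT EFinM !pP [leLHS](iE i j)// 1?eq_sym//.
have var : (\int[P]_w ((N w - m) ^+ 2)%:E <= m%:E)%E.
  (* The expansion of the square is arranged so that all integrands are nonnegative, which avoids
     integrability side conditions. *)
  have : (\int[P]_w ((N w - m) ^+ 2)%:E + (2 * m * m)%:E =
          \int[P]_w (N w ^+ 2)%:E + (m ^+ 2)%:E)%E.
    rewrite [in LHS]EFinM -EN -ge0_integralZl//; last 3 first.
    - exact/measurable_EFinP.
    - by move=> w _; rewrite lee_fin.
    - by rewrite lee_fin mulr_ge0.
    rewrite -ge0_integralD//; last 4 first.
    - by move=> w _; rewrite lee_fin sqr_ge0.
    - exact/measurable_EFinP.
    - by move=> w _; rewrite -EFinM lee_fin !mulr_ge0.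
    - by apply/measurable_EFinP; exact: measurable_funM.
    rewrite -[(m ^+ 2)%:E]mule1 -(@probability_setT _ _ _ P) -integral_cst//.
    rewrite -ge0_integralD//; last 3 first.
    - by move=> w _; rewrite lee_fin sqr_ge0.
    - by apply/measurable_EFinP; exact: measurable_funX.
    - by move=> w _; rewrite lee_fin sqr_ge0.
    apply: eq_integral => w _; rewrite -EFinM -!EFinD; congr EFin; ring.
  move=> h.
  have h2 : (\int[P]_w ((N w - m) ^+ 2)%:E + (2 * m * m)%:E <= (m + m ^+ 2 + m ^+ 2)%:E)%E.
    rewrite h [leRHS]EFinD; apply: leeD; last exact: lexx.
    exact: EN2.
  move: h2; rewrite -leeBrDr// -EFinB => h2; apply: (le_trans h2).
  by rewrite lee_fin; nra.
(* The mean is at least K / 2, so a count below K / 4 deviates by at least K / 4; the variance is at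
   most m <= K, whence 16 / K. *)
apply: (@le_trans _ _ (P [set w | ((K / 4) ^+ 2 <= (N w - m) ^+ 2)%R])).
  apply: le_measure; rewrite ?inE.
  - exact: measurable_lt_set.
  - exact: measurable_le_set.
  - by move=> w /=; rewrite -/K -/(N w) => h; nra.
apply: (le_trans (prob_markov mNm _ _)) => [w||].
- exact: sqr_ge0.
- by rewrite exprn_gt0// divr_gt0.
apply: (@le_trans _ _ (((K / 4) ^+ 2)^-1%:E * m%:E)%E).
  by rewrite lee_pmul2l// lte_fin invr_gt0 exprn_gt0// divr_gt0.
rewrite -EFinM lee_fin -/K.
have -> : ((K / 4) ^+ 2)^-1 * m = 16 / K * (K^-1 * m) by field; rewrite gt_eqF.
by apply: ler_piMr; [rewrite divr_ge0// ltW|rewrite ler_pdivrMl// mulr1].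
Qed.

End ProbTools.

Section SmallBall.
Context disp (T : measurableType disp) (R : realType) (P : probability T R).
Context (I : finType) (g : I -> T -> measurableTypeR R) (s : I -> R).
Hypothesis mg : forall i, measurable_fun setT (g i).
Hypothesis ig : mut_indep P g.
Hypothesis s0 : forall i, 0 < s i.
Hypothesis lg : forall i B, measurable B -> P (g i @^-1` B) = normal_prob 0 (s i) B.
Variables (r : seq I) (a : I -> R).
Hypothesis ur : uniq r.

Let v := \sum_(i <- r) a i ^+ 2 * s i ^+ 2.
Let Y w : R := \sum_(i <- r) a i * g i w.

Let v0 : 0 <= v.
Proof. by apply: sumr_ge0 => i _; rewrite mulr_ge0// sqr_ge0. Qed.

Let mY : measurable_fun setT Y.
Proof. exact: measurable_comb. Qed.

Let mY2 : measurable_fun setT (fun w => Y w ^+ 2).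
Proof. exact: measurable_funX. Qed.

Let mheat e : measurable_fun setT (fun w => (heat e (0 + Y w))%:E).
Proof.
apply/measurable_EFinP; apply: (measurableT_comp (measurable_heat e)).
exact: measurable_funD.
Qed.

Let Eheat e : 0 < e -> (\int[P]_w (heat e (0 + Y w))%:E = ((Num.sqrt (e + v))^-1)%:E)%E.
Proof.
move=> e0; rewrite (integral_heat_comb mg ig s0 lg a 0 ur e0) -/v /heat.
by rewrite expr0n mul0r oppr0 expR0 mulr1.
Qed.

(* The indicator of [y ^+ 2 < e] is at most [2 * Num.sqrt e * heat e y], and the
   expectation of the heat kernel is explicit. *)
Lemma gaussian_small_ball e : 0 < e -> 0 < v ->
  (P [set w | (Y w ^+ 2 < e)%R] <= (2 * Num.sqrt (e / v))%:E)%E.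
Proof.
move=> e0 vpos; set c := 2 * Num.sqrt e.
have c0 : 0 <= c by rewrite mulr_ge0.
apply: (@le_trans _ _ (\int[P]_w (c%:E * (heat e (0 + Y w))%:E))%E).
  apply: prob_le_integral.
  - exact: measurable_lt_set.
  - exact: emeasurable_funM.
  - by move=> w; rewrite -EFinM lee_fin mulr_ge0// heat_ge0.
  - move=> w /= Ye; rewrite -EFinM lee_fin add0r /heat /c mulrA -(mulrA 2).
    rewrite divff ?mulr1 ?gt_eqF ?sqrtr_gt0//.
    have : - (Y w ^+ 2 / (2 * e)) >= - 2^-1.
      by rewrite lerN2 ler_pdivrMr ?mulr_gt0// mulrA mulVf// mul1r ltW.
    by have := expR_ge1Dx (- (Y w ^+ 2 / (2 * e))); lra.
rewrite ge0_integralZl//; last by move=> w _; rewrite lee_fin heat_ge0.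
rewrite Eheat// -EFinM lee_fin /c.
have -> : Num.sqrt (e / v) = Num.sqrt e / Num.sqrt v.
  by rewrite sqrtrM ?ltW// sqrtrV// ltW.
rewrite mulrA ler_pM2l ?mulr_gt0 ?sqrtr_gt0//.
rewrite lef_pV2 ?posrE ?sqrtr_gt0 ?addr_gt0//.
by rewrite ler_wsqrtr// lerDr ltW.
Qed.

(** A Chebyshev-type bound without second moments. Pointwise, the indicator plus 3 sqrt(e) times the
    heat kernel is at most 3, because exp(-y) <= 1 / (1 + y) <= 2 / 3 for y >= 1 / 2. Taking
    expectations gives 3 (1 - sqrt(e / (e + v))), which is at most 3 v / e. *)
Lemma gaussian_tail e : 0 < e ->
  (P [set w | (e <= Y w ^+ 2)%R] <= (3 * v / e)%:E)%E.
Proof.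
move=> e0; set c := 3 * Num.sqrt e.
have c0 : 0 <= c by rewrite mulr_ge0.
set A := [set w | _].
have mA : measurable A by exact: measurable_le_set.
have h : (P A + (c / Num.sqrt (e + v))%:E <= 3%:E)%E.
  rewrite EFinM -Eheat// -[A]setIT -integral_indic// -ge0_integralZl//; last first.
    by move=> w _; rewrite lee_fin heat_ge0.
  rewrite -ge0_integralD//; last 3 first.
  - exact/measurable_EFinP/measurable_indic.
  - by move=> w _; rewrite -EFinM lee_fin mulr_ge0// heat_ge0.
  - exact: emeasurable_funM.
  rewrite -[leRHS]mule1 -(@probability_setT _ _ _ P) -integral_cst//.
  apply: ge0_le_integral => //.
  - by move=> w _; rewrite -EFinM -EFinD lee_fin addr_ge0// mulr_ge0// heat_ge0.
  - apply: emeasurable_funD; first exact/measurable_EFinP/measurable_indic.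
    exact: emeasurable_funM.
  - move=> w _; rewrite -EFinM -EFinD lee_fin add0r /heat /c mulrA -(mulrA 3).
    rewrite divff ?mulr1 ?gt_eqF ?sqrtr_gt0// indicE.
    have E1 : expR (- (Y w ^+ 2 / (2 * e))) <= 1.
      by rewrite -expR0 ler_expR oppr_le0 divr_ge0 ?sqr_ge0// mulr_ge0// ltW.
    case: (boolP (w \in A)) => [|_]; last by rewrite add0r; lra.
    rewrite inE /A/= => eY.
    have : 2^-1 <= Y w ^+ 2 / (2 * e) by rewrite ler_pdivlMr ?mulr_gt0// mulrA mulVf// mul1r.
    set y := _ / _ => y2.
    have := expR_ge1Dx y => ey.
    have : expR (- y) * expR y = 1 by rewrite mulrC expRxMexpNx_1.
    have := expR_ge0 (- y); nra.
have PA : P A \is a fin_num by exact: fin_num_measure.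
have : (P A <= (3 - c / Num.sqrt (e + v))%:E)%E by rewrite EFinB leeBrDr.
move=> h2; apply: (le_trans h2); rewrite lee_fin.
have ev : 0 < e + v by rewrite ltr_wpDr.
have -> : c / Num.sqrt (e + v) = 3 * Num.sqrt (e / (e + v)).
  by rewrite /c -mulrA sqrtrM ?ltW// sqrtrV// ltW.
have x0 : 0 <= e / (e + v) by rewrite divr_ge0// ltW.
have x1 : e / (e + v) <= 1 by rewrite ler_pdivrMr// mul1r lerDl.
have : e / (e + v) <= Num.sqrt (e / (e + v)).
  by rewrite -{1}(sqr_sqrtr x0) expr2 ler_piMl ?sqrtr_ge0// -sqrtr1 ler_wsqrtr.
have : 1 - v / e <= e / (e + v).
  rewrite ler_pdivlMr// mulrBl mul1r -mulrA.
  have : v / e * (e + v) = v + v * v / e by field; rewrite gt_eqF.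
  have : 0 <= v * v / e by rewrite divr_ge0 ?mulr_ge0// ltW.
  lra.
by rewrite -mulrA; lra.
Qed.

End SmallBall.

(** * Measurability of random matrices, projections and eigenvalues *)

Section MatrixMeasurable.
Context disp (T : measurableType disp) (R : realType).

Definition mx_measurable m n (f : T -> 'M[R]_(m, n)) : Prop :=
  forall i j, measurable_fun setT (fun w => f w i j).

Lemma mx_measurable_cst m n (A : 'M[R]_(m, n)) : mx_measurable (fun=> A).
Proof. by move=> i j; exact: measurable_cst. Qed.

Lemma mx_measurableD m n (f g : T -> 'M[R]_(m, n)) :
  mx_measurable f -> mx_measurable g -> mx_measurable (fun w => f w + g w).
Proof.
move=> mf mg i j; under eq_fun do rewrite mxE.
by apply: measurable_funD; [exact: mf|exact: mg].
Qed.

Lemma mx_measurableN m n (f : T -> 'M[R]_(m, n)) :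
  mx_measurable f -> mx_measurable (fun w => - f w).
Proof.
move=> mf i j; under eq_fun do rewrite mxE.
by apply: measurableT_comp => //; exact: mf.
Qed.

Lemma mx_measurableB m n (f g : T -> 'M[R]_(m, n)) :
  mx_measurable f -> mx_measurable g -> mx_measurable (fun w => f w - g w).
Proof. by move=> mf mg; apply: mx_measurableD => //; exact: mx_measurableN. Qed.

Lemma mx_measurableZ m n (c : T -> R) (f : T -> 'M[R]_(m, n)) :
  measurable_fun setT c -> mx_measurable f -> mx_measurable (fun w => c w *: f w).
Proof.
move=> mc mf i j; under eq_fun do rewrite mxE.
by apply: measurable_funM => //; exact: mf.
Qed.

Lemma mx_measurable_sum m n (I : Type) (r : seq I) (f : I -> T -> 'M[R]_(m, n)) :
  (forall i, mx_measurable (f i)) -> mx_measurable (fun w => \sum_(i <- r) f i w).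
Proof.
move=> mf i j; under eq_fun do rewrite summxE.
by apply: measurable_sum => k; exact: mf.
Qed.

Lemma mx_measurable_mul m n p (f : T -> 'M[R]_(m, n)) (g : T -> 'M[R]_(n, p)) :
  mx_measurable f -> mx_measurable g -> mx_measurable (fun w => f w *m g w).
Proof.
move=> mf mg i j; under eq_fun do rewrite mxE.
by apply: measurable_sum => k; apply: measurable_funM; [exact: mf|exact: mg].
Qed.

Lemma mx_measurable_tr m n (f : T -> 'M[R]_(m, n)) :
  mx_measurable f -> mx_measurable (fun w => (f w)^T).
Proof. by move=> mf i j; under eq_fun do rewrite mxE; exact: mf. Qed.

Lemma measurable_nsq d (f : T -> 'cV[R]_d) : mx_measurable f ->
  measurable_fun setT (fun w => nsq (f w)).
Proof.
move=> mf; apply: measurable_sum => i; apply: measurable_funX; exact: mf.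
Qed.

Lemma mx_measurable_proj_compl d (zs : seq (T -> 'cV[R]_d)) :
  (forall z, List.In z zs -> mx_measurable z) ->
  mx_measurable (fun w => proj_compl [seq z w | z <- zs]).
Proof.
elim: zs => [_|z zs IH mz] /=; first exact: mx_measurable_cst.
have mP : mx_measurable (fun w => proj_compl [seq z w | z <- zs]).
  by apply: IH => y yzs; apply: mz; right.
have mv : mx_measurable (fun w => proj_compl [seq z w | z <- zs] *m z w).
  by apply: mx_measurable_mul => //; apply: mz; left.
apply: mx_measurableB => //; apply: mx_measurableZ.
  (* On nonnegative reals the inverse, with the value 0 at 0, is the power function of exponent -1,
     which is measurable. *)
  rewrite (_ : (fun w => _) =
      (fun w => nsq (proj_compl [seq z w | z <- zs] *m z w) `^ (-1))); last first.
    by apply/funext => w; rewrite powR_inv1// nsq_ge0.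
  apply: (measurableT_comp (measurable_powR (-1))); exact: measurable_nsq.
by apply: mx_measurable_mul => //; exact: mx_measurable_tr.
Qed.

(** By [lambda_perturb] the eigenvalue is 1-Lipschitz for the sum of absolute entries. Hence the
    event that it exceeds x is a countable union, over symmetric rational Q and rational e with x +
    e < lambda(Q), of the events that M is within e of Q. *)
Lemma measurable_lambda d k (M : T -> 'M[R]_d) : (k < d)%N ->
  mx_measurable M -> (forall w, (M w)^T = M w) ->
  measurable_fun setT (fun w => lambda k.+1 (M w)).
Proof.
move=> kd mM MT.
have pert (A B : 'M[R]_d) : A^T = A -> B^T = B ->
    lambda k.+1 B - \sum_i \sum_j `|A i j - B i j| <= lambda k.+1 A.
  move=> AT BT; apply: lambda_perturb => // x.
  have n1 i : x i 0 ^+ 2 <= nsq x.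
    by rewrite /nsq (bigD1 i)//= lerDl sumr_ge0// => j _; exact: sqr_ge0.
  suff : (x^T *m (B - A) *m x) 0 0 <= (\sum_i \sum_j `|A i j - B i j|) * nsq x.
    rewrite mulmxBr mulmxBl [X in X <= _ -> _]mxE [X in _ + X <= _ -> _]mxE; lra.
  rewrite [X in _ <= X * _]exchange_big/= mxE mulr_suml; apply: ler_sum => j _.
  rewrite mxE !mulr_suml; apply: ler_sum => i _.
  rewrite !mxE distrC; have := n1 i; have := n1 j.
  set a := x i 0; set b := x j 0; set c := B i j - A i j => hb ha.
  have ab : `|a * b| <= nsq x.
    rewrite ler_norml; have := sqr_ge0 (a + b); have := sqr_ge0 (a - b).
    by move=> h1 h2; apply/andP; split; nra.
  rewrite mulrAC (le_trans (ler_norm _))// normrM mulrC ler_wpM2l//.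
have entry w i j : M w i j = M w j i by rewrite -{1}MT mxE.
pose near (Q : 'M[rat]_d) (e : rat) w := \sum_i \sum_j `|M w i j - ratr (Q i j)| < ratr e.
have mnear Q e : measurable [set w | near Q e w].
  apply: measurable_lt_set; apply: measurable_sum => i; apply: measurable_sum => j.
  apply: measurableT_comp => //; apply: measurable_funB => //; exact: mM.
apply: (measurability _ (RGenOInfty.measurableE R)) => //.
move=> /= _ [_ [x ->] <-]; rewrite setTI.
pose ok (Qe : 'M[rat]_d * rat) := Qe.1^T = Qe.1 /\
  x + ratr Qe.2 < lambda k.+1 (map_mx ratr Qe.1).
pose F n := if unpickle n is Some Qe then
  (if `[< ok Qe >] then [set w | near Qe.1 Qe.2 w] else set0) else set0.
rewrite (_ : _ @^-1` _ = \bigcup_n F n); last first.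
  apply/seteqP; split => w /=; rewrite in_itv/= andbT; last first.
    move=> [n _]; rewrite /F; case: unpickle => // -[Q e]; case: asboolP => // -[/= QT xe].
    rewrite /near => hn.
    have QT' : (map_mx ratr Q : 'M[R]_d)^T = map_mx ratr Q by apply/matrixP => i j; rewrite !mxE -[in LHS]QT mxE.
    have := pert _ _ (MT w) QT'.
    under eq_bigr do under eq_bigr do rewrite mxE.
    by move: hn xe; set u := \sum_i _; lra.
  move=> xM.
  have [e /itvP ein] : exists e : rat, ratr e \in `]0, (lambda k.+1 (M w) - x) / 2[.
    by apply: rat_in_itvoo; rewrite divr_gt0// subr_gt0.
  have e0 : 0 < ratr e :> R by rewrite ein.
  have e2 : ratr e < (lambda k.+1 (M w) - x) / 2 by rewrite ein.
  pose e' : R := ratr e / (d * d).+1%:R.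
  have e'0 : 0 < e' by rewrite divr_gt0.
  (* The rational approximation depends only on the value of the entry, not on its position, so the
     matrix [Q] built from it is symmetric. *)
  have /choice[c cP] : forall y : R, exists q : rat, `|y - ratr q| < e'.
    move=> y; have [q /itvP qin] : exists q : rat, ratr q \in `](y - e'), (y + e')[.
      by apply: rat_in_itvoo; lra.
    exists q; rewrite ltr_norml.
    have : y - e' < ratr q by rewrite qin.
    have : ratr q < y + e' by rewrite qin.
    by move=> ? ?; apply/andP; split; lra.
  pose Q : 'M[rat]_d := \matrix_(i, j) c (M w i j).
  have QT : Q^T = Q by apply/matrixP => i j; rewrite !mxE entry.
  have nQ : \sum_i \sum_j `|M w i j - ratr (Q i j)| < ratr e.
    apply: (@le_lt_trans _ _ (\sum_(i < d) \sum_(j < d) e')).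
      by apply: ler_sum => i _; apply: ler_sum => j _; rewrite mxE ltW.
    rewrite !sumr_const !card_ord -mulrnA -mulr_natr /e' mulrAC ltr_pdivrMr//.
    by rewrite ltr_pM2l// ltr_nat.
  exists (pickle (Q, e)) => //; rewrite /F pickleK; case: asboolP => //= -[]; split => //=.
  have QT' : (map_mx ratr Q : 'M[R]_d)^T = map_mx ratr Q by apply/matrixP => i j; rewrite !mxE entry.
  have := pert _ _ QT' (MT w).
  have -> : \sum_i \sum_j `|map_mx ratr Q i j - M w i j| =
      \sum_i \sum_j `|M w i j - ratr (Q i j)|.
    by apply: eq_bigr => i _; apply: eq_bigr => j _; rewrite [X in `|X - _|]mxE distrC.
  by move: nQ; set u := \sum_i _; lra.
apply: bigcupT_measurable => n; rewrite /F.
by case: unpickle => // -[Q e]; case: ifP.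
Qed.

End MatrixMeasurable.

Lemma mx_measurable_others disp (T : measurableType disp) (R : realType) d q
    (z : 'I_q -> T -> 'cV[R]_d) (j : 'I_q) : (forall l, mx_measurable (z l)) ->
  mx_measurable (fun w => proj_compl (others (fun l => z l w) j)).
Proof.
move=> mz; rewrite /others.
under eq_fun do rewrite (map_comp (fun zl => zl _) z).
apply: mx_measurable_proj_compl => y.
by elim: [seq _ <- _ | _] => //= l ls IH [<- //|/IH].
Qed.

Lemma prob_union_le disp (T : measurableType disp) (R : realType) (P : probability T R)
    (I : finType) (A : I -> set T) : (forall i, measurable (A i)) ->
  (P [set w | exists i, A i w] <= \sum_i P (A i))%E.
Proof.
move=> mA.
have mU : measurable [set w | exists i, A i w].
  rewrite (_ : [set w | _] = \bigcup_(i in [set: I]) A i); last first.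
    by apply/seteqP; split => w /= -[j]; exists j.
  by apply: fin_bigcup_measurable.
have -> : (\sum_i P (A i) = \int[P]_w (\sum_i (\1_(A i) w)%:E))%E.
  rewrite ge0_integral_sum//; last by move=> i; exact/measurable_EFinP/measurable_indic.
  by apply: eq_bigr => i _; rewrite integral_indic// setIT.
apply: prob_le_integral => //.
- by apply: emeasurable_sum => i; exact/measurable_EFinP/measurable_indic.
- by move=> w; apply: sume_ge0.
- move=> w [i Aiw]; rewrite (bigD1 i)//= indicE mem_set// leeDl//.
  by apply: sume_ge0.
Qed.

(** * Distance of one Gaussian vector to the span of the others *)

Section LeaveOneOut.
Context disp (T : measurableType disp) (R : realType) (P : probability T R).
Context (I : finType) (g : I -> T -> measurableTypeR R) (s : I -> R).
Hypothesis mg : forall i, measurable_fun setT (g i).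
Hypothesis ig : mut_indep P g.
Hypothesis s0 : forall i, 0 < s i.
Hypothesis lg : forall i B, measurable B -> P (g i @^-1` B) = normal_prob 0 (s i) B.
Variables (d : nat) (a : I -> 'cV[R]_d).
Local Notation TR := (#|I|.-tuple (measurableTypeR R)).

Definition comb (A : {set I}) (w : T) : 'cV[R]_d := \sum_(i in A) (g i w : R) *: a i.

Definition tcomb (A : {set I}) (t : TR) : 'cV[R]_d :=
  \sum_(i in A) (tnth t (enum_rank i) : R) *: a i.

Lemma tcombE (A B : {set I}) w : {subset A <= B} -> tcomb A (subfamily g B w) = comb A w.
Proof.
move=> AB; apply: eq_bigr => i iA.
by rewrite tnth_subfamily AB.
Qed.

Lemma mx_measurable_tcomb A : mx_measurable (tcomb A).
Proof.
move=> i j; rewrite (_ : (fun t => _) = fun t : TR =>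
    \sum_(k <- enum A) (tnth t (enum_rank k) : R) * a k i j); last first.
  apply/funext => t; rewrite /tcomb summxE big_enum/=.
  by apply: eq_bigr => k _; rewrite mxE.
apply: measurable_sum => k; apply: measurable_funM => //; exact: measurable_tnth.
Qed.

Lemma mx_measurable_comb A : mx_measurable (comb A).
Proof.
move=> i j; rewrite (_ : (fun w => _) = fun w =>
    \sum_(k <- enum A) (g k w : R) * a k i j); last first.
  apply/funext => w; rewrite /comb summxE big_enum/=.
  by apply: eq_bigr => k _; rewrite mxE.
by apply: measurable_sum => k; apply: measurable_funM; [exact: mg|exact: measurable_cst].
Qed.

Variables (r : nat) (S : 'I_r.+1 -> {set I}) (nu : R).
Hypothesis nu0 : 0 < nu.
Hypothesis disS : forall j l i, j != l -> i \in S j -> i \notin S l.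
Hypothesis aS : forall Q : 'M[R]_d, is_proj Q -> d%:R - r%:R <= \tr Q ->
  forall j, nu <= \sum_(i in S j) s i ^+ 2 * nsq (Q *m a i).

(* The squared distance of z j to the span of the other z l. *)
Definition loo_dist (z : 'I_r.+1 -> 'cV[R]_d) (j : 'I_r.+1) : R :=
  nsq (proj_compl (others z j) *m z j).

Lemma measurable_loo d' (T' : measurableType d') (z : 'I_r.+1 -> T' -> 'cV[R]_d) j :
  (forall l, mx_measurable (z l)) -> measurable_fun setT (fun w => loo_dist (z ^~ w) j).
Proof.
move=> mz; apply: measurable_nsq; apply: mx_measurable_mul => //.
exact: mx_measurable_others.
Qed.

(* The j-th vector is independent of the others, so they may be frozen; the
   projection Q is then deterministic and one coordinate of Q z_j has variance at
   least nu / d. *)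
Lemma prob_loo_lt e j : 0 < e -> (0 < d)%N ->
  (P [set w | (loo_dist (fun l => comb (S l) w) j < e)%R]
    <= (2 * Num.sqrt (d%:R * e / nu))%:E)%E.
Proof.
move=> e0 d0; pose S' : {set I} := (\bigcup_(l | l != j) S l)%SET.
have dSS' i : i \in S j -> i \notin S'.
  move=> iS; apply/negP => /bigcupP[l lj il].
  by have := disS lj il; rewrite iS.
have iX := indep_subfamily mg ig dSS'.
(* The j-th vector reads the first component and the others read the second, so that
   [integral_indep] applies to the pair. *)
pose y (l : 'I_r.+1) (t : TR * TR) := if l == j then tcomb (S j) t.1 else tcomb (S l) t.2.
have my l : mx_measurable (y l).
  rewrite /y; case: eqP => _ a1 a2.
    by apply: (measurableT_comp (mx_measurable_tcomb (S j) a1 a2)).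
  by apply: (measurableT_comp (mx_measurable_tcomb (S l) a1 a2)).
have mloo : measurable_fun setT (fun t => loo_dist (y ^~ t) j) by exact: measurable_loo.
set B := [set w | _].
have mB : measurable B.
  by apply: measurable_lt_set; apply: measurable_loo => l; exact: mx_measurable_comb.
pose F t : \bar R := (\1_[set t | loo_dist (y ^~ t) j < e] t)%:E.
have mF : measurable_fun setT F.
  by apply/measurable_EFinP/measurable_indic; exact: measurable_lt_set.
have subS' l : l != j -> {subset S l <= S'}.
  by move=> lj i il; apply/bigcupP; exists l.
have yE w : y ^~ (subfamily g (S j) w, subfamily g S' w) = fun l => comb (S l) w.
  apply/funext => l; rewrite /y; case: eqP => [->|/eqP lj] /=.
    by rewrite tcombE.
  by rewrite tcombE//; exact: subS'.
rewrite -[B]setIT -integral_indic//.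
have -> : (\int[P]_w (\1_B w)%:E = \int[P]_w F (subfamily g (S j) w, subfamily g S' w))%E.
  apply: eq_integral => w _; rewrite /F !indicE; congr ((nat_of_bool _)%:R%:E).
  by rewrite /B; apply/idP/idP; rewrite !inE /= yE.
rewrite (integral_indep (measurable_subfamily mg _) (measurable_subfamily mg _) iX mF); last first.
  by move=> z; rewrite lee_fin.
rewrite -[leRHS]mule1 -(@probability_setT _ _ _ P) -integral_cst//.
have mpre (C : set TR) : measurable C -> measurable (subfamily g (S j) @^-1` C).
  move=> mC; rewrite -[X in measurable X]setTI.
  exact: (measurable_subfamily mg (S j) measurableT).
apply: ge0_le_integral => //.
- by move=> w _; apply: integral_ge0 => w2 _; rewrite lee_fin.
- have mZ : measurable_fun setT (fun ww : T * T => F (subfamily g (S j) ww.1, subfamily g S' ww.2)).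
    apply: (measurableT_comp mF); apply: measurable_fun_pair.
      exact: (measurableT_comp (measurable_subfamily mg (S j))).
    exact: (measurableT_comp (measurable_subfamily mg S')).
  apply: (measurable_fun_fubini_tonelli_G _ mZ) => ?; rewrite lee_fin //.
move=> w' _.
pose Q := proj_compl (others (fun l => comb (S l) w') j).
have [prQ _ trQ] := proj_complP (others (fun l => comb (S l) w') j).
have FE w : F (subfamily g (S j) w, subfamily g S' w') =
    (\1_[set w | nsq (Q *m comb (S j) w) < e] w)%:E.
  have e1 : loo_dist (y ^~ (subfamily g (S j) w, subfamily g S' w')) j = nsq (Q *m comb (S j) w).
    rewrite /loo_dist /y eqxx /= tcombE//; congr (nsq (proj_compl _ *m _)).
    apply/eq_in_map => l; rewrite mem_filter => /andP[lj _].
    by rewrite (negbTE lj) tcombE//; exact: subS'.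
  rewrite /F !indicE; congr ((nat_of_bool _)%:R%:E).
  by apply/idP/idP; rewrite !inE /= e1.
have mQ : mx_measurable (fun w => Q *m comb (S j) w).
  by apply: mx_measurable_mul; [exact: mx_measurable_cst|exact: mx_measurable_comb].
under eq_integral do rewrite FE.
rewrite integral_indic//; last by apply: measurable_lt_set; exact: measurable_nsq.
rewrite setIT size_others in trQ *.
have [i0 hi0] : exists i0, nu / d%:R <= \sum_(i <- enum (S j)) ((Q *m a i) i0 0) ^+ 2 * s i ^+ 2.
  apply/not_existsP => h.
  have := aS prQ trQ j; rewrite leNgt => /negP; apply.
  rewrite /nsq; under eq_bigr do rewrite mulr_sumr.
  rewrite exchange_big/=.
  have -> : nu = \sum_(k < d) nu / d%:R.
    by rewrite sumr_const card_ord -(mulr_natr (nu / d%:R)) divfK// pnatr_eq0 -lt0n.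
  apply: ltr_sum => [|k _].
    by apply/hasP; exists (Ordinal d0); rewrite // mem_index_enum.
  have /negP := h k; rewrite -ltNge big_enum/=; under eq_bigr do rewrite mulrC.
  by [].
set v := \sum_(i <- enum (S j)) _ in hi0.
have v0 : 0 < v by rewrite (lt_le_trans _ hi0)// divr_gt0// ltr0n.
apply: (@le_trans _ _ (P [set w | ((\sum_(i <- enum (S j)) (Q *m a i) i0 0 * g i w) ^+ 2 < e)%R])).
  apply: le_measure; rewrite ?inE.
  - by apply: measurable_lt_set; exact: measurable_nsq.
  - by apply: measurable_lt_set; apply: measurable_funX; exact: measurable_comb.
  - move=> w /=; apply: le_lt_trans.
    rewrite /nsq (bigD1 i0)//= /comb mulmx_sumr summxE big_enum/=.
    rewrite [X in X ^+ 2 <= _](_ : _ = \sum_(i in S j) (Q *m ((g i w : R) *: a i)) i0 0).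
      by rewrite lerDl sumr_ge0// => i _; exact: sqr_ge0.
    by apply: eq_bigr => i _; rewrite -scalemxAr [RHS]mxE mulrC.
have h := gaussian_small_ball mg ig s0 lg (a := fun i => (Q *m a i) i0 0) (enum_uniq _) e0 v0.
rewrite /=; apply: (le_trans h).
have dR : 0 < d%:R :> R by rewrite ltr0n.
rewrite lee_fin ler_pM2l// ler_wsqrtr// ler_pdivrMr//.
have h1 : 1 <= d%:R / nu * v.
  by rewrite mulrAC ler_pdivlMr// mul1r mulrC -ler_pdivrMr.
have -> : d%:R * e / nu * v = e * (d%:R / nu * v) by ring.
by apply: ler_peMr => //; exact: ltW.
Qed.

Lemma prob_loo_ge : (0 < d)%N ->
  ((2^-1)%:E <= P [set w | forall j,
     (nu / (16 * d%:R * r.+1%:R ^+ 2) <= loo_dist (fun l => comb (S l) w) j)%R])%E.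
Proof.
(* With e = nu / (16 d (r+1)^2) the bound of [prob_loo_lt] equals 1 / (2 (r+1)), and the union over
   r+1 indices costs 1/2. *)
move=> d0; set e := nu / _; set E := [set w | _].
have dR : 0 < d%:R :> R by rewrite ltr0n.
have e0 : 0 < e by rewrite divr_gt0// !mulr_gt0// exprn_gt0.
pose B j := [set w | (loo_dist (fun l => comb (S l) w) j < e)%R].
have mB j : measurable (B j).
  by apply: measurable_lt_set; apply: measurable_loo => l; exact: mx_measurable_comb.
have EC : ~` E = [set w | exists j, B j w].
  apply/seteqP; split => w /=.
    by move=> /existsNP[j /negP]; rewrite -ltNge => h; exists j.
  by move=> [j h] /(_ j); rewrite leNgt h.
have mE : measurable E.
  rewrite -[E]setCK EC; apply: measurableC.
  rewrite (_ : [set w | _] = \bigcup_(j in [set: 'I_r.+1]) B j); last first.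
    by apply/seteqP; split => w /= [j]; exists j.
  by apply: fin_bigcup_measurable.
have : (P (~` E) <= (2^-1)%:E)%E.
  rewrite EC; apply: (le_trans (prob_union_le P mB)).
  apply: (@le_trans _ _ (\sum_(j < r.+1) (2 * Num.sqrt (d%:R * e / nu))%:E)%E).
    by apply: lee_sum => j _; exact: prob_loo_lt.
  rewrite sumEFin lee_fin sumr_const card_ord.
  have -> : d%:R * e / nu = ((4 * r.+1%:R)^-1) ^+ 2.
    by rewrite /e; field; rewrite !gt_eqF//= ltr0n.
  rewrite sqrtr_sqr ger0_norm ?invr_ge0// -(mulr_natr (2 * _)).
  by rewrite le_eqVlt; apply/orP; left; apply/eqP; field; rewrite gt_eqF.
rewrite probability_setC// leeBlDr ?fin_num_measure// addeC -leeBlDr ?fin_num_measure//.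
apply: le_trans.
by rewrite -EFinB lee_fin; lra.
Qed.

End LeaveOneOut.

(** Different groups use disjoint sets of variables, so their success events are preimages under
    independent subfamilies, and [prob_count_lt] applies with the bound 1/2 of [prob_loo_ge]. *)
Lemma prob_few_good disp (T : measurableType disp) (R : realType) (P : probability T R)
    (I : finType) (g : I -> T -> measurableTypeR R) (s : I -> R) d (a : I -> 'cV[R]_d)
    (G : finType) r (S : G -> 'I_r.+1 -> {set I}) (nu : R) :
  (forall i, measurable_fun setT (g i)) -> mut_indep P g -> (forall i, 0 < s i) ->
  (forall i B, measurable B -> P (g i @^-1` B) = normal_prob 0 (s i) B) ->
  0 < nu -> (0 < d)%N ->
  (forall p p' j j' i, (p, j) != (p', j') -> i \in S p j -> i \notin S p' j') ->
  (forall Q : 'M[R]_d, is_proj Q -> d%:R - r%:R <= \tr Q ->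
    forall p j, nu <= \sum_(i in S p j) s i ^+ 2 * nsq (Q *m a i)) ->
  (P [set w | (\sum_p \1_[set w | forall j, nu / (16 * d%:R * r.+1%:R ^+ 2) <=
                 loo_dist (fun l => comb g a (S p l) w) j] w < #|G|%:R / 4 :> R)%R]
    <= (16 / #|G|%:R)%:E)%E.
Proof.
move=> mg ig s0 lg nu0 d0 dS aS.
set e := nu / _.
pose U p : {set I} := (\bigcup_j S p j)%SET.
pose E' p := [set t | forall j, e <= loo_dist (fun l => tcomb a (S p l) t) j].
have mE' p : measurable (E' p).
  by apply: measurable_forall_le_set => j; apply: measurable_loo => l; exact: mx_measurable_tcomb.
have EE' p : [set w | forall j, e <= loo_dist (fun l => comb g a (S p l) w) j] =
    subfamily g (U p) @^-1` E' p.
  have cE w : (fun l => comb g a (S p l) w) = (fun l => tcomb a (S p l) (subfamily g (U p) w)).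
    by apply/funext => l; rewrite tcombE// => i iS; apply/bigcupP; exists l.
  by apply/seteqP; split => w /= h j; have := h j; rewrite cE.
apply: prob_count_lt => [p|p p' pp'|p].
- by apply: measurable_forall_le_set => j; apply: measurable_loo => l; exact: mx_measurable_comb.
- rewrite !EE'; apply: (indep_subfamily mg ig) => // i /bigcupP[j _ ij].
  apply/negP => /bigcupP[j' _ ij'].
  have := dS p p' j j' i; rewrite xpair_eqE negb_and pp' => /(_ isT ij).
  by rewrite ij'.
- apply: (prob_loo_ge mg ig s0 lg nu0) => //.
  + move=> j l i jl; apply: dS; by rewrite xpair_eqE eqxx.
  + by move=> Q pQ tQ j; exact: aS.
Qed.

(** * Wiener integrals on a common partition *)

Section Partition.
Variables (R : realType) (pts : seq R).

Definition grid : seq R := sort <=%R (undup pts).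
Definition tau (p : nat) : R := nth 0 grid p.
Definition ncells : nat := (size grid).-1.

Lemma tau_lt p q : (p < q)%N -> (q <= ncells)%N -> tau p < tau q.
Proof.
move=> pq qK.
have ss : sorted <%R grid by rewrite sort_lt_sorted undup_uniq.
have sz : (q < size grid)%N.
  by move: qK pq; rewrite /ncells; case: (size grid) => [|n] /=; lia.
by apply: (sorted_ltn_nth lt_trans) => //; rewrite inE// (ltn_trans pq).
Qed.

Lemma tau_ltE p q : (p <= ncells)%N -> (q <= ncells)%N -> (tau p < tau q) = (p < q)%N.
Proof.
move=> pK qK; case: (ltngtP p q) => [pq|qp|->]; last by rewrite ltxx.
  by rewrite tau_lt.
by apply/negbTE; rewrite -leNgt ltW// tau_lt.
Qed.

Lemma mem_ptsP u : u \in pts -> exists2 p, (p <= ncells)%N & tau p = u.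
Proof.
move=> upts; have ug : u \in grid by rewrite mem_sort mem_undup.
exists (index u grid); last by rewrite /tau nth_index.
by move: ug; rewrite /ncells -index_mem; case: (size grid).
Qed.

Lemma sum_cells (V : zmodType) (f : R -> V) u v : u \in pts -> v \in pts -> v <= u ->
  f u - f v = \sum_(p < ncells | v < tau p.+1 <= u) (f (tau p.+1) - f (tau p)).
Proof.
move=> /mem_ptsP[a aK <-] /mem_ptsP[b bK <-] ba.
have {}ba : (b <= a)%N by rewrite leqNgt -tau_ltE// -leNgt.
rewrite -(telescope_sumr (f \o tau) ba)/=.
rewrite (big_nat_widen _ _ _ _ _ aK) (@big_nat_widenl _ _ _ b 0)//.
rewrite -(big_mkord (fun p => tau b < tau p.+1 <= tau a) (fun p => f (tau p.+1) - f (tau p))).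
rewrite big_nat_cond [RHS]big_nat_cond; apply: eq_bigl => p /=.
have [pK|//] := ltnP p ncells; rewrite !andTb.
by rewrite tau_ltE// leNgt tau_ltE// ltnS -leqNgt andbC.
Qed.

(** The half-open cell contains no partition point except its right end, so comparison with a
    partition point is constant on it. Step functions with ends in [pts] are therefore determined by
    their values at right ends. *)
Lemma tau_cellE u p s : u \in pts -> (p < ncells)%N -> tau p < s <= tau p.+1 ->
  (u < s) = (u < tau p.+1).
Proof.
move=> /mem_ptsP[a aK <-] pK /andP[ps sp].
apply/idP/idP => [h|]; first exact: lt_le_trans h sp.
rewrite tau_ltE// ltnS => ap; apply: le_lt_trans ps.
by move: ap; rewrite leq_eqVlt => /orP[/eqP -> //|ap]; rewrite ltW// tau_lt// ltnW.
Qed.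

Lemma tau_cell_le u p s : u \in pts -> (p < ncells)%N -> tau p < s <= tau p.+1 ->
  (s <= u) = (tau p.+1 <= u).
Proof. by move=> upts pK sp; rewrite leNgt (tau_cellE upts pK sp) -leNgt. Qed.

Local Notation mu := lebesgue_measure.

Lemma integral_cells (f : R -> R) : measurable_fun setT f -> (forall x, 0 <= f x) ->
  (forall p s, (p < ncells)%N -> tau p < s <= tau p.+1 -> f s = f (tau p.+1)) ->
  (\int[mu]_(x in `]tau 0, tau ncells]) (f x)%:E =
   (\sum_(p < ncells) (tau p.+1 - tau p) * f (tau p.+1))%:E)%E.
Proof.
move=> mf f0 fc.
suff : forall k, (k <= ncells)%N -> (\int[mu]_(x in `]tau 0, tau k]) (f x)%:E =
   (\sum_(p < k) (tau p.+1 - tau p) * f (tau p.+1))%:E)%E by exact.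
elim=> [_|k IH kK]; first by rewrite set_itvoc0 integral_set0 big_ord0.
have tk : tau k < tau k.+1 by exact: tau_lt.
have t0k : tau 0 <= tau k by rewrite leNgt tau_ltE// ltnW.
have -> : `]tau 0, tau k.+1]%classic = `]tau 0, tau k] `|` `]tau k, tau k.+1].
  by rewrite -itv_bndbnd_setU// bnd_simp// ltW.
rewrite ge0_integral_setU//=; last 3 first.
- by apply/measurable_funTS/measurable_EFinP.
- by move=> x _; rewrite lee_fin.
- apply/disj_set2P; rewrite -subset0 => x [] /=; rewrite !in_itv/= => /andP[_ xk] /andP[kx _].
  by move: (le_lt_trans xk kx); rewrite ltxx.
rewrite IH ?(ltnW kK)// big_ord_recr/= EFinD; congr (_ + _)%E.
under eq_integral.
  move=> x; rewrite inE/= in_itv/= => xk; rewrite (fc k)//.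
  over.
rewrite integral_cst//= lebesgue_measure_itv/= lte_fin tk -EFinB -EFinM mulrC //.
Qed.

End Partition.

(** * Brownian increments over the cells as an independent Gaussian family *)

Section BrownianIncrements.
Context disp (T : measurableType disp) (R : realType) (P : probability T R).
Context (F : R -> set (set T)) (m : nat) (W : R -> T -> 'cV[R]_m).
Hypothesis fF : filtration F.
Hypothesis bW : brownian P F W.
Variables (t : nat -> R) (K : nat).
Hypothesis t0 : 0 <= t 0.
Hypothesis tlt : forall p q, (p < q)%N -> (q <= K)%N -> t p < t q.

Definition dW (i : 'I_K * 'I_m) (w : T) : measurableTypeR R :=
  (W (t i.1.+1) w - W (t i.1) w) i.2 0.

Let tge p : (p <= K)%N -> 0 <= t p.
Proof. by case: p => [//|p] pK; rewrite (le_trans t0)// ltW// tlt. Qed.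

Let FW_measurable u c : 0 <= u ->
  measurable_fun setT ((fun w => W u w c 0) : g_sigma_algebraType (F u) -> R).
Proof.
have [_ adW _ _ _] := bW; move=> u0 _ B mB; rewrite setTI.
by apply: sub_gen_smallest; exact: adW.
Qed.

Let F_sub u v A : 0 <= u -> u <= v -> F u A -> F v A.
Proof. by move=> u0 uv; exact: fF.2. Qed.

Let F_gen u : 0 <= u -> (measurable : set (set (g_sigma_algebraType (F u)))) = F u.
Proof. by move=> u0; rewrite /measurable/= sigma_algebra_id//; exact: (fF.1 u u0).1. Qed.

Let FdW u (i : 'I_K * 'I_m) B : t i.1.+1 <= u -> measurable B -> F u (dW i @^-1` B).
Proof.
move=> iu mB.
have tp0 : 0 <= t i.1 by apply: tge; rewrite ltnW.
have tp1 : 0 <= t i.1.+1 by apply: tge.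
have u0 : 0 <= u by exact: le_trans iu.
have mWu v : 0 <= v -> v <= u ->
    measurable_fun setT ((fun w => W v w i.2 0) : g_sigma_algebraType (F u) -> R).
  move=> v0 vu _ C mC; rewrite setTI F_gen//; apply: (F_sub v0 vu).
  have := FW_measurable i.2 v0; move=> /(_ measurableT C mC).
  by rewrite setTI F_gen.
have tt : t i.1 <= u by rewrite (le_trans _ iu)// ltW// tlt.
have : measurable_fun setT (dW i : g_sigma_algebraType (F u) -> R).
  rewrite /dW; under eq_fun do rewrite !mxE.
  by apply: measurable_funB; exact: mWu.
by move=> /(_ measurableT B mB); rewrite setTI F_gen.
Qed.

Lemma measurable_dW i : measurable_fun setT (dW i).
Proof.
move=> _ B mB; rewrite setTI.
have ti : 0 <= t i.1.+1 by exact: tge.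
apply: (fF.1 _ ti).2; exact: FdW.
Qed.

Lemma sd_dW_gt0 (i : 'I_K * 'I_m) : 0 < Num.sqrt (t i.1.+1 - t i.1).
Proof. by rewrite sqrtr_gt0 subr_gt0 tlt. Qed.

Let box_prob (p : 'I_K) (B : 'I_m -> set (measurableTypeR R)) :
  (forall c, measurable (B c)) ->
  P [set w | forall c, B c (dW (p, c) w)] =
  (\prod_(c < m) normal_prob 0 (Num.sqrt (t p.+1 - t p)) (B c))%E.
Proof.
move=> mB; have [_ _ _ law _] := bW.
by rewrite -law ?tge ?tlt// ltnW.
Qed.

Lemma law_dW i B : measurable B ->
  P (dW i @^-1` B) = normal_prob 0 (Num.sqrt (t i.1.+1 - t i.1)) B.
Proof.
case: i => p c mB.
pose B' c' := if c' == c then B else setT.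
have mB' c' : measurable (B' c') by rewrite /B'; case: ifP.
rewrite (_ : _ @^-1` _ = [set w | forall c, B' c (dW (p, c) w)]); last first.
  apply/seteqP; split => w /=; first by move=> Bw c'; rewrite /B'; case: eqP => [->|].
  by move=> /(_ c); rewrite /B' eqxx.
rewrite box_prob// (bigD1 c)//= big1 ?mule1 => [|c' /negbTE cc'].
  by rewrite /B' eqxx.
by rewrite /B' cc' probability_setT.
Qed.

(** Cells are added in order of time: the event on the first k cells lies in F(t k) and is thus
    independent of the next increment, whose coordinates are independent by the product form of its
    law. *)
Lemma mut_indep_dW : mut_indep P dW.
Proof.
move=> B mB; have [_ _ _ _ indW] := bW.
pose A k := [set w | forall p : 'I_K, (p < k)%N -> forall c, B (p, c) (dW (p, c) w)].
have AS k (kK : (k < K)%N) : A k.+1 =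
    A k `&` [set w | forall c, B (Ordinal kK, c) (dW (Ordinal kK, c) w)].
  apply/seteqP; split => w /=.
    by move=> h; split => [p pk|]; apply: h => //; exact: ltnW.
  move=> [h1 h2] p; rewrite ltnS leq_eqVlt => /orP[/eqP pk|]; last exact: h1.
  by rewrite (_ : p = Ordinal kK)//; exact: val_inj.
have FA k : (k <= K)%N -> F (t k) (A k).
  elim: k => [_|k IH kK].
    rewrite (_ : A 0 = setT); last by apply/seteqP; split.
    by rewrite -F_gen//; exact: measurableT.
  have tk0 := tge kK.
  rewrite (AS _ kK) -F_gen//; apply: measurableI; rewrite F_gen//.
    by apply: F_sub (IH (ltnW kK)); [exact/tge/ltnW|exact/ltW/tlt].
  rewrite (_ : [set w | _] = \bigcap_(c in [set: 'I_m])
      (dW (Ordinal kK, c) @^-1` B (Ordinal kK, c))); last first.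
    by apply/seteqP; split => w h c; [move=> _|]; apply: h.
  rewrite -F_gen//; apply: fin_bigcap_measurable => // c _; rewrite F_gen//.
  exact: FdW.
have PA k : (k <= K)%N -> P (A k) =
    (\prod_(p < K | (p < k)%N) \prod_(c < m) P (dW (p, c) @^-1` B (p, c)))%E.
  elim: k => [_|k IH kK].
    rewrite (_ : A 0 = setT); last by apply/seteqP; split.
    by rewrite probability_setT big_pred0.
  have e1 : P (A k.+1) = (P (A k) *
      P [set w | forall c, B (Ordinal kK, c) (dW (Ordinal kK, c) w)])%E.
    rewrite (AS _ kK).
    apply: (indW (t k) (t k.+1) (A k) (fun c => B (Ordinal kK, c))) => //.
    - exact/tge/ltnW.
    - exact: tlt.
    - exact/FA/ltnW.
  rewrite e1 IH 1?ltnW// [RHS](bigD1 (Ordinal kK))//= muleC; congr (_ * _)%E.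
    by rewrite (@box_prob (Ordinal kK) (fun c => B (Ordinal kK, c)))//; apply: eq_bigr => c _; rewrite law_dW.
  apply: eq_bigl => p; rewrite ltnS -(inj_eq val_inj)/= ltn_neqAle andbC.
  by [].
rewrite (_ : [set w | _] = A K); last first.
  by apply/seteqP; split => w h; [move=> p _ c; exact: h|case=> p c; exact: h].
rewrite PA// (eq_bigl xpredT) => [|p]; last by rewrite ltn_ord.
by rewrite pair_bigA/=; apply: eq_bigr => -[].
Qed.

End BrownianIncrements.

Section Frobenius.
Variables (R : realType) (d m : nat).
Implicit Types A B : 'M[R]_(d, m).

Lemma frob2_cols A : frob2 A = \sum_c nsq (col c A).
Proof.
rewrite /frob2 exchange_big/=; apply: eq_bigr => c _.
by apply: eq_bigr => i _; rewrite mxE.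
Qed.

Lemma frob2_ge0 A : 0 <= frob2 A.
Proof. by rewrite frob2_cols sumr_ge0// => c _; exact: nsq_ge0. Qed.

Lemma frob2D_le A B : frob2 (A + B) <= 2 * frob2 A + 2 * frob2 B.
Proof.
rewrite !frob2_cols !mulr_sumr -big_split/=; apply: ler_sum => c _.
by rewrite linearD/=; exact: nsqD_le.
Qed.

Lemma frob2N A : frob2 (- A) = frob2 A.
Proof.
by rewrite !frob2_cols; apply: eq_bigr => c _; rewrite linearN/= nsqN.
Qed.

Lemma frob2_proj_le (Q : 'M[R]_d) A : is_proj Q -> frob2 (Q *m A) <= frob2 A.
Proof.
move=> pQ; rewrite !frob2_cols; apply: ler_sum => c _.
by rewrite !colE -mulmxA; exact: nsq_proj_le.
Qed.

Lemma frob2_trace (Q : 'M[R]_d) A : is_proj Q ->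
  frob2 (Q *m A) = \tr (Q *m (A *m A^T) *m Q).
Proof.
move=> [QT _]; have -> : Q *m (A *m A^T) *m Q = (Q *m A) *m (Q *m A)^T.
  by rewrite trmx_mul QT !mulmxA.
move: (Q *m A) => B; rewrite /frob2 /mxtrace; apply: eq_bigr => i _; rewrite mxE.
by apply: eq_bigr => j _; rewrite mxE expr2.
Qed.

End Frobenius.

Section StepFunctions.
Context (R : realType) (d m : nat).
Implicit Types l : step_seq R d m.

Definition ends_in (pts : seq R) l : bool :=
  all (fun e : (R * R) * 'M[R]_(d, m) => (e.1.1 \in pts) && (e.1.2 \in pts)) l.

Lemma step_fun_cell pts l p s : ends_in pts l -> (p < ncells pts)%N ->
  tau pts p < s <= tau pts p.+1 -> step_fun l s = step_fun l (tau pts p.+1).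
Proof.
move=> /allP lp pK sp; apply: eq_big_seq => e /lp /andP[e1 e2].
by rewrite (tau_cellE e1 pK sp) (tau_cell_le e2 pK sp).
Qed.

Lemma step_integral_cells disp (T : measurableType disp) (W : R -> T -> 'cV[R]_m)
    pts l w : ends_in pts l -> step_within 0 1 l ->
  step_integral W l w = \sum_(p < ncells pts)
    step_fun l (tau pts p.+1) *m (W (tau pts p.+1) w - W (tau pts p) w).
Proof.
move=> /allP lp /allP lw.
under [RHS]eq_bigr do rewrite /step_fun mulmx_suml.
rewrite exchange_big/=; apply: eq_big_seq => e el.
have /andP[e1 e2] := lp _ el; have /and3P[_ e12 _] := lw _ el.
rewrite (sum_cells (fun u => W u w) e2 e1 e12) mulmx_sumr big_mkcond/=.
apply: eq_bigr => p _; rewrite -scalemxAl.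
by case: ifP => _; rewrite ?scale1r ?scale0r.
Qed.

Lemma mx_measurable_step_fun l :
  mx_measurable (step_fun l : measurableTypeR R -> 'M[R]_(d, m)).
Proof.
apply: mx_measurable_sum => e; apply: mx_measurableZ; last exact: mx_measurable_cst.
rewrite (_ : (fun w => _) = \1_`]e.1.1, e.1.2]); first exact: measurable_indic.
by apply/funext => s; rewrite indicE mem_setE in_itv.
Qed.

Lemma step_fun_out l a b s : step_within a b l -> b < s -> step_fun l s = 0.
Proof.
move=> /allP lw bs; rewrite /step_fun big_seq big1// => e /lw /and3P[_ _ eb].
by rewrite [s <= _]leNgt (le_lt_trans eb bs) andbF scale0r.
Qed.

End StepFunctions.

Lemma measurable_frob2 disp (T : measurableType disp) (R : realType) d m D
    (f : T -> 'M[R]_(d, m)) :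
  (forall i j, measurable_fun D (fun w => f w i j)) ->
  measurable_fun D (fun w => frob2 (f w)).
Proof.
move=> mf; apply: measurable_sum => i; apply: measurable_sum => j.
by apply: measurable_funX; exact: mf.
Qed.

Section IncrementTail.
Context disp (T : measurableType disp) (R : realType) (P : probability T R).
Context (F : R -> set (set T)) (m : nat) (W : R -> T -> 'cV[R]_m).
Hypothesis fF : filtration F.
Hypothesis bW : brownian P F W.
Variables (t : nat -> R) (K : nat).
Hypothesis t0 : 0 <= t 0.
Hypothesis tlt : forall p q, (p < q)%N -> (q <= K)%N -> t p < t q.

Let sumE d (D : 'I_K -> 'M[R]_(d, m)) w c :
  (\sum_p D p *m (W (t p.+1) w - W (t p) w)) c 0 =
  \sum_(i <- index_enum ('I_K * 'I_m)%type) D i.1 c i.2 * (dW W t i w).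
Proof.
rewrite summxE -(pair_bigA _ (fun p c' => D p c c' * dW W t (p, c') w))/=.
by apply: eq_bigr => p _; rewrite mxE.
Qed.

Lemma mx_measurable_increments d (D : 'I_K -> 'M[R]_(d, m)) :
  mx_measurable (fun w => \sum_p D p *m (W (t p.+1) w - W (t p) w)).
Proof.
move=> c j; rewrite ord1; under eq_fun do rewrite sumE.
exact/measurable_comb/(measurable_dW fF bW t0 tlt).
Qed.

(** [gaussian_tail] is applied to each coordinate with threshold rho / d, followed by a union bound.
    The coordinate variances add up to the squared L2 norm of the step function, as in the Ito
    isometry. *)
Lemma increments_tail d (D : 'I_K -> 'M[R]_(d, m)) rho : 0 < rho -> (0 < d)%N ->
  (P [set w | (rho <= nsq (\sum_p D p *m (W (t p.+1) w - W (t p) w)))%R] <=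
   (3 * d%:R * (\sum_(p < K) (t p.+1 - t p) * frob2 (D p)) / rho)%:E)%E.
Proof.
move=> rho0 d0.
pose X w := \sum_p D p *m (W (t p.+1) w - W (t p) w).
have dR : 0 < d%:R :> R by rewrite ltr0n.
have mX : mx_measurable X by exact: mx_measurable_increments.
have mA c : measurable [set w | rho / d%:R <= X w c 0 ^+ 2].
  by apply: measurable_le_set; apply: measurable_funX; exact: mX.
apply: (@le_trans _ _ (P [set w | exists c, rho / d%:R <= X w c 0 ^+ 2])).
  apply: le_measure; rewrite ?inE.
  - by apply: measurable_le_set; exact: measurable_nsq.
  - rewrite (_ : [set w | _] = \bigcup_(c in [set: 'I_d]) [set w | rho / d%:R <= X w c 0 ^+ 2]).
      by apply: fin_bigcup_measurable.
    by apply/seteqP; split => w /= -[j]; exists j.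
  - move=> w /=; rewrite -/(X w) => h; apply/not_existsP => hc.
    move: h; apply/negP; rewrite -ltNge.
    have -> : rho = \sum_(c < d) rho / d%:R.
      by rewrite sumr_const card_ord -(mulr_natr (rho / d%:R)) divfK// gt_eqF.
    apply: ltr_sum => [|c _]; first by apply/hasP; exists (Ordinal d0); rewrite // mem_index_enum.
    by have /negP := hc c; rewrite -ltNge.
apply: (le_trans (prob_union_le P mA)).
have tail c : (P [set w | (rho / d%:R <= X w c 0 ^+ 2)%R] <=
    (3 * (\sum_(i <- index_enum ('I_K * 'I_m)%type) D i.1 c i.2 ^+ 2 * (t i.1.+1 - t i.1))
      / (rho / d%:R))%:E)%E.
  have := gaussian_tail (measurable_dW fF bW t0 tlt) (mut_indep_dW fF bW t0 tlt)
    (sd_dW_gt0 tlt) (law_dW bW t0 tlt) (fun i => D i.1 c i.2)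
    (index_enum_uniq _) (divr_gt0 rho0 dR).
  under eq_bigr => i _ do rewrite sqr_sqrtr ?subr_ge0 ?(ltW (tlt _ _))//.
  by congr (P _ <= _)%E; apply/seteqP; split => w /=; rewrite /X sumE.
apply: (le_trans (lee_sum _ (fun c _ => tail c))).
rewrite sumEFin lee_fin -mulr_suml -mulr_sumr.
have -> : \sum_c \sum_(i <- index_enum ('I_K * 'I_m)%type)
      D i.1 c i.2 ^+ 2 * (t i.1.+1 - t i.1) =
    \sum_(p < K) (t p.+1 - t p) * frob2 (D p).
  rewrite exchange_big/=.
  rewrite -(pair_bigA _ (fun p c' => \sum_c D p c c' ^+ 2 * (t p.+1 - t p)))/=.
  apply: eq_bigr => p _; rewrite exchange_big/= /frob2 mulr_sumr.
  apply: eq_bigr => c _; rewrite mulr_sumr; apply: eq_bigr => c' _.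
  by rewrite mulrC.
rewrite le_eqVlt; apply/orP; left; apply/eqP.
by field; rewrite !gt_eqF.
Qed.

End IncrementTail.

Lemma tau_ends (R : realType) (pts : seq R) : 0 \in pts -> 1 \in pts ->
  (forall u, u \in pts -> 0 <= u <= 1) ->
  tau pts 0 = 0 /\ tau pts (ncells pts) = 1.
Proof.
move=> p0 p1 p01.
have mem p : (p <= ncells pts)%N -> tau pts p \in pts.
  move=> pK; rewrite -mem_undup -(mem_sort <=%R) /tau -/(grid pts) mem_nth//.
  have : 0 \in grid pts by rewrite mem_sort mem_undup.
  by move: pK; rewrite /ncells; case: (grid pts).
have le p q : (p <= q)%N -> (q <= ncells pts)%N -> tau pts p <= tau pts q.
  move=> pq qK; rewrite leNgt tau_ltE//; last exact: leq_trans qK.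
  by rewrite -leqNgt.
have [a aK a0] := mem_ptsP p0; have [b bK b1] := mem_ptsP p1.
split; apply/eqP; rewrite eq_le; apply/andP; split.
- by rewrite -[leRHS]a0 le.
- by have /andP[] := p01 _ (mem 0%N (leq0n _)).
- by have /andP[] := p01 _ (mem _ (leqnn _)).
- by rewrite -[leLHS]b1 le.
Qed.

Section StepVariance.
Context (R : realType) (d m : nat) (sigma : R -> 'M[R]_(d, m)).
Hypothesis msigma : forall i j, measurable_fun (`[0, 1] : set (measurableTypeR R))
  (fun t => sigma t i j).
Variable (pts : seq R).
Local Notation mu := (@lebesgue_measure R).
Local Notation t := (tau pts).
Local Notation K := (ncells pts).
Hypothesis t0 : t 0 = 0.
Hypothesis tK : t K = 1.

Let merr (l : step_seq R d m) (D : set (measurableTypeR R)) : measurable D -> (D `<=` (`[0%R, 1%R] : set R)) ->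
  measurable_fun D (fun s : measurableTypeR R => (frob2 (step_fun l s - sigma s))%:E).
Proof.
move=> mD D01; apply/measurable_EFinP; apply: measurable_frob2 => i j.
under eq_fun do rewrite !mxE.
apply: measurable_funB.
  by apply: measurable_funTS; exact: mx_measurable_step_fun.
exact: measurable_funS (msigma i j).
Qed.

(** On [0, u] both step functions are e-close to [sigma], hence 4e-close to each other; after u both
    the second one and the cut first one vanish. This allows the approximation belonging to time u
    to be replaced by one common step function cut at u. *)
Lemma step_variance_le (l l' : step_seq R d m) u e :
  ends_in pts l -> ends_in pts l' -> u \in pts -> 0 <= u <= 1 -> step_within 0 u l' ->
  (\int[mu]_(s in `[0%R, u]) (frob2 (step_fun l' s - sigma s))%:E <= e%:E)%E ->
  (\int[mu]_(s in `[0%R, 1%R]) (frob2 (step_fun l s - sigma s))%:E <= e%:E)%E ->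
  \sum_(p < K) (t p.+1 - t p) *
    frob2 (step_fun l' (t p.+1) - (t p.+1 <= u)%R%:R *: step_fun l (t p.+1)) <= 4 * e.
Proof.
move=> lp lp' upts /andP[u0 u1] wl' h1 h2.
pose f s := frob2 (step_fun l' s - (s <= u)%R%:R *: step_fun l s).
have mle : measurable_fun setT (fun s : R => (s <= u)%R%:R : R).
  rewrite (_ : (fun s => _) = \1_`]-oo, u]); first exact: measurable_indic.
  by apply/funext => s; rewrite indicE mem_setE in_itv.
have mf : measurable_fun setT f.
  apply: measurable_frob2; apply: mx_measurableB; first exact: mx_measurable_step_fun.
  by apply: mx_measurableZ => //; exact: mx_measurable_step_fun.
have fc p s : (p < K)%N -> t p < s <= t p.+1 -> f s = f (t p.+1).
  move=> pK sp; rewrite /f (step_fun_cell lp' pK sp) (step_fun_cell lp pK sp).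
  by rewrite (tau_cell_le upts pK sp).
have f0 s : 0 <= f s by exact: frob2_ge0.
rewrite -lee_fin -(integral_cells mf f0 fc) t0 tK.
have -> : `]0, 1]%classic = `]0, u] `|` `]u, 1].
  by rewrite -itv_bndbnd_setU// bnd_simp.
rewrite ge0_integral_setU//=; last 3 first.
- by apply: measurable_funTS; apply/measurable_EFinP.
- by move=> x _; rewrite lee_fin.
- apply/disj_set2P; rewrite -subset0 => x [] /=; rewrite !in_itv/= => /andP[_ xk] /andP[kx _].
  by move: (le_lt_trans xk kx); rewrite ltxx.
rewrite [X in (_ + X)%E]integral0_eq ?adde0; last first.
  move=> s /=; rewrite in_itv/= => /andP[us _].
  rewrite /f (step_fun_out wl' us) leNgt us scale0r subr0.
  by rewrite /frob2 big1// => i _; rewrite big1// => j _; rewrite mxE expr0n.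
have s01 : `]0, u] `<=` `[0, 1].
  by move=> s /=; rewrite !in_itv/= => /andP[/ltW -> su]; rewrite (le_trans su).
apply: (@le_trans _ _ (\int[mu]_(s in `]0%R, u]) (2%:E * (frob2 (step_fun l' s - sigma s))%:E
    + 2%:E * (frob2 (step_fun l s - sigma s))%:E))%E).
  apply: ge0_le_integral => //.
  - by move=> s _; rewrite lee_fin.
  - by apply: measurable_funTS; apply/measurable_EFinP.
  - apply: emeasurable_funD; apply: emeasurable_funM => //; exact: merr.
  - move=> s /=; rewrite in_itv/= => /andP[_ su].
    rewrite -!EFinM -EFinD lee_fin /f su scale1r.
    have -> : step_fun l' s - step_fun l s =
        (step_fun l' s - sigma s) + - (step_fun l s - sigma s).
      by rewrite opprB addrA subrK.
    by apply: (le_trans (frob2D_le _ _)); rewrite frob2N.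
rewrite ge0_integralD//; last 4 first.
- by move=> s _; rewrite -EFinM lee_fin mulr_ge0// frob2_ge0.
- apply: emeasurable_funM => //; exact: merr.
- by move=> s _; rewrite -EFinM lee_fin mulr_ge0// frob2_ge0.
- apply: emeasurable_funM => //; exact: merr.
rewrite !ge0_integralZl//; try (by move=> s _; rewrite lee_fin frob2_ge0); try exact: merr.
have -> : 4 * e = 2 * e + 2 * e by ring.
rewrite (EFinD (2 * e)); apply: leeD; rewrite EFinM lee_pmul2l// ?lte_fin//.
- apply: le_trans h1; apply: ge0_subset_integral => //=.
  + apply: merr => //; move=> s /=; rewrite !in_itv/= => /andP[-> su].
    exact: le_trans u1.
  + by move=> s _; rewrite lee_fin frob2_ge0.
  + by move=> s /=; rewrite !in_itv/= => /andP[/ltW -> ->].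
- apply: le_trans h2; apply: ge0_subset_integral => //=.
  + exact: merr.
  + by move=> s _; rewrite lee_fin frob2_ge0.
Qed.

(** Integrate c / 2 <= |Q l|^2 + |l - sigma|^2 over the window. The right-hand side of the claim is
    the variance of a second difference after the projection [Q]. *)
Lemma step_variance_ge (l : step_seq R d m) u v e c (Q : 'M[R]_d) :
  ends_in pts l -> u \in pts -> v \in pts -> 0 <= u -> u <= v -> v <= 1 -> is_proj Q ->
  (forall s, u < s <= v -> c <= frob2 (Q *m sigma s)) -> 0 <= c ->
  (\int[mu]_(s in `[0%R, 1%R]) (frob2 (step_fun l s - sigma s))%:E <= e%:E)%E ->
  c / 2 * (v - u) - e <=
    \sum_(p < K | u < t p.+1 <= v) (t p.+1 - t p) * frob2 (Q *m step_fun l (t p.+1)).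
Proof.
move=> lp up vp u0 uv v1 pQ cs c0 h.
pose f s := (u < s <= v)%R%:R * frob2 (Q *m step_fun l s).
have muv : measurable_fun setT (fun s : R => (u < s <= v)%R%:R : R).
  rewrite (_ : (fun s => _) = \1_`]u, v]); first exact: measurable_indic.
  by apply/funext => s; rewrite indicE mem_setE in_itv.
have mf : measurable_fun setT f.
  apply: measurable_funM => //; apply: measurable_frob2; apply: mx_measurable_mul.
    exact: mx_measurable_cst.
  exact: mx_measurable_step_fun.
have fc p s : (p < K)%N -> t p < s <= t p.+1 -> f s = f (t p.+1).
  move=> pK sp; rewrite /f (step_fun_cell lp pK sp).
  by rewrite (tau_cell_le vp pK sp) (tau_cellE up pK sp).
have f0 s : 0 <= f s by rewrite mulr_ge0// frob2_ge0.
have -> : \sum_(p < K | u < t p.+1 <= v) (t p.+1 - t p) * frob2 (Q *m step_fun l (t p.+1)) =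
    \sum_(p < K) (t p.+1 - t p) * f (t p.+1).
  rewrite [LHS]big_mkcond/=; apply: eq_bigr => p _; rewrite /f.
  by case: ifP => _; rewrite ?mul1r ?mul0r ?mulr0.
rewrite lerBlDr -lee_fin EFinD -(integral_cells mf f0 fc) t0 tK.
have s01 : `]u, v] `<=` `[0, 1].
  by move=> s /=; rewrite !in_itv/= => /andP[us sv]; rewrite (le_trans u0 (ltW us)) (le_trans sv).
have s01' : `]u, v] `<=` `]0, 1].
  by move=> s /=; rewrite !in_itv/= => /andP[us sv]; rewrite (le_lt_trans u0 us) (le_trans sv).
apply: (@le_trans _ _ (\int[mu]_(s in `]u, v]) ((f s)%:E + (frob2 (step_fun l s - sigma s))%:E))%E).
  have -> : (c / 2 * (v - u))%:E = (\int[mu]_(s in `]u, v]) (c / 2)%:E)%E.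
    rewrite integral_cst//= lebesgue_measure_itv/= lte_fin.
    case: ltP => [|vu]; first by rewrite -EFinB -EFinM.
    by rewrite (_ : v - u = 0) ?mulr0 ?mule0//; lra.
  apply: ge0_le_integral => //.
  - by move=> s _; rewrite lee_fin divr_ge0.
  - apply: emeasurable_funD; last exact: merr.
    by apply: measurable_funTS; apply/measurable_EFinP.
  - move=> s /=; rewrite in_itv/= => suv.
    rewrite -EFinD lee_fin /f suv mul1r.
    have := cs s suv.
    have -> : Q *m sigma s = Q *m step_fun l s + - (Q *m (step_fun l s - sigma s)).
      by rewrite mulmxBr opprB addrA addrAC subrr add0r.
    have := frob2D_le (Q *m step_fun l s) (- (Q *m (step_fun l s - sigma s))).
    rewrite frob2N; have := frob2_proj_le (step_fun l s - sigma s) pQ; lra.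
rewrite ge0_integralD//; last 4 first.
- by move=> s _; rewrite lee_fin.
- by apply: measurable_funTS; apply/measurable_EFinP.
- by move=> s _; rewrite lee_fin frob2_ge0.
- exact: merr.
apply: leeD.
  apply: ge0_subset_integral => //=.
  - by apply: measurable_funTS; apply/measurable_EFinP.
  - by move=> s _; rewrite lee_fin.
apply: le_trans h; apply: ge0_subset_integral => //=.
- exact: merr.
- by move=> s _; rewrite lee_fin frob2_ge0.
Qed.

End StepVariance.

Lemma nsq_enorm (R : realType) d (v : 'cV[R]_d) : enorm v ^+ 2 = nsq v.
Proof. by rewrite /enorm sqr_sqrtr//; exact: nsq_ge0. Qed.

Lemma wiener_approx disp (T : measurableType disp) (R : realType) (P : probability T R)
    d m (W : R -> T -> 'cV[R]_m) (sigma : R -> 'M[R]_(d, m)) a b Y e : 0 < e ->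
  is_wiener_integral P W sigma a b Y ->
  exists l : step_seq R d m, [/\ step_within a b l,
    (\int[lebesgue_measure]_(s in `[a, b]) (frob2 (step_fun l s - sigma s))%:E <= e%:E)%E &
    (\int[P]_w (nsq (step_integral W l w - Y w))%:E <= e%:E)%E].
Proof.
move=> e0 [_ [l [lw c1 c2]]].
have nb : nbhs (0%E : \bar R) [set y | (y < e%:E)%E].
  apply: open_nbhs_nbhs; split; first exact: open_ereal_lt_ereal.
  by rewrite /= lte_fin.
have n1 : \forall k \near \oo, (\int[lebesgue_measure]_(s in `[a, b])
    (frob2 (step_fun (l k) s - sigma s))%:E < e%:E)%E by exact: c1 _ nb.
have n2 : \forall k \near \oo,
    (\int[P]_w (enorm (step_integral W (l k) w - Y w) ^+ 2)%:E < e%:E)%E by exact: c2 _ nb.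
have [k [k1 k2]] := filter_ex (filterI n1 n2).
exists (l k); split => //; first exact: ltW.
by apply/ltW; under eq_integral do rewrite -nsq_enorm.
Qed.

Lemma mulmx_colE (R : realType) d m (A : 'M[R]_(d, m)) (v : 'cV[R]_m) :
  A *m v = \sum_c v c 0 *: col c A.
Proof.
apply/colP => i; rewrite mxE summxE; apply: eq_bigr => c _.
by rewrite !mxE mulrC.
Qed.

Lemma sum_pair (V : nmodType) (I J : finType) (f : I * J -> V) :
  \sum_x f x = \sum_i \sum_j f (i, j).
Proof. by rewrite pair_bigA/=; apply: eq_bigr => -[]. Qed.

(** * Gaussian approximation of the second differences *)

Section Skeleton.
Context disp (T : measurableType disp) (R : realType) (P : probability T R).
Context (F : R -> set (set T)) (m : nat) (W : R -> T -> 'cV[R]_m).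
Hypothesis fF : filtration F.
Hypothesis bW : brownian P F W.
Variables (d : nat) (sigma : R -> 'M[R]_(d, m)) (n : nat) (J : nat -> T -> 'cV[R]_d).
Hypothesis d0 : (0 < d)%N.
Hypothesis n0 : (0 < n)%N.
Hypothesis vsigma : volatility sigma.
Local Notation tt i := (i%:R / n%:R : R).
Hypothesis wJ : forall i, (i <= n)%N -> is_wiener_integral P W sigma 0 (tt i) (J i).
Variables (mu eta : R) (G : finType) (r : nat) (st : G -> 'I_r.+1 -> nat).
Hypothesis mu0 : 0 < mu.
Hypothesis eta0 : 0 < eta.
Hypothesis stn : forall p j, (st p j + 2 <= n)%N.
Hypothesis st_disj : forall p p' j j', (p, j) != (p', j') ->
  (st p j + 2 <= st p' j')%N || (st p' j' + 2 <= st p j)%N.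
Hypothesis sigma_ge : forall Q : 'M[R]_d, is_proj Q -> d%:R - r%:R <= \tr Q ->
  forall p j s, tt (st p j) < s <= tt (st p j + 2)%N -> mu <= frob2 (Q *m sigma s).

Let nR : 0 < n%:R :> R. Proof. by rewrite ltr0n. Qed.

Let tt_le i j : (tt i <= tt j) = (i <= j)%N.
Proof. by rewrite ler_pM2r ?invr_gt0// ler_nat. Qed.

Let tt_lt i j : (tt i < tt j) = (i < j)%N.
Proof. by rewrite ltr_pM2r ?invr_gt0// ltr_nat. Qed.

Let tt01 i : (i <= n)%N -> 0 <= tt i <= 1.
Proof.
by move=> i_n; rewrite divr_ge0//= ler_pdivrMr// mul1r ler_nat.
Qed.

(** The vectors [z] are second differences of integrals of a single step function. Off the rare
    event [Bad] they differ from those of [J] by an error controlled by the free parameter [eta],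
    and they have the independence that the counting argument needs. *)
Lemma gaussian_skeleton : exists (z : G -> 'I_r.+1 -> T -> 'cV[R]_d) (Bad : set T),
  [/\ (forall p j, mx_measurable (z p j)),
      measurable Bad,
      (P Bad <= eta%:E)%E,
      (forall w, ~ Bad w -> forall p j,
        nsq (J (st p j + 2)%N w - J (st p j).+1 w - (J (st p j).+1 w - J (st p j) w) - z p j w)
          <= eta) &
      (P [set w | (\sum_p \1_[set w | forall j, mu / (2 * n%:R) / (16 * d%:R * r.+1%:R ^+ 2) <=
                 loo_dist (fun l => z p l w) j] w < #|G|%:R / 4 :> R)%R]
        <= (16 / #|G|%:R)%:E)%E].
Proof.
have dR : 0 < d%:R :> R by rewrite ltr0n.
(* A second difference of terms with squared norm at most 4 rho has squared norm at most 64 rho, by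
   three uses of [nsqD_le]. The constant [Cn] counts 2 (n+1) bad events of probability at most (12 d
   + 1) e / rho each, where 12 d is 3 d from the tail bound times 4 from [step_variance_le]. The cap
   mu / (2 n) on e preserves half of the variance mu / n. *)
pose rho := eta / 64; have rho0 : 0 < rho by rewrite divr_gt0.
pose Cn : R := 2 * n.+1%:R * (12 * d%:R + 1).
have Cn0 : 0 < Cn by rewrite !mulr_gt0// addr_gt0// mulr_gt0.
pose e := Num.min (mu / (2 * n%:R)) (eta * rho / Cn).
have e0 : 0 < e by rewrite lt_min !divr_gt0// ?mulr_gt0.
have /choice[li liP] : forall i : nat, exists l : step_seq R d m, (i <= n)%N ->
    [/\ step_within 0 (tt i) l,
    (\int[lebesgue_measure]_(s in `[0%R, tt i]) (frob2 (step_fun l s - sigma s))%:E <= e%:E)%E &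
    (\int[P]_w (nsq (step_integral W l w - J i w))%:E <= e%:E)%E].
  move=> i; have [i_n|i_n] := leqP i n; last by exists [::].
  by have [l lP] := wiener_approx e0 (wJ i_n); exists l.
have [msigma _] := vsigma.
(* One partition containing the grid times and the ends of all n+1 approximating step functions. *)
pose pts : seq R := 0 :: [seq tt i | i <- iota 0 n.+1] ++
  flatten [seq flatten [seq [:: e.1.1; e.1.2] | e <- li i] | i <- iota 0 n.+1].
have tt_pts i : (i <= n)%N -> tt i \in pts.
  move=> i_n; rewrite inE mem_cat; apply/orP; right; apply/orP; left.
  by apply/mapP; exists i => //; rewrite mem_iota.
have one_pts : 1 \in pts by rewrite -(divff (lt0r_neq0 nR)) tt_pts.
have li_pts i : (i <= n)%N -> ends_in pts (li i).
  move=> i_n; apply/allP => x xl.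
  have sub y : y \in [:: x.1.1; x.1.2] -> y \in pts.
    move=> yx; rewrite inE mem_cat; apply/orP; right; apply/orP; right.
    apply/flattenP; exists (flatten [seq [:: e.1.1; e.1.2] | e <- li i]).
      by apply/mapP; exists i => //; rewrite mem_iota.
    by apply/flattenP; exists [:: x.1.1; x.1.2] => //; apply/mapP; exists x.
  by rewrite !sub// !inE eqxx ?orbT.
have within1 i : (i <= n)%N -> step_within 0 1 (li i).
  move=> i_n; have [/allP wl _ _] := liP i i_n; apply/allP => x /wl /and3P[-> -> h] /=.
  by have /andP[_] := tt01 i_n; exact: le_trans.
have pts01 u : u \in pts -> 0 <= u <= 1.
  rewrite inE mem_cat => /orP[/eqP ->|/orP[/mapP[k]|]]; first by rewrite lexx ler01.
    by rewrite mem_iota => i_n ->; exact: tt01.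
  move=> /flattenP[s /mapP[k]]; rewrite mem_iota => /= i_n -> /flattenP[s' /mapP[x xl ->]].
  have /allP/(_ x xl)/and3P[h1 h2 h3] := within1 k i_n.
  rewrite !inE => /orP[|] /eqP ->; apply/andP; split => //.
    exact: le_trans h3.
  exact: le_trans h2.
have [t0 tK] := tau_ends (mem_head _ _) one_pts pts01.
set t := tau pts in t0 tK; set K := ncells pts in tK.
have t00 : 0 <= t 0 by rewrite t0.
have tlt p q : (p < q)%N -> (q <= K)%N -> t p < t q by exact: tau_lt.
pose g := dW W t (K := K).
pose l := li n.
have ln := liP n (leqnn n); rewrite -/l divff ?gt_eqF// in ln.
pose A (q : 'I_K) := step_fun l (t q.+1).
pose xi (q : 'I_K) w := W (t q.+1) w - W (t q) w.
(* The same step function [l] is used for all times and only cut at i / n, so differences of [Y]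
   involve exactly the cells in between. *)
pose Y i w := \sum_(q < K) ((t q.+1 <= tt i)%R%:R *: A q) *m xi q w.
pose D i (q : 'I_K) := step_fun (li i) (t q.+1) - (t q.+1 <= tt i)%R%:R *: A q.
have siE i w : (i <= n)%N -> step_integral W (li i) w = \sum_(q < K) step_fun (li i) (t q.+1) *m xi q w.
  by move=> i_n; exact: step_integral_cells (li_pts i i_n) (within1 i i_n).
have DE i w : (i <= n)%N -> step_integral W (li i) w - Y i w = \sum_(q < K) D i q *m xi q w.
  by move=> i_n; rewrite siE// -sumrB; apply: eq_bigr => q _; rewrite mulmxBl.
(* Two sources of error per grid time: the time's own step integral against [J] (Markov), and that
   step integral against [Y] (Gaussian tail). *)
pose B (ib : 'I_n.+1 * bool) := if ib.2
  then [set w | rho <= nsq (step_integral W (li ib.1) w - J ib.1 w)]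
  else [set w | rho <= nsq (\sum_(q < K) D ib.1 q *m xi q w)].
have mxi d' (C : 'I_K -> 'M[R]_(d', m)) : mx_measurable (fun w => \sum_(q < K) C q *m xi q w).
  exact: (mx_measurable_increments fF bW t00 tlt).
have msJ i : (i <= n)%N -> mx_measurable (fun w => step_integral W (li i) w - J i w).
  move=> i_n; apply: mx_measurableB.
    have -> : step_integral W (li i) =
        (fun w => \sum_(q < K) step_fun (li i) (t q.+1) *m xi q w).
      by apply/funext => w; exact: siE.
    exact: mxi.
  move=> c j _ U mU; rewrite ord1 setTI; have [mJ _] := wJ i_n.
  exact: mJ.
have mB ib : measurable (B ib).
  case: ib => i [] /=; rewrite /B/=; apply: measurable_le_set; apply: measurable_nsq.
    by apply: msJ; rewrite -ltnS.
  exact: mxi.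
have PB ib : (P (B ib) <= (((12 * d%:R + 1) * e) / rho)%:E)%E.
  case: ib => -[i i_n] b; have i_n' : (i <= n)%N by rewrite -ltnS.
  have [wi hi1 hi2] := liP i i_n'.
  case: b; rewrite /B/=.
    apply: (le_trans (prob_markov _ _ _ rho0)) => [|w|].
    - by apply: measurable_nsq; exact: msJ.
    - exact: nsq_ge0.
    apply: (@le_trans _ _ ((rho^-1)%:E * e%:E)%E).
      by rewrite lee_pmul2l// lte_fin invr_gt0.
    rewrite -EFinM lee_fin mulrC ler_pM2r ?invr_gt0//.
    rewrite mulrDl mul1r lerDr; apply: mulr_ge0; last exact: ltW.
    by rewrite mulr_ge0// ltW.
  apply: (le_trans (increments_tail fF bW t00 tlt _ rho0 d0)).
  rewrite lee_fin ler_pM2r ?invr_gt0//.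
  have hV := step_variance_le msigma t0 tK (li_pts n (leqnn n)) (li_pts i i_n') (tt_pts i i_n')
    (tt01 i_n') wi hi1 (let: And3 _ h _ := ln in h).
  apply: (@le_trans _ _ (3 * d%:R * (4 * e))).
    by rewrite ler_pM2l ?mulr_gt0.
  by have := e0; nra.
pose Bad := [set w | exists ib, B ib w].
have mBad : measurable Bad.
  rewrite (_ : Bad = \bigcup_(ib in [set: 'I_n.+1 * bool]) B ib); last first.
    by apply/seteqP; split => w /= [ib]; exists ib.
  by apply: fin_bigcup_measurable.
have PBad : (P Bad <= eta%:E)%E.
  apply: (le_trans (prob_union_le P mB)).
  apply: (le_trans (lee_sum _ (fun ib _ => PB ib))).
  rewrite sumEFin lee_fin sumr_const card_prod card_ord card_bool.
  have : e <= eta * rho / Cn by rewrite ge_min lexx orbT.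
  rewrite ler_pdivlMr// => he.
  rewrite -(mulr_natr (_ / rho)) mulrAC ler_pdivrMr// -mulrA mulrC -mulrA.
  apply: le_trans he; rewrite le_eqVlt; apply/orP; left; apply/eqP.
  by rewrite /Cn natrM; ring.
have JY w i : ~ Bad w -> (i <= n)%N -> nsq (J i w - Y i w) <= 4 * rho.
  move=> nB i_n; have i_n' : (i < n.+1)%N by rewrite ltnS.
  have n1 : nsq (step_integral W (li i) w - J i w) < rho.
    by rewrite ltNge; apply/negP => h; apply: nB; exists (Ordinal i_n', true).
  have n2 : nsq (step_integral W (li i) w - Y i w) < rho.
    rewrite ltNge; apply/negP => h; apply: nB; exists (Ordinal i_n', false).
    by rewrite /B/= -DE.
  have -> : J i w - Y i w =
      (step_integral W (li i) w - Y i w) + - (step_integral W (li i) w - J i w).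
    by rewrite opprB [RHS]addrC addrA subrK.
  apply: (le_trans (nsqD_le _ _)); rewrite nsqN; lra.
pose win p j (q : nat) := tt (st p j) < t q.+1 <= tt (st p j + 2)%N.
pose fst_half p j (q : nat) := tt (st p j) < t q.+1 <= tt (st p j).+1.
(* The first half of a window enters the second difference with a minus sign. *)
pose sg (q : 'I_K) : R := if [exists pj : G * 'I_r.+1, fst_half pj.1 pj.2 q] then -1 else 1.
pose a (i : 'I_K * 'I_m) : 'cV[R]_d := sg i.1 *: col i.2 (A i.1).
pose S p j : {set 'I_K * 'I_m} := [set i : 'I_K * 'I_m | win p j i.1]%SET.
have combE p j w : comb g a (S p j) w =
    Y (st p j + 2)%N w - Y (st p j).+1 w - (Y (st p j).+1 w - Y (st p j) w).
  have -> : comb g a (S p j) w =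
      \sum_(q < K) (if win p j q then sg q else 0) *: (A q *m xi q w).
    rewrite /comb big_mkcond/=.
    rewrite sum_pair.
    apply: eq_bigr => q _; rewrite mulmx_colE scaler_sumr; apply: eq_bigr => c _.
    rewrite inE /=; case: ifP => _; last by rewrite scale0r.
    by rewrite /a /g /dW /= !scalerA mulrC.
  rewrite -!sumrB; apply: eq_bigr => q _; rewrite -!scalemxAl -!scalerBl; congr (_ *: _).
  have lt1 : tt (st p j) < tt (st p j).+1 by rewrite tt_lt.
  have lt2 : tt (st p j).+1 < tt (st p j + 2)%N by rewrite tt_lt addn2.
  rewrite /win; case: (leP (t q.+1) (tt (st p j))) => h0 /=.
    by rewrite (le_trans h0 (ltW lt1)) (le_trans h0 (ltW (lt_trans lt1 lt2))) !subrr.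
  case: (leP (t q.+1) (tt (st p j).+1)) => h1 /=.
    rewrite (le_trans h1 (ltW lt2)) subrr sub0r subr0.
    rewrite /sg ifT//; apply/existsP; exists (p, j).
    by rewrite /fst_half/= h0 h1.
  case: leP => h2 //=; last by rewrite !subr0.
  (* A cell in the second half of this window must not be negated on account of another window;
     disjointness of the windows excludes it. *)
  rewrite !subr0 /sg ifF//; apply/negbTE/existsPn => -[p' j'] /=.
  apply/negP => /andP[h3 h4].
  have pj : (p, j) != (p', j').
    apply/eqP => -[pp jj]; move: h4; rewrite -pp -jj.
    by rewrite leNgt h1.
  have := st_disj pj => /orP[] hst.
  - have : tt (st p j + 2)%N <= tt (st p' j') by rewrite tt_le.
    by move=> h5; move: (lt_le_trans h3 h2); rewrite ltNge h5.
  - have : tt (st p' j').+1 <= tt (st p j) by rewrite tt_le (leq_trans _ hst)// addn2.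
    by move=> h5; move: (le_lt_trans (le_trans h4 h5) h0); rewrite ltxx.
exists (fun p j => comb g a (S p j)), Bad; split => //.
- by move=> p j; apply: mx_measurable_comb; exact: (measurable_dW fF bW t00 tlt).
- move=> w nB p j; rewrite combE.
  have e0' := JY w (st p j) nB (leq_trans (leq_addr 2 _) (stn p j)).
  have e1' : nsq (J (st p j).+1 w - Y (st p j).+1 w) <= 4 * rho.
    by apply: JY => //; apply: leq_trans (stn p j); rewrite addn2.
  have e2' := JY w (st p j + 2)%N nB (stn p j).
  move: (J (st p j) w) (J (st p j).+1 w) (J (st p j + 2)%N w) (Y (st p j) w)
    (Y (st p j).+1 w) (Y (st p j + 2)%N w) e0' e1' e2' => J0 J1 J2 Y0 Y1 Y2 h0 h1 h2.
  have -> : J2 - J1 - (J1 - J0) - (Y2 - Y1 - (Y1 - Y0)) =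
      ((J2 - Y2) + - (J1 - Y1)) + - ((J1 - Y1) + - (J0 - Y0)).
    by apply/colP => i; rewrite !mxE; ring.
  apply: (le_trans (nsqD_le _ _)); rewrite nsqN.
  have := nsqD_le (J2 - Y2) (- (J1 - Y1)); have := nsqD_le (J1 - Y1) (- (J0 - Y0)).
  rewrite !nsqN; have -> : eta = 64 * rho by rewrite /rho; field.
  lra.
apply: (prob_few_good (measurable_dW fF bW t00 tlt) (mut_indep_dW fF bW t00 tlt)
    (sd_dW_gt0 tlt) (law_dW bW t00 tlt)) => //.
- by rewrite divr_gt0// mulr_gt0.
- move=> p p' j j' i pj; rewrite !inE /win => /andP[h1 h2]; apply/negP => /andP[h3 h4].
  have := st_disj pj => /orP[] hst.
  + have : tt (st p j + 2)%N <= tt (st p' j') by rewrite tt_le.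
    by move=> h5; move: (lt_le_trans h3 h2); rewrite ltNge h5.
  + have : tt (st p' j' + 2)%N <= tt (st p j) by rewrite tt_le.
    by move=> h5; move: (lt_le_trans h1 h4); rewrite ltNge h5.
- move=> Q pQ trQ p j.
  have -> : \sum_(i in S p j) Num.sqrt (t i.1.+1 - t i.1) ^+ 2 * nsq (Q *m a i) =
      \sum_(q < K | win p j q) (t q.+1 - t q) * frob2 (Q *m A q).
    rewrite [LHS]big_mkcond [RHS]big_mkcond/= sum_pair; apply: eq_bigr => q _.
    under eq_bigr do rewrite inE/=.
    case: ifP => _; last by rewrite big1.
    rewrite frob2_cols mulr_sumr; apply: eq_bigr => c _.
    rewrite sqr_sqrtr; last by rewrite subr_ge0 ltW// tlt.
    rewrite /a/= -scalemxAr nsqZ.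
    have -> : sg q ^+ 2 = 1 by rewrite /sg; case: ifP; rewrite ?sqrrN expr1n.
    by rewrite mul1r !colE mulmxA.
  have u1 : 0 <= tt (st p j) by rewrite divr_ge0.
  have u2 : tt (st p j) <= tt (st p j + 2)%N by rewrite tt_le leq_addr.
  have u3 : tt (st p j + 2)%N <= 1 by have /andP[] := tt01 (stn p j).
  have ge := step_variance_ge msigma t0 tK (li_pts n (leqnn n))
    (tt_pts _ (leq_trans (leq_addr 2 _) (stn p j))) (tt_pts _ (stn p j)) u1 u2 u3 pQ
    (sigma_ge pQ trQ (p := p) (j := j)) (ltW mu0) (let: And3 _ h _ := ln in h).
  apply: le_trans ge.
  have : e <= mu / (2 * n%:R) by rewrite ge_min lexx.
  have -> : tt (st p j + 2)%N - tt (st p j) = 2 / n%:R by rewrite natrD; field; rewrite gt_eqF.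
  have -> : mu / 2 * (2 / n%:R) = mu / n%:R by field; rewrite gt_eqF.
  have -> : mu / n%:R = 2 * (mu / (2 * n%:R)) by field; rewrite gt_eqF.
  lra.
Qed.

End Skeleton.

(** * The drift *)

Section SecondDifference.
Variables (R : realType) (f : R -> R) (t0 t1 t2 y : R).
Hypotheses (t00 : 0 <= t0) (t01 : t0 < t1) (t12 : t1 < t2) (t21 : t2 <= 1).
Hypothesis tt : t1 - t0 = t2 - t1.
Let mu := @lebesgue_measure R.
Hypothesis fi : mu.-integrable `[0, 1] (EFin \o f).
Let I t := \int[mu]_(s in `[0, t]) f s.

Let sub (a b : R) (D : set (measurableTypeR R)) : 0 <= a -> b <= 1 ->
  (D `<=` (`[a, b] : set R)) -> measurable D -> mu.-integrable D (EFin \o f).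
Proof.
move=> a0 b1 Dab mD; apply: (integrableS _ _ _ fi) => // s /Dab.
by rewrite /= !in_itv/= => /andP[sa sb]; rewrite (le_trans a0 sa) (le_trans sb).
Qed.

Let cst_int (a b : R) : mu.-integrable `]a, b] (EFin \o cst y).
Proof.
apply/integrableP; split; first exact/measurable_EFinP.
rewrite /= integral_cst//= lebesgue_measure_itv/=.
by case: ifP => _; rewrite -?EFinB -EFinM ltry.
Qed.

Let centered a b : 0 <= a -> a < b -> b <= 1 ->
  I b - I a = \int[mu]_(s in `]a, b]) (f s - y) + y * (b - a).
Proof.
move=> a0 ab b1.
have -> : I b - I a = \int[mu]_(s in `]a, b]) f s.
  rewrite /I Rintegral_itvB//.
  - by apply: (sub (a := 0) (b := b)).
  - by rewrite bnd_simp ltW.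
have fab : mu.-integrable `]a, b] (EFin \o f).
  by apply: (sub (a := a) (b := b)) => // s /=; rewrite !in_itv/= => /andP[/ltW -> ->].
rewrite RintegralB// Rintegral_cst//= lebesgue_measure_itv/= lte_fin ab -EFinB/=.
by rewrite subrK.
Qed.

(** The two halves have equal length, so subtracting the constant y from f leaves the second
    difference unchanged. The rest is Cauchy-Schwarz, in a form that also covers an infinite
    right-hand side. *)
Lemma second_difference_le :
  (((I t2 - I t1 - (I t1 - I t0)) ^+ 2)%:E <=
   (t2 - t0)%:E * \int[mu]_(s in `[t0, t2]) ((f s - y) ^+ 2)%:E)%E.
Proof.
have t10 : 0 <= t1 by rewrite (le_trans t00)// ltW.
have t11 : t1 <= 1 by rewrite (le_trans _ t21)// ltW.
rewrite !centered// tt opprD addrACA subrr addr0.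
set X := _ - _.
have mf (D : set (measurableTypeR R)) : (D `<=` (`[0%R, 1%R] : set R)) -> measurable D ->
    measurable_fun D f.
  move=> D01 mD; have /integrableP[/measurable_EFinP mf _] := fi.
  exact: measurable_funS mf.
pose l := t2 - t0; have l0 : 0 < l by rewrite subr_gt0 (lt_trans t01).
set Q := (\int[mu]_(s in _) _)%E.
have Q0 : (0 <= Q)%E by apply: integral_ge0 => s _; rewrite lee_fin sqr_ge0.
have s01 : (`[t0, t2] : set R) `<=` `[0, 1].
  by move=> s /=; rewrite !in_itv/= => /andP[h1 h2]; rewrite (le_trans t00 h1) (le_trans h2).
have o01 a b : t0 <= a -> b <= t2 -> (`]a, b] : set R) `<=` `[t0, t2].
  move=> h1 h2 s /=; rewrite !in_itv/= => /andP[h3 h4].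
  by rewrite (le_trans h1 (ltW h3)) (le_trans h4 h2).
have mabs (D : set (measurableTypeR R)) : (D `<=` (`[t0, t2] : set R)) -> measurable D ->
    measurable_fun D (fun s => `|f s - y|%:E).
  move=> Ds mD; apply/measurable_EFinP; apply: measurableT_comp => //.
  by apply: measurable_funB => //; apply: mf => //; exact: subset_trans s01.
have absint a b : t0 <= a -> a < b -> b <= t2 ->
    (`|\int[mu]_(s in `]a, b]) (f s - y)|%:E <= \int[mu]_(s in `]a, b]) `|f s - y|%:E)%E.
  move=> ha ab hb.
  have ia : mu.-integrable `]a, b] (EFin \o (fun s => f s - y)).
    rewrite (_ : EFin \o _ = (EFin \o f) \- (EFin \o cst y))%E//.
    apply: integrableB => //.
    apply: (sub (a := a) (b := b)) => //.
    - exact: le_trans ha.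
    - exact: le_trans hb _.
    - by move=> s /=; rewrite !in_itv/= => /andP[/ltW -> ->].
  rewrite EFin_normr_Rintegral//; apply: le_abse_integral => //.
  by have /integrableP[] := ia.
have XA : (`|X|%:E <= \int[mu]_(s in `[t0, t2]) `|f s - y|%:E)%E.
  apply: (@le_trans _ _ (\int[mu]_(s in `]t0, t2]) `|f s - y|%:E)%E); last first.
    apply: ge0_subset_integral => //.
    - by apply: mabs.
    - by move=> s /=; rewrite !in_itv/= => /andP[/ltW -> ->].
  have -> : `]t0, t2]%classic = `]t0, t1] `|` `]t1, t2].
    by rewrite -itv_bndbnd_setU// bnd_simp// ltW.
  rewrite ge0_integral_setU//=; last 2 first.
  - apply: mabs => //; last exact: measurableU.
    move=> s [] /=; rewrite !in_itv/= => /andP[h1 h2].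
      by rewrite (ltW h1) (le_trans h2 (ltW t12)).
    by rewrite (ltW (lt_trans t01 h1)) h2.
  - apply/disj_set2P; rewrite -subset0 => x [] /=; rewrite !in_itv/= => /andP[_ xk] /andP[kx _].
    by move: (le_lt_trans xk kx); rewrite ltxx.
  apply: (@le_trans _ _ (`|\int[mu]_(s in `]t0, t1]) (f s - y)|%:E +
      `|\int[mu]_(s in `]t1, t2]) (f s - y)|%:E)%E).
    by rewrite -EFinD lee_fin [leRHS]addrC; exact: ler_normB.
  by apply: leeD; apply: absint => //; exact: ltW.
(* Cauchy-Schwarz through u <= a / 2 + u^2 / (2 a), used below with a = |X| / l. *)
have XQ a : 0 < a -> (`|X|%:E <= (a / 2 * l)%:E + ((2 * a)^-1)%:E * Q)%E.
  move=> a0; apply: (le_trans XA).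
  apply: (@le_trans _ _ (\int[mu]_(s in `[t0, t2])
      ((a / 2)%:E + ((2 * a)^-1)%:E * ((f s - y) ^+ 2)%:E))%E).
    apply: ge0_le_integral => //.
    - exact: mabs.
    - apply: emeasurable_funD => //; apply: emeasurable_funM => //.
      apply/measurable_EFinP; apply: measurable_funX; apply: measurable_funB => //.
      exact: mf.
    - move=> s _; rewrite -EFinM -EFinD lee_fin -(real_normK (num_real (f s - y))).
      move: (`|f s - y|) => u.
      have -> : a / 2 + (2 * a)^-1 * u ^+ 2 = u + (2 * a)^-1 * (u - a) ^+ 2.
        by field; rewrite gt_eqF.
      by rewrite lerDl mulr_ge0 ?sqr_ge0// invr_ge0 mulr_ge0// ltW.
  rewrite ge0_integralD//; last 3 first.
  - by move=> s _; rewrite lee_fin divr_ge0// ltW.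
  - by move=> s _; rewrite -EFinM lee_fin mulr_ge0 ?sqr_ge0// invr_ge0 mulr_ge0// ltW.
  - apply: emeasurable_funM => //.
    apply/measurable_EFinP; apply: measurable_funX; apply: measurable_funB => //.
    exact: mf.
  rewrite ge0_integralZl//; last 3 first.
  - apply/measurable_EFinP; apply: measurable_funX; apply: measurable_funB => //.
    exact: mf.
  - by move=> s _; rewrite lee_fin sqr_ge0.
  - by rewrite lee_fin invr_ge0 mulr_ge0// ltW.
  rewrite integral_cst//= lebesgue_measure_itv/= lte_fin (lt_trans t01 t12).
  by rewrite -EFinB -EFinM.
have [->|X0] := eqVneq X 0; first by rewrite expr0n mule_ge0// lee_fin ltW.
have {X0}X0 : 0 < `|X| by rewrite normr_gt0.
have := XQ (`|X| / l) (divr_gt0 X0 l0).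
case: Q Q0 {XQ} => [q| |] //= q0.
  rewrite -!EFinM -EFinD !lee_fin -(real_normK (num_real X)) -/l.
  move: (`|X|) X0 => u u0.
  have -> : u / l / 2 * l + (2 * (u / l))^-1 * q = u / 2 + l * q / (2 * u).
    by field; rewrite !gt_eqF.
  rewrite -lerBlDl => h.
  have : (u / 2) * (2 * u) <= l * q by rewrite -ler_pdivlMr ?mulr_gt0//; lra.
  by nra.
by move=> _; rewrite [X in (_ <= X)%E]gt0_muley ?lte_fin ?leey.
Qed.

End SecondDifference.

Lemma measurable_enorm disp (T : measurableType disp) (R : realType) d (D : set T)
    (f : T -> 'cV[R]_d) : (forall i, measurable_fun D (fun w => f w i 0)) ->
  measurable_fun D (fun w => enorm (f w)).
Proof.
move=> mf; have msqrt : measurable_fun [set: R] (@Num.sqrt R).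
  by apply: continuous_measurable_fun; exact: sqrt_continuous.
apply: (measurableT_comp msqrt).
by apply: measurable_sum => i; apply: measurable_funX; exact: mf.
Qed.

Section Drift.
Context disp (T : measurableType disp) (R : realType) (P : probability T R).
Context (F : R -> set (set T)) (d : nat) (b : R -> T -> 'cV[R]_d) (beta L : R).
Hypothesis fF : filtration F.
Hypothesis beta0 : 0 < beta.
Hypothesis L0 : 0 <= L.
Hypothesis hb : holder_drift P F beta L b.
Local Notation mu := (@lebesgue_measure R).
Local Notation TT := (measurableTypeR R * T)%type.
Local Notation I01 := (`[0%R, 1%R]%classic : set (measurableTypeR R)).

Let mb c : measurable_fun (I01 `*` [set: T]) (fun x : TT => b x.1 x.2 c 0).
Proof. by have [[_ mb _] _] := hb. Qed.

Let mb_at u : 0 <= u <= 1 -> mx_measurable (b u).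
Proof.
move=> u01 i j _ B mB; rewrite ord1 setTI.
have [[adb _ _] _] := hb; have /andP[u0 _] := u01.
apply: (fF.1 u u0).2; exact: adb.
Qed.

Let section_measurable w c : measurable_fun I01 (fun s => b s w c 0).
Proof.
move=> mI B mB.
have mX : measurable (I01 `*` [set: T]) by apply: measurableX.
have := measurable_ysection w (mb c mX mB).
congr measurable; apply/seteqP; split => s /=.
  by rewrite /ysection/= inE => -[[h _] h2].
by rewrite /ysection/= inE => -[h h2]; split.
Qed.

(** Since |s - u|^beta <= 1, the fourth moment is at most L^4; the pointwise x <= 1 + x^2 then
    bounds the second moment without Hoelder's inequality. *)
Let Lp4 s u : 0 <= u -> u <= s -> s <= 1 ->
  (\int[P]_w (nsq (b s w - b u w))%:E <= (1 + L ^+ 4)%:E)%E.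
Proof.
move=> u0 us s1; have [_ /(_ s u u0 us s1) h] := hb.
have u01 : 0 <= u <= 1 by rewrite u0 (le_trans us).
have s01 : 0 <= s <= 1 by rewrite s1 (le_trans u0).
have mdiff : measurable_fun setT (fun w => nsq (b s w - b u w)).
  by apply: measurable_nsq; apply: mx_measurableB; exact: mb_at.
have n4 w : enorm (b s w - b u w) ^+ 4 = nsq (b s w - b u w) ^+ 2.
  by rewrite (exprM _ 2 2) nsq_enorm.
have m4 : measurable_fun setT (fun w => (enorm (b s w - b u w) ^+ 4)%:E).
  by apply/measurable_EFinP; under eq_fun do rewrite n4; exact: measurable_funX.
set A := (\int[P]_w _)%E in h.
have A0 : (0 <= A)%E by apply: integral_ge0 => w _; rewrite lee_fin n4 sqr_ge0.
have AL : (A <= (L ^+ 4)%:E)%E.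
  have hL : (A `^ (4^-1) <= L%:E)%E.
    apply: (le_trans h); rewrite lee_fin ler_piMr//.
    have su1 : `|s - u| <= 1 by rewrite ger0_norm ?subr_ge0// lerBlDr (le_trans s1)// lerDl.
    have := @ge0_ler_powR R beta (ltW beta0) `|s - u| 1.
    by rewrite powR1; apply => //; rewrite ?nnegrE.
  clear h; case: A A0 hL => [a| |] //= a0; last by rewrite gt_eqF.
  rewrite !lee_fin in a0 * => hL.
  rewrite -[leLHS](powRr1 a0) -(mulVf (_ : 4 != 0 :> R))//.
  by rewrite powRrM powR_mulrn ?powR_ge0// lerXn2r ?nnegrE ?powR_ge0.
apply: (@le_trans _ _ (\int[P]_w (1%:E + (enorm (b s w - b u w) ^+ 4)%:E))%E).
  apply: ge0_le_integral => //.
  - by move=> w _; rewrite lee_fin nsq_ge0.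
  - exact/measurable_EFinP.
  - exact: emeasurable_funD.
  - move=> w _; rewrite -EFinD lee_fin n4; have := sqr_ge0 (nsq (b s w - b u w) - 1).
    have := nsq_ge0 (b s w - b u w); nra.
rewrite ge0_integralD//; last by move=> w _; rewrite lee_fin n4 sqr_ge0.
rewrite integral_cst// [X in (_ * X)%E]probability_setT mule1 EFinD.
by apply: leeD.
Qed.

(** By Tonelli the path integral of |b| is a measurable function of the outcome; its expectation is
    finite, so it is finite almost surely, and it dominates every coordinate. *)
Lemma ae_drift_integrable :
  {ae P, forall w, forall c, mu.-integrable `[0, 1] (EFin \o (fun s => b s w c 0))}.
Proof.
have [[_ _ fin] _] := hb.
pose G0 (x : TT) : \bar R := (enorm (b x.1 x.2))%:E.
have mX : measurable (I01 `*` [set: T]) by apply: measurableX.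
have mG0 : measurable_fun (I01 `*` [set: T]) G0.
  by apply/measurable_EFinP; apply: measurable_enorm => c; exact: mb.
have mGr : measurable_fun setT (G0 \_ (I01 `*` [set: T])) by apply/(measurable_restrictT _ mX).
have Gr0 x : (0 <= (G0 \_ (I01 `*` [set: T])) x)%E.
  by rewrite patchE; case: ifP => // _; rewrite lee_fin sqrtr_ge0.
pose g w := (\int[mu]_s (G0 \_ (I01 `*` [set: T])) (s, w))%E.
have mg : measurable_fun setT g by exact: (measurable_fun_fubini_tonelli_G (m1 := mu) _ mGr Gr0).
have gE w : g w = (\int[mu]_(s in `[0%R, 1%R]) (enorm (b s w))%:E)%E.
  rewrite /g [RHS]integral_mkcond/=; apply: eq_integral => s _.
  by rewrite !patchE; congr (if _ then _ else _); apply/idP/idP; rewrite !inE; [case|split].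
have g0 w : (0 <= g w)%E by exact: integral_ge0.
have gint : P.-integrable setT g.
  apply/integrableP; split => //.
  under eq_integral do rewrite gee0_abs// gE.
  exact: fin.
have := integrable_ae measurableT gint; apply: filterS => w /(_ I) gfin c.
apply/integrableP; split; first by apply/measurable_EFinP; exact: section_measurable.
apply: (@le_lt_trans _ _ (g w)); last by rewrite ltey_eq gfin.
rewrite gE; apply: ge0_le_integral => //.
- apply: measurableT_comp => //; apply/measurable_EFinP; exact: section_measurable.
- by apply/measurable_EFinP; apply: measurable_enorm => c'; exact: section_measurable.
- move=> s _; rewrite /= lee_fin -sqrtr_sqr /enorm ler_wsqrtr// (bigD1 c)//= lerDl.
  by apply: sumr_ge0 => c' _; exact: sqr_ge0.
Qed.

Variables (t0 t1 t2 : R).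
Hypotheses (t00 : 0 <= t0) (t01 : t0 < t1) (t12 : t1 < t2) (t21 : t2 <= 1).
Hypothesis tt : t1 - t0 = t2 - t1.

(** The right-hand side of [second_difference_le] with y = b(t0), summed over coordinates. It is
    extended-real because single paths of b need not be square integrable. *)
Definition drift_var w : \bar R :=
  ((t2 - t0)%:E * \int[mu]_(s in `[t0, t2]) (nsq (b s w - b t0 w))%:E)%E.

Local Notation J02 := (`[t0, t2]%classic : set (measurableTypeR R)).

Let J02I : J02 `<=` I01.
Proof.
by move=> s /=; rewrite !in_itv/= => /andP[h1 h2]; rewrite (le_trans t00 h1) (le_trans h2).
Qed.

Let t0le : 0 <= t0 <= 1.
Proof. by rewrite t00 (le_trans (ltW t01))// (le_trans (ltW t12)). Qed.

Let H (x : TT) : \bar R := (nsq (b x.1 x.2 - b t0 x.2))%:E.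

Let mH : measurable_fun (J02 `*` [set: T]) H.
Proof.
apply/measurable_EFinP; apply: measurable_sum => c; apply: measurable_funX.
rewrite (_ : (fun x => _) = (fun x : TT => b x.1 x.2 c 0 - b t0 x.2 c 0)); last first.
  by apply/funext => x; rewrite !mxE.
apply: measurable_funB.
  apply: measurable_funS (mb c); first exact: measurableX.
  by move=> x [h1 h2]; split => //; exact: J02I.
apply: measurable_funTS; apply: (measurableT_comp (mb_at t0le c 0)); exact: measurable_snd.
Qed.

Let Hr := H \_ (J02 `*` [set: T]).

Let mHr : measurable_fun setT Hr.
Proof.
have mX : measurable (J02 `*` [set: T]) by apply: measurableX.
by apply/(measurable_restrictT _ mX).
Qed.

Let Hr0 x : (0 <= Hr x)%E.
Proof. by rewrite /Hr patchE; case: ifP => // _; rewrite lee_fin nsq_ge0. Qed.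

Let HrE w : (\int[mu]_(s in `[t0, t2]) (nsq (b s w - b t0 w))%:E = \int[mu]_s Hr (s, w))%E.
Proof.
rewrite [LHS]integral_mkcond/=; apply: eq_integral => s _.
by rewrite /Hr !patchE; congr (if _ then _ else _); apply/idP/idP; rewrite !inE; [split|case].
Qed.

Lemma measurable_drift_var : measurable_fun setT drift_var.
Proof.
apply: emeasurable_funM => //; under eq_fun do rewrite HrE.
exact: (measurable_fun_fubini_tonelli_G (m1 := mu) _ mHr Hr0).
Qed.

Lemma drift_var_ge0 w : (0 <= drift_var w)%E.
Proof.
apply: mule_ge0; first by rewrite lee_fin subr_ge0 ltW// (lt_trans t01).
by apply: integral_ge0 => s _; rewrite lee_fin nsq_ge0.
Qed.

Lemma integral_drift_var :
  (\int[P]_w drift_var w <= ((t2 - t0) ^+ 2 * (1 + L ^+ 4))%:E)%E.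
Proof.
have l0 : 0 <= t2 - t0 by rewrite subr_ge0 ltW// (lt_trans t01).
rewrite ge0_integralZl//; last 2 first.
- under eq_fun do rewrite HrE.
  exact: (measurable_fun_fubini_tonelli_G (m1 := mu) _ mHr Hr0).
- by move=> w _; apply: integral_ge0 => s _; rewrite lee_fin nsq_ge0.
under eq_integral do rewrite HrE.
rewrite -(fubini_tonelli (m1 := mu) (m2 := P) _ mHr Hr0).
rewrite expr2 -mulrA [in leRHS]EFinM; apply: lee_wpmul2l; first by rewrite lee_fin.
apply: (@le_trans _ _ (\int[mu]_(s in `[t0, t2]) (1 + L ^+ 4)%:E)%E); last first.
  rewrite integral_cst//= lebesgue_measure_itv/= lte_fin (lt_trans t01)// -EFinB -EFinM.
  by rewrite mulrC.
rewrite [leRHS]integral_mkcond/=; apply: ge0_le_integral => //.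
- by move=> s _; apply: integral_ge0 => w _.
- exact: (measurable_fun_fubini_tonelli_F (m2 := P) _ mHr Hr0).
- by apply/(measurable_restrictT _ (measurable_itv _)).
move=> s _; rewrite patchE; case: ifPn => [|].
  rewrite inE/= in_itv/= => /andP[h1 h2].
  apply: le_trans (Lp4 t00 h1 (le_trans h2 t21)).
  rewrite le_eqVlt; apply/orP; left; apply/eqP; apply: eq_integral => w _.
  by rewrite /Hr patchE mem_set//; split => //=; rewrite in_itv/= h1.
move=> hs; rewrite integral0_eq// => w _; rewrite /Hr patchE ifF//.
by apply/negbTE; apply: contra hs; rewrite !inE => -[].
Qed.

Lemma drift_second_difference w :
  (forall c, mu.-integrable `[0, 1] (EFin \o (fun s => b s w c 0))) ->
  let I t := \col_c (\int[mu]_(s in `[0, t]) b s w c 0) in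
  ((nsq (I t2 - I t1 - (I t1 - I t0)))%:E <= drift_var w)%E.
Proof.
move=> bi; set I := fun t => _.
have h c := second_difference_le (b t0 w c 0) t00 t01 t12 t21 tt (bi c).
rewrite /nsq -sumEFin /drift_var.
have -> : (\int[mu]_(s in `[t0, t2]) (nsq (b s w - b t0 w))%:E =
    \sum_c \int[mu]_(s in `[t0, t2]) ((b s w c 0 - b t0 w c 0) ^+ 2)%:E)%E.
  rewrite -ge0_integral_sum//; last 2 first.
  - move=> c; apply/measurable_EFinP; apply: measurable_funX; apply: measurable_funB => //.
    exact: measurable_funS (section_measurable w c).
  - by move=> c s _; rewrite lee_fin sqr_ge0.
  apply: eq_integral => s _; rewrite sumEFin; congr EFin.
  by apply: eq_bigr => c _; rewrite !mxE.
rewrite ge0_sume_distrr; last first.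
  by move=> c _; apply: integral_ge0 => s _; rewrite lee_fin sqr_ge0.
by apply: lee_sum => c _; rewrite !mxE; exact: h.
Qed.

End Drift.

(** * The statistic *)

Lemma lambda_block_ge_grouped (R : realType) d r b B (h e : R) (m : 'cV[R]_d)
    (y : nat -> 'cV[R]_d) (z err : 'I_B -> 'I_r.+1 -> 'cV[R]_d) (good : pred 'I_B) :
  (r < d)%N -> 0 < h -> 0 <= e -> ((B * r.+1).*2 <= b)%N ->
  (forall (g : 'I_B) (j : 'I_r.+1), y (g * r.+1 + j).*2.+2 - y (g * r.+1 + j).*2.+1 = z g j + err g j) ->
  (forall g j, good g -> e <= loo_dist (z g) j) ->
  e / r.+1%:R / 4 * (\sum_(g < B) (good g)%:R)
    - 2^-1 * \sum_g \sum_j nsq (err g j)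
  <= d%:R * (h * lambda r.+1 (h^-1 *: \sum_(1 <= i < b.+1) outer (y i - m))).
Proof.
move=> rd h0 e0 Bb yz goodP.
(* Flat positions are decoded by division with remainder by r+1; the value 0 is met only beyond the
   last group. *)
pose flat (f : 'I_B -> 'I_r.+1 -> 'cV[R]_d) (l : nat) : 'cV[R]_d :=
  if insub (l %/ r.+1)%N is Some g then f g (inord (l %% r.+1)) else 0.
have flatE f (g : 'I_B) (j : 'I_r.+1) : flat f (g * r.+1 + j)%N = f g j.
  rewrite /flat divnMDl// divn_small// addn0 modnMDl modn_small// inord_val.
  by rewrite valK.
have := @lambda_block_ge R d r b B h e m y (flat z) (flat err) good rd h0 e0 Bb.
rewrite (sum_regroup (fun l => nsq (flat err l))).
under [X in _ - _ * X]eq_bigr do under eq_bigr do rewrite flatE.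
apply.
- move=> l lB; have lq : (l %/ r.+1 < B)%N by rewrite ltn_divLR.
  have jq : (l %% r.+1 < r.+1)%N by rewrite ltn_mod.
  by have := yz (Ordinal lq) (Ordinal jq); rewrite -!flatE /= -divn_eq.
- move=> g j gg; rewrite flatE; have := goodP g j gg; rewrite /loo_dist.
  by congr (_ <= nsq (proj_compl _ *m _)); apply: eq_map => l; rewrite flatE.
Qed.

Section Statistic.
Variables (R : realType) (d r n bN Kb : nat) (h : R).
Hypothesis rd : (r < d)%N.
Hypothesis h0 : 0 < h.
Hypothesis n0 : (0 < n)%N.
Hypothesis nh : n%:R * h = bN%:R.
Hypothesis hK : h^-1 = Kb%:R.
Local Notation tt i := (i%:R / n%:R : R).

Let nR : 0 < n%:R :> R. Proof. by rewrite ltr0n. Qed.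

Lemma block_time k i : k%:R * h + i%:R / n%:R = tt (k * bN + i)%N.
Proof.
by rewrite natrD natrM -nh mulrDl; congr (_ + _); field; rewrite gt_eqF.
Qed.

Lemma incrementE (x : R -> 'cV[R]_d) i k :
  increment n h x i.+1 k = x (tt (k * bN + i.+1)%N) - x (tt (k * bN + i)%N).
Proof.
rewrite /increment block_time -block_time; congr (x _ - x _).
by rewrite -natr1 addrK block_time.
Qed.

Lemma blocksizeE : blocksize n h = bN.
Proof. by rewrite /blocksize nh natrK. Qed.

Lemma nblocksE : nblocks h = Kb.
Proof. by rewrite /nblocks hK natrK. Qed.

Lemma blocks_cover : (Kb * bN = n)%N.
Proof.
by apply/eqP; rewrite -(eqr_nat R) natrM -nh -hK mulrCA mulVf ?mulr1// gt_eqF.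
Qed.

Lemma Sigma_hatE (x : R -> 'cV[R]_d) k : exists m, Sigma_hat n h x k =
  h^-1 *: \sum_(1 <= i < bN.+1) outer (increment n h x i k - m).
Proof. by rewrite /Sigma_hat blocksizeE; eexists; reflexivity. Qed.

Lemma Sigma_hat_psd (x : R -> 'cV[R]_d) k : psd (Sigma_hat n h x k).
Proof.
have [m ->] := Sigma_hatE x k.
split.
  rewrite [LHS]linearZ/= linear_sum/=; congr (_ *: _); apply: eq_bigr => i _.
  by rewrite /outer trmx_mul trmxK.
move=> v; rewrite -scalemxAr -scalemxAl mxE mulr_ge0 ?invr_ge0 ?(ltW h0)//.
rewrite mulmx_sumr mulmx_suml summxE; apply: sumr_ge0 => i _.
move: (increment _ _ _ _ _ - m) => w.
have -> : v^T *m outer w *m v = (w^T *m v)^T *m (w^T *m v).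
  by rewrite /outer trmx_mul trmxK !mulmxA.
by rewrite mulmx_trl_nsq mxE eqxx mulr1n nsq_ge0.
Qed.

Variables (k0 k1 B : nat).
Hypothesis k1K : (k1 <= Kb)%N.
Hypothesis Bb : ((B * r.+1).*2 <= bN)%N.
Local Notation G := ('I_(k1 - k0) * 'I_B)%type.

(* Group g.2 of block k0 + g.1 consists of r+1 pairs of consecutive increments; the
   j-th pair covers the grid times [start g j], ..., [start g j + 2]. *)
Definition start (g : G) (j : 'I_r.+1) : nat :=
  ((k0 + g.1) * bN + (g.2 * r.+1 + j).*2)%N.

(** The block inequality is summed over the blocks k0 <= k < k1. The other blocks contribute
    nonnegative terms, since [Sigma_hat] is positive semi-definite. *)
Lemma test_stat_ge (x : R -> 'cV[R]_d) (e : R) (z err : G -> 'I_r.+1 -> 'cV[R]_d)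
    (good : pred G) : 0 <= e ->
  (forall g j, x (tt (start g j + 2)%N) - x (tt (start g j).+1)
     - (x (tt (start g j).+1) - x (tt (start g j))) = z g j + err g j) ->
  (forall g j, good g -> e <= loo_dist (z g) j) ->
  e / r.+1%:R / 4 * (\sum_g (good g)%:R) - 2^-1 * \sum_g \sum_j nsq (err g j)
  <= d%:R * test_stat r n h x.
Proof.
move=> e0 xz goodP.
have lam0 k : 0 <= h * lambda r.+1 (Sigma_hat n h x k).
  by rewrite mulr_ge0 ?(ltW h0)// lambda_ge0//; exact: Sigma_hat_psd.
have -> : e / r.+1%:R / 4 * (\sum_g (good g)%:R) - 2^-1 * \sum_g \sum_j nsq (err g j) =
    \sum_(k < k1 - k0) (e / r.+1%:R / 4 * (\sum_(g < B) (good (k, g))%:R)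
      - 2^-1 * \sum_(g < B) \sum_j nsq (err (k, g) j)).
  by rewrite sumrB -!mulr_sumr !sum_pair.
apply: (@le_trans _ _ (\sum_(k < k1 - k0)
    d%:R * (h * lambda r.+1 (Sigma_hat n h x (k0 + k))))).
  apply: ler_sum => k _; have [m ->] := Sigma_hatE x (k0 + k).
  apply: (@lambda_block_ge_grouped _ _ _ bN B h e m (fun i => increment n h x i (k0 + k))
    (fun g => z (k, g)) (fun g => err (k, g)) (fun g => good (k, g))) => //.
  - move=> g j; rewrite -xz /start/= !incrementE -!addnS addn2 -addnS.
    by rewrite -!addnS.
  - by move=> g j; exact: goodP.
rewrite -mulr_sumr ler_wpM2l//.
rewrite /test_stat nblocksE.
pose f k := h * lambda r.+1 (Sigma_hat n h x k).
rewrite -(big_mkord xpredT (fun k => f (k0 + k)%N)).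
have [k01|k10] := leqP k0 k1; last first.
  by rewrite big_geq; [exact: sumr_ge0|rewrite leqn0 subn_eq0 ltnW].
have -> : \sum_(0 <= k < k1 - k0) f (k0 + k)%N = \sum_(k0 <= k < k1) f k.
  by rewrite -[in RHS](add0n k0) big_addn; apply: eq_bigr => k _; rewrite addnC.
rewrite (@big_cat_nat _ _ _ k0 0 Kb)//=; last exact: leq_trans k01 k1K.
rewrite (@big_cat_nat _ _ _ k1 k0 Kb)//=.
have s1 : 0 <= \sum_(0 <= k < k0) f k by apply: sumr_ge0 => k _; exact: lam0.
have s2 : 0 <= \sum_(k1 <= k < Kb) f k by apply: sumr_ge0 => k _; exact: lam0.
rewrite -/(f _); lra.
Qed.

Lemma measurable_test_stat disp (T : measurableType disp) (X : R -> T -> 'cV[R]_d) :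
  (forall i, (i <= n)%N -> mx_measurable (X (tt i))) ->
  measurable_fun setT (fun w => test_stat r n h (X ^~ w)).
Proof.
move=> mX.
(* The guard k < Kb keeps all observation times at most 1; measurability of [X] is assumed only
   there. *)
rewrite (_ : (fun w => _) = (fun w =>
    \sum_(k <- index_iota 0 Kb) (if (k < Kb)%N then h * lambda r.+1 (Sigma_hat n h (X ^~ w) k) else 0))); last first.
  apply/funext => w; rewrite /test_stat nblocksE big_nat [RHS]big_nat.
  by apply: eq_bigr => k /andP[_ ->].
apply: measurable_sum => k; case: ltnP => kK; last exact: measurable_cst.
apply: measurable_funM => //; apply: measurable_lambda => //; last first.
  by move=> w; have [] := Sigma_hat_psd (X ^~ w) k.
have minc i : (0 < i <= bN)%N -> mx_measurable (fun w => increment n h (X ^~ w) i k).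
  case: i => // i ib; rewrite (_ : (fun w => _) = (fun w => X (tt (k * bN + i.+1)%N) w - X (tt (k * bN + i)%N) w)).
    have le : (k * bN + i.+1 <= n)%N.
      rewrite -blocks_cover; apply: (@leq_trans (k.+1 * bN)); last by rewrite leq_mul2r kK orbT.
      by rewrite mulSn addnC leq_add2r.
    by apply: mx_measurableB; apply: mX => //; apply: leq_trans le; rewrite addnS.
  by apply/funext => w; rewrite incrementE.
have msum (f : nat -> T -> 'cV[R]_d) : (forall i, (0 < i <= bN)%N -> mx_measurable (f i)) ->
    mx_measurable (fun w => \sum_(1 <= i < bN.+1) f i w).
  move=> mf; rewrite (_ : (fun w => _) =
      (fun w => \sum_(i <- index_iota 1 bN.+1) (if (0 < i <= bN)%N then f i w else 0))).
    apply: mx_measurable_sum => i; case ib: (0 < i <= bN)%N; first exact: mf.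
    exact: mx_measurable_cst.
  apply/funext => w; rewrite big_nat [RHS]big_nat; apply: eq_bigr => i.
  by rewrite ltnS => ->.
have mbar : mx_measurable (fun w => (n%:R * h)^-1 *: \sum_(1 <= j < bN.+1) increment n h (X ^~ w) j k).
  apply: mx_measurableZ; first exact: measurable_cst.
  exact: msum.
rewrite /Sigma_hat blocksizeE; apply: mx_measurableZ; first exact: measurable_cst.
rewrite (_ : (fun w => _) = (fun w => \sum_(i <- index_iota 1 bN.+1)
    (if (0 < i <= bN)%N then outer (increment n h (X ^~ w) i k -
      (n%:R * h)^-1 *: \sum_(1 <= j < bN.+1) increment n h (X ^~ w) j k) else 0))).
  apply: mx_measurable_sum => i; case ib: (0 < i <= bN)%N; last exact: mx_measurable_cst.
  have mi := mx_measurableB (minc i ib) mbar.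
  by apply: mx_measurable_mul => //; exact: mx_measurable_tr.
apply/funext => w; rewrite big_nat [RHS]big_nat; apply: eq_bigr => i.
by rewrite ltnS => ->.
Qed.

End Statistic.

Section Start.
Variables (r bN k0 k1 B : nat).
Hypothesis Bb : ((B * r.+1).*2 <= bN)%N.
Local Notation start := (@start r bN k0 k1 B).

Let pos_lt (g : 'I_B) (j : 'I_r.+1) : (g * r.+1 + j < B * r.+1)%N.
Proof.
apply: (@leq_trans (g.+1 * r.+1)); last by rewrite leq_mul2r ltn_ord orbT.
by rewrite mulSn addnC ltn_add2r.
Qed.

Lemma start_le g j : (start g j + 2 <= (k0 + g.1).+1 * bN)%N.
Proof.
rewrite /start mulSn -addnA addnC leq_add2r (leq_trans _ Bb)//.
by rewrite addn2 -doubleS leq_double; exact: pos_lt.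
Qed.

Lemma start_end g j : (start g j + 2 <= k1 * bN)%N.
Proof.
apply: (leq_trans (start_le g j)); rewrite leq_mul2r; apply/orP; right.
by case: g => -[a a1] g /=; rewrite -addnS -leq_subRL//; lia.
Qed.

Lemma start_ge g j : (k0 * bN <= start g j)%N.
Proof. by rewrite /start mulnDl -addnA leq_addr. Qed.

Lemma start_disj g g' j j' : (g, j) != (g', j') ->
  (start g j + 2 <= start g' j')%N || (start g' j' + 2 <= start g j)%N.
Proof.
have block_lt (g1 g2 : 'I_(k1 - k0) * 'I_B) (i1 i2 : 'I_r.+1) : (g1.1 < g2.1)%N ->
    (start g1 i1 + 2 <= start g2 i2)%N.
  move=> lt; apply: (leq_trans (start_le g1 i1)).
  apply: (@leq_trans ((k0 + g2.1) * bN)); last by rewrite /start leq_addr.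
  by rewrite leq_mul2r -addnS leq_add2l; apply/orP; right.
case: (ltngtP g.1 g'.1) => [lt _|lt _|eq1 ne].
- by apply/orP; left; exact: block_lt.
- by apply/orP; right; exact: block_lt.
have {eq1} eq1 : g.1 = g'.1 by exact: val_inj.
rewrite /start eq1 -!addnA !leq_add2l !addn2 -!doubleS !leq_double.
case: ltngtP => //= epos; exfalso; move/negP: ne; apply.
have eg : g.2 = g'.2 :> nat.
  have /(congr1 (divn^~ r.+1)) := epos.
  by rewrite !divnMDl// !divn_small// !addn0.
have ej : j = j' :> nat by move: epos; rewrite eg => /addnI.
rewrite xpair_eqE; apply/andP; split; last by apply/eqP; exact: val_inj.
by case: g g' eq1 eg {epos block_lt} => [a c] [a' c'] /= -> /val_inj ->.
Qed.

End Start.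

(** Rounding to whole blocks loses at most two, and [u, v] is at least four blocks long, so at least
    (v - u) / (2 h) remain. With B = bN / (2 (r+1)) rounded down and bN >= 4 (r+1), a block has at
    least n h / (4 (r+1)) groups. The product is the stated count. *)
Lemma block_choice (R : realType) (r n bN Kb : nat) (h u v : R) : 0 < h -> (0 < n)%N ->
  n%:R * h = bN%:R -> h^-1 = Kb%:R -> (4 * r.+1 <= bN)%N ->
  0 <= u -> v <= 1 -> 4 * h <= v - u ->
  exists k0 k1 B : nat,
    [/\ u <= k0%:R * h, k1%:R * h <= v, (k1 <= Kb)%N, ((B * r.+1).*2 <= bN)%N &
        (v - u) * n%:R / (8 * r.+1%:R) <= ((k1 - k0) * B)%:R].
Proof.
move=> h0 n0 nh hK bN4 u0 v1 uv.
exists (Num.truncn (u / h)).+1, (Num.truncn (v / h)), (bN %/ r.+1.*2)%N.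
set k0 := (_).+1; set k1 := Num.truncn _; set B := (_ %/ _)%N.
have v0 : 0 <= v by have := u0; have := uv; have := h0; lra.
have uh0 : 0 <= u / h by rewrite divr_ge0// ltW.
have vh0 : 0 <= v / h by rewrite divr_ge0// ltW.
have /andP[k0a k0b] := truncn_itv uh0; have /andP[k1a k1b] := truncn_itv vh0.
have len : (v - u) / (2 * h) <= v / h - u / h - 2.
  rewrite -mulrBl ler_pdivrMr ?mulr_gt0//.
  have -> : ((v - u) / h - 2) * (2 * h) = 2 * (v - u) - 4 * h by field; rewrite gt_eqF.
  have := uv; lra.
have len2 : 2 <= (v - u) / (2 * h) by rewrite ler_pdivlMr ?mulr_gt0//; have := uv; lra.
have k01 : (k0 <= k1)%N.
  rewrite -(ler_nat R) /k0 -natr1; rewrite -natr1 in k1b; move: k0a k1b len len2.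
  rewrite -/k1; move: ((Num.truncn (u / h))%:R : R) (k1%:R : R) (u / h) (v / h) ((v - u) / _).
  by move=> *; lra.
have K1 : (v - u) / (2 * h) <= (k1 - k0)%:R.
  rewrite natrB// /k0 -natr1; rewrite -natr1 in k1b; move: k0a k1b len len2.
  rewrite -/k1; move: ((Num.truncn (u / h))%:R : R) (k1%:R : R) (u / h) (v / h) ((v - u) / _).
  by move=> *; lra.
have B4 : (bN <= 4 * r.+1 * B)%N.
  have q2 : (0 < r.+1.*2)%N by rewrite double_gt0.
  have B2 : (2 <= B)%N.
    have e4 : (2 * r.+1.*2 = 4 * r.+1)%N by rewrite -muln2 mulnCA mulnC.
    by rewrite leq_divRL// e4.
  have := ltn_ceil bN q2; rewrite -/B -muln2; clear -B2; nia.
split.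
- by rewrite -ler_pdivrMr// ltW.
- by rewrite -ler_pdivlMr.
- by rewrite -(ler_nat R) -hK (le_trans k1a)// -[leRHS]mul1r ler_pM2r ?invr_gt0.
- by rewrite -muln2 -mulnA muln2; exact: leq_trunc_div.
have -> : (v - u) * n%:R / (8 * r.+1%:R) = (v - u) / (2 * h) * (bN%:R / (4 * r.+1%:R)).
  rewrite -nh; have : r.+1%:R != 0 :> R by rewrite pnatr_eq0.
  by move: (r.+1%:R : R) => q q0; field; rewrite q0 gt_eqF.
rewrite natrM ler_pM//.
- by rewrite (le_trans _ len2).
by rewrite ler_pdivrMr// mulrC -!natrM ler_nat.
Qed.

Section DriftBudget.
Context disp (T : measurableType disp) (R : realType) (P : probability T R).
Context (F : R -> set (set T)) (d : nat) (beta L : R) (b : R -> T -> 'cV[R]_d).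
Hypothesis fF : filtration F.
Hypothesis beta0 : 0 < beta.
Hypothesis L0 : 0 <= L.
Hypothesis hb : holder_drift P F beta L b.
Variables (n : nat) (I : finType) (s : I -> nat).
Hypothesis n0 : (0 < n)%N.
Hypothesis sn : forall i, (s i + 2 <= n)%N.
Local Notation tt i := (i%:R / n%:R : R).

Let nR : 0 < n%:R :> R. Proof. by rewrite ltr0n. Qed.
Let tt0 i : 0 <= tt i. Proof. by rewrite divr_ge0. Qed.
Let ttS i : tt i < tt i.+1. Proof. by rewrite ltr_pM2r ?invr_gt0// ltr_nat. Qed.
Let ttSS i : tt (s i).+1 < tt (s i + 2)%N. Proof. by rewrite addn2. Qed.
Let tt1 i : tt (s i + 2)%N <= 1.
Proof. by rewrite ler_pdivrMr// mul1r ler_nat. Qed.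

Definition drift_total w : \bar R := (\sum_i drift_var b (tt (s i)) (tt (s i + 2)%N) w)%E.

Lemma measurable_drift_total : measurable_fun setT drift_total.
Proof.
apply: emeasurable_sum => i.
exact: (measurable_drift_var fF hb (tt0 _) (ttS _) (ttSS i) (tt1 i)).
Qed.

(** Markov's inequality: at most n / 2 windows of length 2 / n each contribute (2 / n)^2 (1 + L^4)
    in mean, in total 2 (1 + L^4) / n. *)
Lemma prob_drift_total (c : R) : (2 * #|I| <= n)%N -> 0 < c ->
  (P [set w | (c%:E <= drift_total w)%E] <= (2 * (1 + L ^+ 4) / (n%:R * c))%:E)%E.
Proof.
move=> In c0.
have md i : measurable_fun setT (drift_var b (tt (s i)) (tt (s i + 2)%N)).
  exact: (measurable_drift_var fF hb (tt0 _) (ttS _) (ttSS i) (tt1 i)).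
have d0 i w : (0 <= drift_var b (tt (s i)) (tt (s i + 2)%N) w)%E.
  exact: (drift_var_ge0 _ (ttS _) (ttSS i)).
have t0 w : (0 <= drift_total w)%E by apply: sume_ge0.
apply: (@le_trans _ _ (\int[P]_w ((c^-1)%:E * drift_total w))%E).
  apply: prob_le_integral.
  - rewrite -[X in measurable X]setTI; apply: emeasurable_fun_c_infty => //.
    exact: measurable_drift_total.
  - exact: emeasurable_funM measurable_drift_total.
  - by move=> w; rewrite mule_ge0// lee_fin invr_ge0 ltW.
  move=> w /= cw; apply: (@le_trans _ _ ((c^-1)%:E * c%:E)%E).
    by rewrite -EFinM mulVf// gt_eqF.
  by apply: lee_wpmul2l => //; rewrite lee_fin invr_ge0 ltW.
rewrite ge0_integralZl//; last 2 first.
- exact: measurable_drift_total.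
- by rewrite lee_fin invr_ge0 ltW.
rewrite ge0_integral_sum//.
apply: (@le_trans _ _ ((c^-1)%:E * \sum_(i : I) ((2 / n%:R) ^+ 2 * (1 + L ^+ 4))%:E)%E).
  apply: lee_wpmul2l; first by rewrite lee_fin invr_ge0 ltW.
  apply: lee_sum => i _.
  have := integral_drift_var fF beta0 L0 hb (tt0 _) (ttS _) (ttSS i) (tt1 i).
  by have -> : tt (s i + 2)%N - tt (s i) = 2 / n%:R by rewrite natrD mulrDl addrC addKr.
rewrite sumEFin -EFinM lee_fin sumr_const -(mulr_natr (_ * _)).
have L4 : 0 <= 1 + L ^+ 4 by rewrite addr_ge0// exprn_ge0.
have -> : c^-1 * ((2 / n%:R) ^+ 2 * (1 + L ^+ 4) * #|I|%:R) =
    (2 * (1 + L ^+ 4) / (n%:R * c)) * ((2 * #|I|%:R) / n%:R).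
  by field; rewrite !gt_eqF.
rewrite ler_piMr//; first by rewrite divr_ge0// mulr_ge0// ltW.
by rewrite ler_pdivrMr// mul1r -natrM ler_nat.
Qed.

End DriftBudget.

(** * Lower bound for the rejection probability *)

Section Power.
Context disp (T : measurableType disp) (R : realType) (P : probability T R).
Context (F : R -> set (set T)) (m : nat) (W : R -> T -> 'cV[R]_m).
Hypothesis fF : filtration F.
Hypothesis bW : brownian P F W.
Variables (d n : nat) (beta L : R).
Hypothesis n0 : (0 < n)%N.
Variables (b : R -> T -> 'cV[R]_d) (sigma : R -> 'M[R]_(d, m)) (X : R -> T -> 'cV[R]_d).
Hypothesis hb : holder_drift P F beta L b.
Hypothesis ito : is_ito_process P W b sigma X.

Local Notation tt i := (i%:R / n%:R : R).
Local Notation mu := (@lebesgue_measure R).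

Let nR : 0 < n%:R :> R. Proof. by rewrite ltr0n. Qed.
Let tt0 i : 0 <= tt i. Proof. by rewrite divr_ge0. Qed.
Let ttS i : tt i < tt i.+1. Proof. by rewrite ltr_pM2r ?invr_gt0// ltr_nat. Qed.
Let ttSS i : tt i.+1 < tt (i + 2)%N. Proof. by rewrite addn2. Qed.
Let tt01 i : (i <= n)%N -> 0 <= tt i <= 1.
Proof. by move=> ?; rewrite tt0 ler_pdivrMr// mul1r ler_nat. Qed.

Lemma mx_measurable_grid i : (i <= n)%N -> mx_measurable (X (tt i)).
Proof.
move=> /tt01 t01; have [mX _ _] := ito; move=> k j; rewrite ord1 => _ B mB.
by rewrite setTI; exact: mX.
Qed.

(** The decomposition of X holds almost surely for each time separately; the grid is finite, so one
    null set [N] serves for all of it and for the integrability of the drift paths. The vector [z]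
    is left free, to be taken as the Gaussian approximation. *)
Lemma ito_second_difference : exists (J : nat -> T -> 'cV[R]_d) (N : set T),
  [/\ forall i, (i <= n)%N -> is_wiener_integral P W sigma 0 (tt i) (J i),
      measurable N, P N = 0%E &
      forall w, ~ N w -> forall (z : 'cV[R]_d) i, (i + 2 <= n)%N ->
        ((nsq (X (tt (i + 2)%N) w - X (tt i.+1) w - (X (tt i.+1) w - X (tt i) w) - z))%:E <=
         2%:E * drift_var b (tt i) (tt (i + 2)%N) w +
         (2 * nsq (J (i + 2)%N w - J i.+1 w - (J i.+1 w - J i w) - z))%:E)%E].
Proof.
have [_ _ hX] := ito.
pose I t w := \col_c (\int[mu]_(s in `[0, t]) b s w c 0).
have /choice[J hJ] i : exists Y : T -> 'cV[R]_d, (i <= n)%N ->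
    is_wiener_integral P W sigma 0 (tt i) Y /\
    {ae P, forall w, X (tt i) w = X 0 w + I (tt i) w + Y w}.
  have [le|gt] := leqP i n; last by exists (fun=> 0).
  by have [Y hY] := hX _ (tt01 le); exists Y.
have aeX : {ae P, forall w, forall i, (i <= n)%N ->
    X (tt i) w = X 0 w + I (tt i) w + J i w}.
  apply/ae_foralln => i; have [le|gt] := leqP i n; last first.
    by apply: filterE.
  by apply: filterS (hJ i le).2 => w hw.
have [N [mN PN hN]] : P.-negligible (~` [set w |
    (forall c, mu.-integrable `[0, 1] (EFin \o (fun s => b s w c 0))) /\
    (forall i, (i <= n)%N -> X (tt i) w = X 0 w + I (tt i) w + J i w)]).
  exact: (filterI (ae_drift_integrable hb) aeX).
exists J, N; split => // [i le|w Nw z i le]; first exact: (hJ i le).1.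
have [bi XE] : (forall c, mu.-integrable `[0, 1] (EFin \o (fun s => b s w c 0))) /\
    (forall i, (i <= n)%N -> X (tt i) w = X 0 w + I (tt i) w + J i w).
  by apply: contrapT => h; apply: Nw; apply: hN.
have i1n : (i.+1 <= n)%N by apply: leq_trans le; rewrite addn2.
have i0n : (i <= n)%N by apply: leq_trans i1n.
rewrite !XE//.
have eqt : tt i.+1 - tt i = tt (i + 2)%N - tt i.+1.
  by rewrite addn2 -!mulrBl -!natr1; congr (_ / _); ring.
have /andP[_ t21] := tt01 le.
have := drift_second_difference hb (tt0 i) (ttS i) (ttSS i) t21 eqt bi.
move=> /= hI.
have -> : X 0 w + I (tt (i + 2)%N) w + J (i + 2)%N w - (X 0 w + I (tt i.+1) w + J i.+1 w) -
    (X 0 w + I (tt i.+1) w + J i.+1 w - (X 0 w + I (tt i) w + J i w)) - z =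
    (I (tt (i + 2)%N) w - I (tt i.+1) w - (I (tt i.+1) w - I (tt i) w)) +
    (J (i + 2)%N w - J i.+1 w - (J i.+1 w - J i w) - z).
  by apply/colP => c; rewrite !mxE; ring.
apply: (@le_trans _ _ ((2 * nsq (I (tt (i + 2)%N) w - I (tt i.+1) w -
    (I (tt i.+1) w - I (tt i) w)))%:E +
    (2 * nsq (J (i + 2)%N w - J i.+1 w - (J i.+1 w - J i w) - z))%:E)%E).
  by rewrite -EFinD lee_fin nsqD_le.
by rewrite leeD2r// EFinM lee_wpmul2l.
Qed.

End Power.

(** Origin of the constant: the factors 2 and 16 of the threshold e, the 4 of the block inequality,
    the 4 of the success count and the 8 of [block_choice] multiply to 16^3. *)
Lemma signal_budget (R : realFieldType) (D q n l mu kappa G : R) :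
  0 < D -> 0 < q -> 0 < n -> 0 < mu ->
  2 * 16 ^+ 3 * D ^+ 2 * q ^+ 4 * kappa <= l * mu -> l * n / (8 * q) <= G ->
  2 * D * kappa <= mu / (2 * n) / (16 * D * q ^+ 2) / q / 4 * (G / 4).
Proof.
move=> D0 q0 n0 mu0 signal lG; set e := mu / _ / _.
have e0 : 0 <= e / q / 4 / 4 by rewrite !divr_ge0 ?mulr_ge0 ?exprn_ge0// ltW.
have -> : e / q / 4 * (G / 4) = e / q / 4 / 4 * G by field; rewrite gt_eqF.
apply: le_trans (ler_wpM2l e0 lG).
have -> : e / q / 4 / 4 * (l * n / (8 * q)) = l * mu / (16 ^+ 3 * D * q ^+ 4).
  by rewrite /e; field; rewrite !gt_eqF.
rewrite ler_pdivlMr ?mulr_gt0 ?exprn_gt0//.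
by apply: le_trans signal; rewrite le_eqVlt; apply/orP; left; apply/eqP; ring.
Qed.

Lemma inv_count_le (R : realFieldType) (q n h l G : R) :
  0 < q -> 0 < h -> 0 < l -> 0 < n -> 0 < G -> 4 * q <= n * h -> l * n / (8 * q) <= G ->
  16 / G <= 32 * h / l.
Proof.
move=> q0 h0 l0 n0 G0 b4 lG; rewrite ler_pdivrMr//.
have c0 : 0 <= 32 * h / l by rewrite divr_ge0 ?mulr_ge0// ltW.
apply: le_trans (ler_wpM2l c0 lG).
have -> : 32 * h / l * (l * n / (8 * q)) = 4 * (n * h) / q.
  by field; rewrite !gt_eqF.
by rewrite ler_pdivlMr//; move: b4; lra.
Qed.

Section PowerBound.
Context disp (T : measurableType disp) (R : realType) (P : probability T R).
Context (F : R -> set (set T)) (m : nat) (W : R -> T -> 'cV[R]_m).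
Hypothesis fF : filtration F.
Hypothesis bW : brownian P F W.
Variables (d r n bN Kb : nat) (h beta L : R).
Hypothesis rd : (r < d)%N.
Hypothesis h0 : 0 < h.
Hypothesis n0 : (0 < n)%N.
Hypothesis nh : n%:R * h = bN%:R.
Hypothesis hK : h^-1 = Kb%:R.
Hypothesis bN4 : (4 * r.+1 <= bN)%N.
Hypothesis beta0 : 0 < beta.
Hypothesis L0 : 0 <= L.
Variables (Sigma : R -> 'M[R]_d) (b : R -> T -> 'cV[R]_d) (sigma : R -> 'M[R]_(d, m))
  (X : R -> T -> 'cV[R]_d).
Hypothesis hb : holder_drift P F beta L b.
Hypothesis vsigma : volatility sigma.
Hypothesis Spsd : forall t : R, 0 <= t <= 1 -> psd (Sigma t).
Hypothesis SE : forall t : R, 0 <= t <= 1 -> Sigma t = sigma t *m (sigma t)^T.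
Hypothesis ito : is_ito_process P W b sigma X.
Variables (u v mu kappa eta : R).
Hypothesis u0 : 0 <= u.
Hypothesis v1 : v <= 1.
Hypothesis uv : 4 * h <= v - u.
Hypothesis mu0 : 0 < mu.
Hypothesis lam : forall t, u <= t <= v -> mu <= lambda r.+1 (Sigma t).
Hypothesis kappa0 : 0 < kappa.
Hypothesis signal : 2 * 16 ^+ 3 * d%:R ^+ 2 * r.+1%:R ^+ 4 * kappa <= (v - u) * mu.
Hypothesis eta0 : 0 < eta.

Local Notation tt i := (i%:R / n%:R : R).
Local Notation q := r.+1.

(** The three subtracted terms bound, in order, a large drift, a failed Gaussian approximation, and
    fewer than a quarter of the groups succeeding. Outside these events d times the statistic is at
    least 2 d kappa - kappa / 4, which exceeds d kappa. *)
Lemma power_bound :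
  ((1 - (16 * (1 + L ^+ 4) / (n%:R * kappa) + eta + 32 * h / (v - u)))%:E <=
   P [set w | @test R d r n h kappa (X ^~ w) = 1%N])%E.
Proof.
have nR : 0 < n%:R :> R by rewrite ltr0n.
have d0 : (0 < d)%N by rewrite (leq_ltn_trans _ rd).
have dR : 0 < d%:R :> R by rewrite ltr0n.
have qR : 0 < q%:R :> R by [].
have [k0 [k1 [B [uk0 k1v k1K Bb GB]]]] := block_choice h0 n0 nh hK bN4 u0 v1 uv.
have cover := blocks_cover h0 nh hK.
pose G : finType := ('I_(k1 - k0) * 'I_B)%type.
pose st : G -> 'I_q -> nat := @start r bN k0 k1 B.
have cardG : #|G| = ((k1 - k0) * B)%N by rewrite card_prod !card_ord.
have k1n : (k1 * bN <= n)%N by rewrite -cover leq_mul2r k1K orbT.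
have stn g j : (st g j + 2 <= n)%N by apply: leq_trans (start_end Bb g j) k1n.
pose pairs : finType := (G * 'I_q)%type.
have pairs_n : (2 * #|pairs| <= n)%N.
  rewrite card_prod cardG card_ord -mulnA mulnCA mul2n.
  apply: (@leq_trans ((k1 - k0) * bN)); first by rewrite leq_mul2l Bb orbT.
  by apply: leq_trans k1n; rewrite leq_mul2r leq_subr orbT.
have [J [N [wJ mN PN XJ]]] := ito_second_difference n0 hb ito.
(* Over all pairs the approximation then costs at most kappa / 4, as much as the drift off [Dr]; the
   + 1 keeps the denominator positive if there are no pairs. *)
pose eta' := Num.min eta (kappa / (8 * (#|pairs|%:R + 1))).
have eta'0 : 0 < eta'.
  by rewrite lt_min eta0 divr_gt0// mulr_gt0// ltr_wpDl.
have sigma_ge Q : is_proj Q -> d%:R - r%:R <= \tr Q -> forall g j (s : R),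
    tt (st g j) < s <= tt (st g j + 2)%N -> mu <= frob2 (Q *m sigma s).
  move=> pQ trQ g j s /andP[s1 s2].
  have grid k : tt (k * bN)%N = k%:R * h by rewrite natrM -nh; field; rewrite gt_eqF.
  have su : u <= s.
    apply: (le_trans uk0); rewrite -grid; apply: le_trans (ltW s1).
    by rewrite ler_pM2r ?invr_gt0// ler_nat; exact: start_ge.
  have sv : s <= v.
    apply: (le_trans s2); apply: le_trans k1v; rewrite -grid.
    by rewrite ler_pM2r ?invr_gt0// ler_nat; exact: start_end.
  have s01 : 0 <= s <= 1 by rewrite (le_trans u0 su) (le_trans sv v1).
  rewrite frob2_trace// -SE//; apply: le_trans (lambda_le_trace_proj rd (Spsd s01) pQ trQ).
  by apply: lam; rewrite su.
have [z [Bad [mz mBad PBad zJ few]]] := gaussian_skeleton fF bW d0 n0 vsigma wJ mu0 eta'0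
  stn (start_disj Bb) sigma_ge.
set e := mu / (2 * n%:R) / _ in few.
pose good g := [set w | forall j, e <= loo_dist (fun l => z g l w) j].
pose Few := [set w | (\sum_g \1_(good g) w < #|G|%:R / 4 :> R)%R].
pose Dr := [set w | ((kappa / 8)%:E <=
  drift_total b n (fun gj : pairs => st gj.1 gj.2) w)%E].
pose S := [set w | kappa < test_stat r n h (X ^~ w)].
have mT := measurable_test_stat rd h0 n0 nh hK (mx_measurable_grid n0 ito).
have mS : measurable S.
  rewrite (_ : S = ~` [set w | test_stat r n h (X ^~ w) <= kappa]).
    apply: measurableC; rewrite -[X in measurable X]setTI.
    by apply: measurable_fun_le => //; exact: measurable_cst.
  by apply/seteqP; split => w /=; rewrite /S/= ltNge => /negP.
have mFew : measurable Few.
  apply: measurable_lt_set; apply: measurable_sum => g; apply: measurable_indic.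
  by apply: measurable_forall_le_set => j; apply: measurable_loo => l; exact: mz.
have mDr : measurable Dr.
  rewrite -[X in measurable X]setTI; apply: emeasurable_fun_c_infty => //.
  exact: (measurable_drift_total fF hb n0 (fun gj : pairs => stn gj.1 gj.2)).
have sub : ~` S `<=` N `|` Bad `|` Dr `|` Few.
  move=> w Sw; apply: contrapT => /not_orP[/not_orP[/not_orP[Nw Bw] Dw] Fw]; apply: Sw.
  rewrite /S/=.
  have Dw' : (drift_total b n (fun gj : pairs => st gj.1 gj.2) w < (kappa / 8)%:E)%E.
    by rewrite ltNge; apply/negP.
  pose err g j := X (tt (st g j + 2)%N) w - X (tt (st g j).+1) w -
    (X (tt (st g j).+1) w - X (tt (st g j)) w) - z g j w.
  have err_le : \sum_g \sum_j nsq (err g j) <= kappa / 2.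
    rewrite -(sum_pair (fun gj : pairs => nsq (err gj.1 gj.2))) -lee_fin -sumEFin.
    apply: (@le_trans _ _ (2%:E * drift_total b n (fun gj : pairs => st gj.1 gj.2) w +
        (kappa / 4)%:E)%E); last first.
      apply: (@le_trans _ _ (2%:E * (kappa / 8)%:E + (kappa / 4)%:E)%E).
        by rewrite leeD2r// lee_wpmul2l// ltW.
      by rewrite -EFinM -EFinD lee_fin; have := kappa0; lra.
    apply: (@le_trans _ _ (\sum_(gj : pairs) (2%:E * drift_var b (tt (st gj.1 gj.2))
        (tt (st gj.1 gj.2 + 2)%N) w + (2 * eta')%:E))%E).
      apply: lee_sum => -[g j] _ /=.
      apply: (le_trans (XJ w Nw (z g j w) _ (stn g j))).
      by rewrite leeD2l// lee_fin ler_pM2l// zJ.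
    rewrite big_split/= -ge0_sume_distrr; last first.
      move=> gj _; apply: (@drift_var_ge0 _ _ _ _ b _ (tt (st gj.1 gj.2).+1)).
        by rewrite ltr_pM2r ?invr_gt0// ltr_nat.
      by rewrite addn2 ltr_pM2r ?invr_gt0// ltr_nat.
    rewrite leeD2l// sumEFin lee_fin sumr_const -(mulr_natr (2 * eta')).
    have c0 : 0 < 8 * (#|pairs|%:R + 1) :> R by rewrite mulr_gt0// ltr_wpDl.
    have : eta' <= kappa / (8 * (#|pairs|%:R + 1)) by rewrite ge_min lexx orbT.
    rewrite ler_pdivlMr//; have := eta'0; have := kappa0; lra.
  have e0 : 0 <= e by rewrite !divr_ge0 ?mulr_ge0 ?exprn_ge0// ltW.
  have := @test_stat_ge R d r n bN Kb h rd h0 n0 nh hK k0 k1 B k1K Bb (X ^~ w) e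
    (fun g j => z g j w) err (fun g => w \in good g) e0.
  have zerr g j : X (tt (st g j + 2)%N) w - X (tt (st g j).+1) w -
    (X (tt (st g j).+1) w - X (tt (st g j)) w) = z g j w + err g j.
    by rewrite /err [RHS]addrC subrK.
  have gloo g j : w \in good g -> e <= loo_dist (fun l => z g l w) j by rewrite inE => /(_ j).
  move=> /(_ zerr gloo).
  have GF : #|G|%:R / 4 <= \sum_g (w \in good g)%:R :> R.
    rewrite leNgt; apply/negP => lt; apply: Fw; rewrite /Few/=.
    by under eq_bigr do rewrite indicE.
  have eG : 2 * d%:R * kappa <= e / q%:R / 4 * (#|G|%:R / 4).
    have gb : (v - u) * n%:R / (8 * q%:R) <= #|G|%:R by rewrite cardG.
    exact: signal_budget signal gb.
  move=> /= le; have {}eG : 2 * d%:R * kappa <= e / q%:R / 4 * \sum_g (w \in good g)%:R.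
    by apply: (le_trans eG); rewrite ler_wpM2l// !divr_ge0// ltW.
  have dk : kappa <= d%:R * kappa by rewrite ler_peMl ?ler1n// ltW.
  rewrite -(ltr_pM2l dR); move: le eG err_le dk (kappa0).
  move: (e / _ / _ * _) (\sum_g \sum_j nsq (err g j)) (d%:R * test_stat _ _ _ _) => a1 a2 a3; rewrite -(mulrA 2).
  by move: (d%:R * kappa) => a4; lra.
rewrite (_ : [set w | _] = S); last first.
  by apply/seteqP; split => w; rewrite /S/= /test; case: (_ < _).
have PC : (P (~` S) <= P N + P Bad + P Dr + P Few)%E.
  apply: (@le_trans _ _ (P (N `|` Bad `|` Dr `|` Few))).
    apply: le_measure => //; rewrite inE; first exact: measurableC.
    by repeat apply: measurableU.
  have mU2 := measurableU _ _ mN mBad; have mU3 := measurableU _ _ mU2 mDr.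
  apply: (le_trans (measureU2 _ mU3 mFew)); rewrite leeD2r//.
  apply: (le_trans (measureU2 _ mU2 mDr)); rewrite leeD2r//.
  exact: measureU2.
have PDr : (P Dr <= (2 * (1 + L ^+ 4) / (n%:R * (kappa / 8)))%:E)%E.
  apply: (prob_drift_total fF beta0 L0 hb n0 (fun gj => stn gj.1 gj.2) pairs_n).
  by rewrite divr_gt0.
have G0 : 0 < #|G|%:R :> R.
  by rewrite cardG; apply: lt_le_trans GB; rewrite !divr_gt0 ?mulr_gt0//; have := uv; have := h0; lra.
have vu0 : 0 < v - u by have := uv; have := h0; lra.
have [p pE] : exists p : R, P S = p%:E.
  by exists (fine (P S)); rewrite fineK// fin_num_measure.
rewrite probability_setC// pE PN add0e -EFinB in PC; rewrite pE lee_fin.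
have {}PC : 1 - p <= eta + 2 * (1 + L ^+ 4) / (n%:R * (kappa / 8)) + 16 / #|G|%:R.
  rewrite -lee_fin; apply: (le_trans PC); rewrite !EFinD.
  apply: leeD few; apply: leeD PDr; apply: (le_trans PBad).
  by rewrite lee_fin ge_min lexx.
have b4 : 4 * q%:R <= n%:R * h by rewrite nh -natrM ler_nat.
have G16 : 16 / #|G|%:R <= 32 * h / (v - u).
  by apply: (inv_count_le qR h0 vu0 nR G0 b4); rewrite cardG.
have eqL : 2 * (1 + L ^+ 4) / (n%:R * (kappa / 8)) = 16 * (1 + L ^+ 4) / (n%:R * kappa).
  by field; rewrite !gt_eqF.
rewrite eqL in PC; lra.
Qed.
End PowerBound.

(** The supremum need not be attained, so an interval with more than half of the value is taken.
    This is the factor 2 between the 4 in c' and the 2 in the condition [signal]. *)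
Lemma signal_interval (R : realType) (d r : nat) (hbar v : R) (Sigma : R -> 'M[R]_d) :
  0 < v -> (v%:E <= signal_strength r hbar Sigma)%E ->
  exists a b mu : R, [/\ 0 <= a /\ b <= 1, hbar <= b - a, 0 < mu,
    (b - a) * mu = v / 2 & forall t, a <= t <= b -> mu <= lambda r.+1 (Sigma t)].
Proof.
move=> v0 vS.
have /ereal_sup_gt[_ [[a b] [/= a0 ab b1 hb] <-] lt] : ((v / 2)%:E < signal_strength r hbar Sigma)%E.
  by apply: lt_le_trans vS; rewrite lte_fin; lra.
have {}lt t : a <= t <= b -> v / 2 < (b - a) * lambda r.+1 (Sigma t).
  move=> tab; rewrite -lte_fin; apply: (lt_le_trans lt); rewrite EFinM lee_wpmul2l//.
    by rewrite lee_fin subr_ge0.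
  by apply: ereal_inf_lbound; exists t => //=; rewrite in_itv.
have ab0 : 0 < b - a.
  rewrite lt_def subr_ge0 ab andbT; apply/negP => /eqP ba.
  by have := lt a; rewrite lexx ab ba mul0r => /(_ isT); lra.
exists a, b, (v / 2 / (b - a)); split => // [||t tab].
- by rewrite !divr_gt0.
- by rewrite mulrC divfK// gt_eqF.
by rewrite ler_pdivrMr// [leRHS]mulrC ltW// lt.
Qed.

Section Consistency.
Context disp (T : measurableType disp) (R : realType) (P : probability T R).
Context (F : R -> set (set T)) (m : nat) (W : R -> T -> 'cV[R]_m).
Hypothesis fF : filtration F.
Hypothesis bW : brownian P F W.
Variables (d r : nat) (beta L C : R).
Hypothesis rd : (r < d)%N.
Hypothesis beta0 : 0 < beta.
Hypothesis L0 : 0 <= L.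
Variables (h c hbar : nat -> R) (n : nat).
Hypothesis h01 : 0 < h n <= 1.
Hypothesis nh_nat : n%:R * h n \is a Num.nat.
Hypothesis hK_nat : (h n)^-1 \is a Num.nat.
Hypothesis nh4 : 2 * r.+1%:R * 2 <= n%:R * h n.
Hypothesis c0 : 0 < c n.
Hypothesis hb4 : 4 <= hbar n / h n.

Local Notation kappa := (critical_value beta L h c n).
Local Notation gap := (4 * 16 ^+ 3 * d%:R ^+ 2 * r.+1%:R ^+ 4 : R).

(** The summand n^-1 h^-2 alone gives this, as h <= 1. It makes the drift term of order 1 / (n
    kappa) vanish as c_n grows. *)
Lemma critical_value_ge : (0 < n)%N -> c n <= n%:R * kappa.
Proof.
move=> n0; have nR : 0 < n%:R :> R by rewrite ltr0n.
have /andP[h0 h1] := h01.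
rewrite /critical_value mulrCA -[leLHS]mulr1 ler_pM2l// mulrDr mulVKf ?gt_eqF//.
apply: (@le_trans _ _ (h n ^- 2)); first by rewrite invf_ge1 ?exprn_gt0// exprn_ile1// ltW.
by rewrite lerDl mulr_ge0 ?mulr_ge0// ?powR_ge0.
Qed.

Lemma inf_power_ge :
  ((1 - ((16 * (1 + L ^+ 4) + 1) / c n + 32 / (hbar n / h n)))%:E <=
   inf_prob (H1_powers P F r W beta L (hbar n) (gap * kappa) C (@test R d r n (h n) kappa)))%E.
Proof.
have /andP[h0 h1] := h01.
have n0 : (0 < n)%N.
  rewrite lt0n; apply/eqP => n0; move: nh4; rewrite n0 mul0r leNgt => /negP; apply.
  by rewrite !mulr_gt0.
have nR : 0 < n%:R :> R by rewrite ltr0n.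
have dR : 0 < d%:R :> R by rewrite ltr0n (leq_ltn_trans _ rd).
have cn := critical_value_ge n0.
have kappa0 : 0 < kappa by rewrite -(pmulr_rgt0 _ nR); apply: lt_le_trans cn.
have hbar0 : 0 < hbar n / h n by apply: lt_le_trans hb4.
have L4 : 0 <= 1 + L ^+ 4 by rewrite addr_ge0// exprn_ge0.
apply: le_ereal_inf_tmp => _ [->|[Sigma [b [sigma [X [[[_ Spsd] hb sig _] vs SE ito ->]]]]]].
- by rewrite lee_fin lerBlDr lerDl addr_ge0// divr_ge0 ?(ltW c0) ?(ltW hbar0)// addr_ge0// mulr_ge0.
have gk0 : 0 < gap * kappa.
  by apply: mulr_gt0 (kappa0); do 3 rewrite pmulr_lgt0 ?exprn_gt0//.
have [u [v [mu [[u0 v1] huv mu0 muE lam]]]] := signal_interval gk0 sig.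
have [bN nhE] := natrP nh_nat; have [Kb hKE] := natrP hK_nat.
have bN4 : (4 * r.+1 <= bN)%N.
  by rewrite -(ler_nat R) -nhE natrM; apply: le_trans nh4; rewrite le_eqVlt; apply/orP; left; apply/eqP; ring.
have huv' : hbar n / h n * h n <= v - u by rewrite divfK ?gt_eqF.
have uv : 4 * h n <= v - u by apply: le_trans huv'; rewrite ler_pM2r.
have signal : 2 * 16 ^+ 3 * d%:R ^+ 2 * r.+1%:R ^+ 4 * kappa <= (v - u) * mu.
  by rewrite muE le_eqVlt; apply/orP; left; apply/eqP; field.
(* The failure probability of the Gaussian approximation is free; 1 / c_n merges it with the drift
   term. *)
have eta0 : 0 < (c n)^-1 by rewrite invr_gt0.
apply: le_trans (power_bound fF bW rd h0 n0 nhE hKE bN4 beta0 L0 hb vs Spsd SE ito u0 v1 uv mu0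
  lam kappa0 signal eta0).
have vu0 : 0 < v - u by apply: lt_le_trans uv; rewrite mulr_gt0.
rewrite lee_fin lerD2l lerN2 (mulrDl (16 * _) 1) div1r lerD//.
  rewrite lerD2r; apply: ler_wpM2l; first exact: mulr_ge0.
  by rewrite lef_pV2// posrE; exact: lt_le_trans cn.
by rewrite ler_pdivrMr// mulrAC ler_pdivlMr// -mulrA ler_pM2l// mulrC.
Qed.

End Consistency.

Theorem theorem2p18 (R : realType) (d r : nat) (hr : (r < d)%N) :
  exists Cdr : R, 1 < Cdr /\
  forall (beta L C : R), 0 < beta <= 1 -> 0 <= L -> 0 < C ->
  (* N: the sample sizes n along which the block sizes are admissible *)
  forall (N : set nat) (h c hbar : nat -> R),
    infinite_set N ->
    (forall n, N n ->
      [/\ 0 < h n <= 1, n%:R * h n \is a Num.nat, (h n)^-1 \is a Num.nat &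
          2 * r.+1%:R * Cdr <= n%:R * h n]) ->
    h n @[n --> within N \oo] --> (0 : R) ->
    c n @[n --> within N \oo] --> +oo ->
    (forall n, N n -> 0 < hbar n < 1) ->
    hbar n / h n @[n --> within N \oo] --> +oo ->
  exists c' : R, 0 < c' /\
  forall (disp : measure_display) (T : measurableType disp)
    (P : probability T R) (F : R -> set (set T)) (m : nat)
    (W : R -> T -> 'cV[R]_m),
    filtration F -> brownian P F W ->
    inf_prob (H1_powers P F r W beta L (hbar n)
                (c' * critical_value beta L h c n) C
                (@test R d r n (h n) (critical_value beta L h c n)))
      @[n --> within N \oo] --> 1%E.

Proof.
(* With this constant n h >= 4 (r+1), so that each block holds at least two groups of r+1 pairs of
   increments. *)
exists 2; split; first by rewrite ltr1n.
move=> beta L C /andP[beta0 _] L0 C0 N h c hbar _ Nh _ c_oo Nhbar hbar_oo.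
have dR : 0 < d%:R :> R by rewrite ltr0n (leq_ltn_trans _ hr).
exists (4 * 16 ^+ 3 * d%:R ^+ 2 * r.+1%:R ^+ 4); split; first by rewrite !mulr_gt0 ?exprn_gt0.
move=> disp T P F m W fF bW.
have fN : Filter (within N \oo) by exact: within_filter.
pose lower n := 1 - ((16 * (1 + L ^+ 4) + 1) / c n + 32 / (hbar n / h n)).
have inv0 (f : nat -> R) (a : R) : f n @[n --> within N \oo] --> +oo ->
    a / f n @[n --> within N \oo] --> (0 : R).
  move=> foo; rewrite -[X in _ --> X](mulr0 a); apply: cvgM; first exact: cvg_cst.
  apply/gtr0_cvgV0 => //; move/cvgryPge : foo => /(_ 1).
  by apply: filterS => n; exact: lt_le_trans.
(* The upper bound 1 comes from the element 1 built into [inf_prob]; the lower bound holds for those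
   n in [N] with c_n >= 1 and hbar_n >= 4 h_n. *)
apply: (@squeeze_cvge _ _ _ _ (fun n => (lower n)%:E) _ (fun=> 1%E)).
- have c1 : \forall n \near within N \oo, 1 <= c n by move/cvgryPge : c_oo => /(_ 1).
  have b4 : \forall n \near within N \oo, 4 <= hbar n / h n.
    by move/cvgryPge : hbar_oo => /(_ 4).
  have NN : \forall n \near within N \oo, N n by exact: withinT.
  apply: filterS3 c1 b4 NN => n c1 b4 /Nh[h01 nh hK nh4].
  rewrite inf_power_ge//=; last exact: lt_le_trans c1.
  by apply: ereal_inf_lbound; left.
- apply: cvg_EFin; first by apply: filterE.
  rewrite -[X in _ --> X]subr0 -[X in _ - X](addr0 0).
  by apply: cvgB; [exact: cvg_cst|apply: cvgD; exact: inv0].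
exact: cvg_cst.
Qed.
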